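(* Let $\Gamma\subset\mathrm{SO}(2,2)_\circ$ be a quasi-Fuchsian group. The spacelike geodesic flow of $\mathcal M=\Gamma\backslash\widetilde{\mathcal M}$ satisfies Axiom A, i.e. its non-wandering set is compact, is a hyperbolic set for the flow, and is equal to the closure of the set of periodic points.
   Context: $q(x,y)=-x_1y_1-x_2y_2+x_3y_3+x_4y_4$ on $\mathbb R^4$, $q(x)=q(x,x)$; $\mathrm{AdS}_3=\{q(x)=-1\}$ with Lorentzian metric induced by $q$, whose isometry group has identity component $\mathrm{SO}(2,2)_\circ$. $\partial\mathrm{AdS}_3=\{x\ne0:q(x)=0\}/\mathbb R^+$ is identified with $\mathbb T^2=\{\nu\in\mathbb R^4:\nu_1^2+\nu_2^2=\nu_3^2+\nu_4^2=1\}=\mathbb S^1\times\mathbb S^1$. An acausal circle is a set $\Lambda=\{(F(z),z):z\in\mathbb S^1\}\subset\mathbb T^2$ with $F:\mathbb S^1\to\mathbb S^1$, $|F(z)-F(z')|<|z-z'|$ for $z\ne z'$; $C(\Lambda)=\{x/\sqrt{|q(x)|}: x\in\mathrm{Conv}(\Lambda)\subset\mathbb R^4, q(x)<0\}$; $\mathcal O_+(\Lambda)=\{x\in\mathrm{AdS}_3: q(x,\nu)<0\ \forall\nu\in\Lambda\}$. A subgroup $\Gamma\subset\mathrm{SO}(2,2)_\circ$ is quasi-Fuchsian if it preserves an acausal circle $\Lambda_\Gamma$ (unique) and acts freely, properly discontinuously and co-compactly on $C(\Lambda_\Gamma)$. $T^1\mathrm{AdS}_3=\{(x,v): q(x)=-1,q(x,v)=0,q(v)=1\}$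 with spacelike geodesic flow $\varphi_t(x,v)=(x\cosh t+v\sinh t,x\sinh t+v\cosh t)$; $\widetilde{\mathcal M}=\bigcup_{t\in\mathbb R}\varphi_t(T^1\mathcal O_+(\Lambda_\Gamma))$, where $T^1\mathcal O_+(\Lambda_\Gamma)$ is the part of $T^1\mathrm{AdS}_3$ over $\mathcal O_+(\Lambda_\Gamma)$. $\Gamma$ acts freely and properly discontinuously on $\widetilde{\mathcal M}$, and $\varphi_t$ descends to a complete flow on the manifold $\mathcal M$. Non-wandering set: points $z$ such that for every open $V\ni z$ and $T>0$ there is $t\ge T$ with $\varphi_t(V)\cap V\neq\emptyset$. A compact invariant set $\mathcal K$ is hyperbolic if $T\mathcal M|_{\mathcal K}=\mathbb RX\oplus E_s\oplus E_u$ with continuous $d\varphi_t$-invariant subbundles, $X$ the generator, and constants $C,c>0$ such that (for some Riemannian metric) $\|d\varphi_tw\|\le Ce^{-ct}\|w\|$ for $w\in E_s,t\ge0$ and $\|d\varphi_{t}w\|\le Ce^{-c|t|}\|w\|$ for $w\in E_u,t\le0$. *)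

(* Defs.v *)
From HB Require Import structures.
From mathcomp Require Import all_boot all_order all_algebra.
From mathcomp Require Import generic_quotient.
From mathcomp Require Import ring.
From mathcomp Require Import all_classical all_reals all_analysis.
Import Order.TTheory GRing.Theory Num.Theory.
Import numFieldNormedType.Exports.

Set Implicit Arguments.
Unset Strict Implicit.
Unset Printing Implicit Defensive.

Local Open Scope classical_set_scope.
Local Open Scope ring_scope.

Section QuadraticForm.
Context {R : realType}.

(* Coordinates are numbered from 0: the first two are the negative ones. *)
Definition q (x y : 'cV[R]_4) : R :=
  \sum_(i < 4) (-1) ^+ (i < 2)%N * (x i 0 * y i 0).

Definition SO22 : set 'M[R]_4 :=
  [set A | (forall x y, q (A *m x) (A *m y) = q x y) /\ \det A = 1].

Definition SO22o : set 'M[R]_4 := connected_component SO22 1%:M.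

Definition AdS3 : set 'cV[R]_4 := [set x | q x x = -1].

(* The Euclidean norm; the norm [`|x|] of MathComp-Analysis on matrices is the
   sup norm. *)
Definition enorm n (z : 'cV[R]_n) : R := Num.sqrt (\sum_(i < n) z i 0 ^+ 2).

Definition circle : set 'cV[R]_2 := [set z | enorm z = 1].

Definition acausal_circle (L : set 'cV[R]_4) : Prop :=
  exists F : 'cV[R]_2 -> 'cV[R]_2,
    [/\ {homo F : z / circle z},
        forall z z', circle z -> circle z' -> z <> z' ->
          enorm (F z - F z') < enorm (z - z')
      & L = [set (col_mx (F z) z : 'cV[R]_4) | z in circle]].

(* The representative in the torus nu_1^2 + nu_2^2 = nu_3^2 + nu_4^2 = 1 of the
   ray spanned by a nonzero null vector: on such a vector the first two
   coordinates have the same Euclidean norm as the last two. *)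
Definition torus_rep (x : 'cV[R]_4) : 'cV[R]_4 :=
  (enorm (@usubmx R 2 2 1 x))^-1 *: x.

Definition bd_act (A : 'M[R]_4) (nu : 'cV[R]_4) : 'cV[R]_4 :=
  torus_rep (A *m nu).

Definition Conv (S : set 'cV[R]_4) : set 'cV[R]_4 :=
  [set x | exists n (p : 'I_n -> 'cV[R]_4) (l : 'I_n -> R),
     [/\ forall i, S (p i), forall i, 0 <= l i, \sum_i l i = 1
       & x = \sum_i l i *: p i]].

Definition convex_core (L : set 'cV[R]_4) : set 'cV[R]_4 :=
  [set (Num.sqrt `|q x x|)^-1 *: x | x in Conv L `&` [set x | q x x < 0]].

Definition Oplus (L : set 'cV[R]_4) : set 'cV[R]_4 :=
  AdS3 `&` [set x | forall nu, L nu -> q x nu < 0].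

End QuadraticForm.

Record subgroup22 (R : realType) := Subgroup22 {
  sg_set :> set 'M[R]_4;
  sg_sub : sg_set `<=` SO22o;
  sg_one : sg_set 1%:M;
  sg_mul : forall A B, sg_set A -> sg_set B -> sg_set (A *m B);
  sg_inv : forall A, sg_set A -> sg_set (invmx A)
}.

Section QuasiFuchsian.
Context {R : realType}.
Implicit Types (G : set 'M[R]_4) (X L : set 'cV[R]_4).

Definition acts_freely G X :=
  forall A x, G A -> X x -> A *m x = x -> A = 1%:M.

Definition acts_properly_discontinuously G X :=
  forall K, compact K -> K `<=` X ->
    finite_set [set A | G A /\ (mulmx A @` K) `&` K !=set0].

Definition acts_cocompactly G X :=
  exists K, [/\ compact K, K `<=` X & \bigcup_(A in G) (mulmx A @` K) = X].

(* L is the invariant circle of G. *)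
Definition quasi_Fuchsian (G : subgroup22 R) L :=
  [/\ acausal_circle L,
      forall A, sg_set G A -> bd_act A @` L = L,
      acts_freely G (convex_core L),
      acts_properly_discontinuously G (convex_core L)
    & acts_cocompactly G (convex_core L)].

End QuasiFuchsian.

Notation phase R := ('cV[R]_4 * 'cV[R]_4)%type.

Section Flow.
Context {R : realType}.
Implicit Types (s t : R) (z w : phase R) (A : 'M[R]_4) (L : set 'cV[R]_4).

Definition cosh t : R := (expR t + expR (- t)) / 2.
Definition sinh t : R := (expR t - expR (- t)) / 2.

Definition T1AdS3 : set (phase R) :=
  [set z | [/\ q z.1 z.1 = -1, q z.1 z.2 = 0 & q z.2 z.2 = 1]].

Definition flow t z : phase R :=
  (cosh t *: z.1 + sinh t *: z.2, sinh t *: z.1 + cosh t *: z.2).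

Definition act A z : phase R := (A *m z.1, A *m z.2).

Definition Mtilde L : set (phase R) :=
  \bigcup_(t in [set: R]) (flow t @` (T1AdS3 `&` [set z | Oplus L z.1])).

Lemma flowD s t z : flow s (flow t z) = flow (s + t) z.
Proof.
have cD : cosh (s + t) = cosh s * cosh t + sinh s * sinh t.
  by rewrite /cosh /sinh opprD !expRD; field.
have sD : sinh (s + t) = cosh s * sinh t + sinh s * cosh t.
  by rewrite /cosh /sinh opprD !expRD; field.
rewrite /flow cD sD /=; congr pair; apply/matrixP => i j; rewrite !mxE; ring.
Qed.

Lemma flow_act t A z : flow t (act A z) = act A (flow t z).
Proof. by rewrite /flow /act /= !mulmxDr !scalemxAr. Qed.

Lemma act_mul A B z : act A (act B z) = act (A *m B) z.
Proof. by rewrite /act /= !mulmxA. Qed.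

Lemma act_one z : act 1%:M z = z.
Proof. by case: z => x v; rewrite /act /= !mul1mx. Qed.

Lemma Mtilde_flow L t z : Mtilde L z -> Mtilde L (flow t z).
Proof.
by move=> [s _ [y Py <-]]; exists (t + s) => //; exists y; rewrite ?flowD.
Qed.

Definition Mflow L t (z : Mtilde L) : Mtilde L :=
  exist _ (flow t (\val z)) (mem_set (Mtilde_flow t (set_mem (valP z)))).

End Flow.

Section QuotientFlow.
Context {R : realType} (G : subgroup22 R) (L : set 'cV[R]_4).
Local Open Scope quotient_scope.

Lemma sg_det A : sg_set G A -> A \in unitmx.
Proof.
move=> /(@sg_sub _ G) /(@connected_component_sub _ _ _) [_ dA].
by rewrite unitmxE dA unitr1.
Qed.

Definition same_orbit (y z : Mtilde L) : bool :=
  `[< exists2 A, sg_set G A & \val z = act A (\val y) >].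

Lemma same_orbit_refl : reflexive same_orbit.
Proof.
by move=> y; apply/asboolP; exists 1%:M; [exact: sg_one|rewrite act_one].
Qed.

Lemma same_orbit_sym : symmetric same_orbit.
Proof.
have H x y : same_orbit x y -> same_orbit y x.
  move=> /asboolP[A GA e]; apply/asboolP; exists (invmx A); first exact: sg_inv.
  by rewrite e act_mul mulVmx ?act_one// sg_det.
by move=> x y; apply/idP/idP => /H.
Qed.

Lemma same_orbit_trans : transitive same_orbit.
Proof.
move=> y x z /asboolP[A GA e] /asboolP[B GB e']; apply/asboolP.
by exists (B *m A); [exact: sg_mul|rewrite e' e act_mul].
Qed.

Canonical same_orbit_equiv :=
  EquivRel same_orbit same_orbit_refl same_orbit_sym same_orbit_trans.

Definition orbit_space : Type := quotient_topology {eq_quot same_orbit_equiv}.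

Definition orbit_proj (z : Mtilde L) : orbit_space := \pi_(quotient_topology {eq_quot same_orbit_equiv}) z.

Definition qflow (t : R) (p : orbit_space) : orbit_space :=
  orbit_proj (Mflow t (repr p)).

Lemma qflow_orbit_proj t z : qflow t (orbit_proj z) = orbit_proj (Mflow t z).
Proof.
apply/eqmodP => /=; rewrite /same_orbit/=.
have /eqmodP/asboolP[A GA e] : orbit_proj (repr (orbit_proj z)) = orbit_proj z by rewrite /orbit_proj reprK.
by apply/asboolP; exists A => //=; rewrite -flow_act e.
Qed.

End QuotientFlow.

Section Dynamics.
Context {R : realType} {X : topologicalType} (phi : R -> X -> X).

Definition non_wandering : set X :=
  [set z | forall V, open V -> V z -> forall T, 0 < T ->
     exists2 t, T <= t & (phi t @` V) `&` V !=set0].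

Definition periodic_points : set X :=
  [set z | exists2 T, 0 < T & phi T z = z].

Definition invariant_set (K : set X) : Prop := forall t, phi t @` K = K.

End Dynamics.

Section Smooth.
Context {R : realType} {V : normedModType R}.

Fixpoint Ck (k : nat) (U : set V) (f : V -> R^o) : Prop :=
  match k with
  | 0 => forall x, U x -> {for x, continuous f}
  | k'.+1 => (forall x, U x -> differentiable f x) /\
             forall v, Ck k' U (fun x => 'D_v f x)
  end.

(* Smoothness of a function on a subset, for instance a submanifold: it is
   locally the restriction of a smooth function on an open set. *)
Definition smooth_on (S : set V) (f : V -> R^o) : Prop :=
  forall z, S z -> exists (U : set V) (h : V -> R^o),
    [/\ open U, U z, forall k, Ck k U h & {in S `&` U, f =1 h}].

End Smooth.

Section Hyperbolicity.
Context {R : realType} (G : subgroup22 R) (L : set 'cV[R]_4).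
Implicit Types (z w : phase R) (t : R) (K : set (orbit_space G L)).
Implicit Types (S : set (phase R)) (E : phase R -> {vspace phase R}).

(* The tangent space of T1AdS3 at z, by linearizing the defining equations;
   since Mtilde L is open in T1AdS3 it is also that of Mtilde L. *)
Definition tangent z : set (phase R) :=
  [set w | [/\ q z.1 w.1 = 0, q w.1 z.2 + q z.1 w.2 = 0 & q z.2 w.2 = 0]].

Definition flow_generator z : phase R := derive1 (fun t => flow t z) 0.

(* G acts freely and properly discontinuously on Mtilde L, so that the tangent
   bundle of the quotient is the quotient of that of Mtilde L by G. Hence a
   subbundle over K is a G-invariant subbundle over the inverse image of K in
   Mtilde L, and a Riemannian metric on the quotient is a G-invariant one on
   Mtilde L. *)
Definition lift_set K : set (phase R) :=
  [set \val z | z in [set z : Mtilde L | K (orbit_proj G z)]].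

Definition G_invariant S E : Prop := forall A z w,
  sg_set G A -> S z -> (w \in E z) = ('d (act A) z w \in E (act A z)).

Definition flow_invariant S E : Prop := forall t z w,
  S z -> (w \in E z) = ('d (flow t) z w \in E (flow t z)).

Definition continuous_subbundle S E : Prop :=
  (forall z w, S z -> w \in E z -> tangent z w) /\
  (forall z0, S z0 -> exists r (U : set (phase R)) (s : 'I_r -> phase R -> phase R),
     [/\ nbhs z0 U, forall i, {within S `&` U, continuous (s i)}
       & forall z, S z -> U z -> basis_of (E z) [tuple s i z | i < r]]).

(* g z is a bilinear form on the whole of R^8, but only its restriction to the
   tangent space at z, for z in Mtilde L, matters. *)
Definition invariant_Riemannian_metric
    (g : phase R -> phase R -> phase R -> R^o) : Prop :=
  [/\ forall z w, Mtilde L z -> linear (g z w),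
      forall z w w', Mtilde L z -> g z w w' = g z w' w,
      forall z w, Mtilde L z -> tangent z w -> w <> 0 -> 0 < g z w w,
      forall w w', smooth_on (Mtilde L) (fun z => g z w w')
    & forall A z w w', sg_set G A -> Mtilde L z -> tangent z w -> tangent z w' ->
        g (act A z) ('d (act A) z w) ('d (act A) z w') = g z w w'].

Definition hyperbolic K : Prop :=
  [/\ compact K, invariant_set (@qflow R G L) K
    & exists (Es Eu : phase R -> {vspace phase R}) g (C c : R),
      let S := lift_set K in
      let norm z w := Num.sqrt (g z w w) in
      [/\ [/\ continuous_subbundle S Es, G_invariant S Es & flow_invariant S Es],
          [/\ continuous_subbundle S Eu, G_invariant S Eu & flow_invariant S Eu],
          forall z, S z ->
            directv (<[flow_generator z]> + Es z + Eu z) /\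
            forall w, w \in (<[flow_generator z]> + Es z + Eu z)%VS <-> tangent z w,
          [/\ invariant_Riemannian_metric g, 0 < C & 0 < c]
        & (forall z w t, S z -> w \in Es z -> 0 <= t ->
             norm (flow t z) ('d (flow t) z w) <= C * expR (- (c * t)) * norm z w) /\
          (forall z w t, S z -> w \in Eu z -> t <= 0 ->
             norm (flow t z) ('d (flow t) z w) <= C * expR (- (c * `|t|)) * norm z w)]].

Definition Axiom_A : Prop :=
  let NW := non_wandering (@qflow R G L) in
  [/\ compact NW, hyperbolic NW
    & NW = closure (periodic_points (@qflow R G L))].

End Hyperbolicity.

(* Main.v *)
(** Write [a = x + v] and [b = x - v]: the geodesic flow multiplies the null vectors
    [a], [b] by [e^t], [e^-t]. If [A_n] in [Gamma] leaves every bounded set, then, along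
    an ultrafilter, [A_n / |A_n|] tends to a nonzero map [x |-> c q(nu2, x) nu1] with
    [nu1], [nu2] in [Lambda]: the image of the limit is isotropic, as is that of its
    adjoint, and no nonzero null vector is orthogonal to [Lambda].

    If [z] is non-wandering upstairs, then some [A_n phi_(t_n)(z_n)] and [z_n] both tend
    to [z] with [t_n -> oo]. The limit of [A_n / |A_n|] then forces [a] and [b] to lie on
    rays of [Lambda]; the set of such [z] is compact modulo [Gamma] because its base points
    lie in the convex core. Moreover [A_n / |A_n|], being close to a rank one map with a
    positive eigenvalue, has an eigenvector close to [b], and [A_n^-1 / |A_n|] one close
    to [a]; they span the axis of a periodic orbit close to [z].

    The stable and unstable spaces at [z = (x, v)] are [{(u, -u)}] and [{(u, u)}] for [u]
    orthogonal to [x] and [v]. On them the flow acts by [e^-t] and [e^t] times the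
    identity on [u]. If uniform contraction in a [Gamma]-invariant metric failed, one
    would find [e^(-t_n) A_n u_n] not tending to [0], with [u_n] orthogonal to [x_n], [v_n],
    whereas the limit map vanishes on such [u_n]. The metric is a locally finite sum over
    [Gamma] of pullbacks of the Euclidean product weighted by bump functions. *)

From HB Require Import structures.
Require Import Defs.
From mathcomp Require Import all_boot all_order all_algebra.
From mathcomp Require Import all_classical all_reals all_analysis.
From mathcomp Require Import generic_quotient ring lra.
Import Order.TTheory GRing.Theory Num.Theory.
Import numFieldNormedType.Exports.

Set Implicit Arguments.
Unset Strict Implicit.
Unset Printing Implicit Defensive.

Local Open Scope classical_set_scope.
Local Open Scope ring_scope.

(** The hypotheses control the action on the convex core only, while the metric is needed on all of
    [Mtilde L]. The bridge has two halves. A matrix of bounded norm moves a segment joining two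
    points of [L] inside a compact part of the core, so the group contains finitely many matrices of
    norm at most [M]. And the rank one limits cannot kill a point of [Mtilde L], which gives
    [c * |A| <= |act A w|] uniformly for [w] near such a point.

    Uniform constants come from sequences of violations. Their limits are taken along one
    ultrafilter on [nat] finer than the filter at infinity: every bounded sequence then converges
    with no passage to a subsequence, and every sequence of matrices is either bounded or divergent.

    Reversing time exchanges the stable and the unstable directions. Hence a sign [sg] with
    [sg ^+ 2 = 1] is carried through the contraction argument, which is made once for both. *)

Section Limits.
Context {R : realType} {T : Type}.
Implicit Types (F : set_system T) (U : set_system T).

Lemma cvg_mx {F} {FF : Filter F} m n (f : T -> 'M[R]_(m, n)) (l : 'M[R]_(m, n)) :
  (forall i j, f t i j @[t --> F] --> l i j) -> f t @[t --> F] --> l.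
Proof.
move=> h A [P lP PA].
have : \forall t \near F, forall i j, P i j (f t i j).
  by apply: filter_forall => i; apply: filter_forall => j; exact: h (lP i j).
by apply: filterS => t Pt; exact: PA.
Qed.

Lemma cvg_coord {F} {FF : Filter F} m n (f : T -> 'M[R]_(m, n)) (l : 'M[R]_(m, n))
  i j : f t @[t --> F] --> l -> f t i j @[t --> F] --> l i j.
Proof.
by move=> fl A lA; exact: fl (@coord_continuous _ _ _ i j l A lA).
Qed.

Lemma cvg_sum_seq {F} {FF : Filter F} (I : Type) (r : seq I) (f : I -> T -> R) (l : I -> R) :
  (forall i, f i t @[t --> F] --> l i) ->
  (\sum_(i <- r) f i t) @[t --> F] --> \sum_(i <- r) l i.
Proof.
move=> h; elim: r => [|i r ih].
  by rewrite big_nil; under eq_fun do rewrite big_nil; exact: cvg_cst.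
rewrite big_cons; under eq_fun do rewrite big_cons.
by apply: cvgD.
Qed.

Lemma cvg_mulmx {F} {FF : Filter F} m n p (A : T -> 'M[R]_(m, n))
    (B : T -> 'M[R]_(n, p)) (a : 'M[R]_(m, n)) (b : 'M[R]_(n, p)) :
  A t @[t --> F] --> a -> B t @[t --> F] --> b -> A t *m B t @[t --> F] --> a *m b.
Proof.
move=> Aa Bb; apply: cvg_mx => i j; rewrite mxE; under eq_fun do rewrite mxE.
by apply: cvg_sum_seq => k; apply: cvgM; exact: cvg_coord.
Qed.

Lemma ultra_fmap U {UU : UltraFilter U} (Y : Type) (f : T -> Y) :
  UltraFilter (f @ U).
Proof.
split=> [|G GF UG]; first exact: fmap_proper_filter.
rewrite eqEsubset; split => // A GA.
have [//|UnA] := in_ultra_setVsetC (f @^-1` A) UU.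
have /UG GnA : (f @ U) (~` A) by [].
have GAA : G (A `&` ~` A) by exact: filterI.
by have [x []] := filter_ex GAA.
Qed.

(** Takes the place of extracting a convergent subsequence: the ultrafilter is kept, so any number
    of sequences can be made to converge simultaneously. *)
Lemma ultra_cvg U {UU : UltraFilter U} (Y : topologicalType) (K : set Y) (f : T -> Y) :
  compact K -> (\forall t \near U, K (f t)) -> exists2 y, K y & f t @[t --> U] --> y.
Proof.
rewrite compact_ultra => cK UK.
by have [y [Ky fy]] := cK _ (ultra_fmap f) UK; exists y.
Qed.

Lemma mx_coord_le m n (x : 'M[R]_(m, n)) i j : `|x i j| <= `|x|.
Proof.
have -> : `|x| = mx_norm x by [].
by rewrite mx_normrE; apply/bigmax_geP; right => /=; exists (i, j).
Qed.

Lemma mx_norm_le m n (x : 'M[R]_(m, n)) e :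
  0 <= e -> (forall i j, `|x i j| <= e) -> `|x| <= e.
Proof.
move=> e0 h; have -> : `|x| = mx_norm x by [].
by rewrite mx_normrE; apply/bigmax_leP; split => // -[i j] _; exact: h.
Qed.

Lemma ultra_mx_cvg U {UU : UltraFilter U} m n (f : T -> 'M[R]_(m, n)) M :
  (\forall t \near U, `|f t| <= M) ->
  exists l : 'M[R]_(m, n), f t @[t --> U] --> l.
Proof.
move=> fM.
have h i j : exists l : R, f t i j @[t --> U] --> l.
  have [|l _ fl] := @ultra_cvg U _ _ `[-M, M] (fun t => f t i j) (@segment_compact R _ _).
    apply: filterS fM => t; rewrite /= in_itv/= -ler_norml; exact/le_trans/mx_coord_le.
  by exists l.
exists (\matrix_(i, j) get [set l : R | f t i j @[t --> U] --> l]).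
by apply: cvg_mx => i j; rewrite mxE; have /getPex := h i j.
Qed.

End Limits.

(** [|A|] is the largest absolute value of an entry, which is submultiplicative only up to the inner
    dimension. *)
Lemma mulmx_norm {R : realType} m n p (A : 'M[R]_(m, n)) (B : 'M[R]_(n, p)) :
  `|A *m B| <= n%:R * `|A| * `|B|.
Proof.
apply: mx_norm_le => [|i j]; first by rewrite !mulr_ge0.
rewrite mxE (le_trans (ler_norm_sum _ _ _))//.
rewrite (le_trans (ler_sum _ (G := fun=> `|A| * `|B|) _))//.
  by move=> k _; rewrite normrM ler_pM// mx_coord_le.
by rewrite sumr_const card_ord -[leLHS]mulr_natl mulrA.
Qed.

(** * The quadratic form and the invariant circle *)

Section Form.
Context {R : realType}.
Implicit Types (x y z : 'cV[R]_4) (A B : 'M[R]_4).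

Definition formmx : 'M[R]_4 := diag_mx (\row_i (-1) ^+ (i < 2)%N).

Lemma qE x y : q x y = (x^T *m formmx *m y) 0 0.
Proof.
rewrite mxE; apply: eq_bigr => i _; rewrite mul_mx_diag !mxE; ring.
Qed.

Lemma qC x y : q x y = q y x.
Proof. by apply: eq_bigr => i _; rewrite [x i 0 * _]mulrC. Qed.

Lemma qDl x y z : q (x + y) z = q x z + q y z.
Proof. by rewrite -big_split; apply: eq_bigr => i _; rewrite mxE /=; ring. Qed.

Lemma qZl (c : R) x y : q (c *: x) y = c * q x y.
Proof. by rewrite mulr_sumr; apply: eq_bigr => i _; rewrite mxE; ring. Qed.

Lemma qDr x y z : q x (y + z) = q x y + q x z.
Proof. by rewrite qC qDl !(qC x). Qed.

Lemma qZr (c : R) x y : q x (c *: y) = c * q x y.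
Proof. by rewrite qC qZl qC. Qed.

Lemma qNl x y : q (- x) y = - q x y.
Proof. by rewrite -scaleN1r qZl mulN1r. Qed.

Lemma qNr x y : q x (- y) = - q x y.
Proof. by rewrite -scaleN1r qZr mulN1r. Qed.

Lemma qBl x y z : q (x - y) z = q x z - q y z.
Proof. by rewrite qDl qNl. Qed.

Lemma qBr x y z : q x (y - z) = q x y - q x z.
Proof. by rewrite qDr qNr. Qed.

Lemma q0l x : q 0 x = 0.
Proof. by rewrite -(scale0r 0) qZl mul0r. Qed.

Lemma q0r x : q x 0 = 0.
Proof. by rewrite qC q0l. Qed.

Definition qlin := (qDl, qDr, qBl, qBr, qNl, qNr, qZl, qZr, q0l, q0r).

Lemma cvg_q {T : Type} {F : set_system T} {FF : Filter F} (f g : T -> 'cV[R]_4) x y :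
  f t @[t --> F] --> x -> g t @[t --> F] --> y -> q (f t) (g t) @[t --> F] --> q x y.
Proof.
move=> fx gy; apply: cvg_sum_seq => i; apply: cvgM; first exact: cvg_cst.
by apply: cvgM; exact: cvg_coord.
Qed.

Lemma q_nondeg x : (forall y, q x y = 0) -> x = 0.
Proof.
move=> h; apply/matrixP => i j; rewrite !mxE ord1.
have := h (delta_mx i 0); rewrite /q (bigD1 i)//= big1 => [|k ki].
  by rewrite mxE !eqxx mulr1 addr0 => /eqP; rewrite mulf_eq0 signr_eq0 => /eqP.
by rewrite mxE (negPf ki) /= mulr0 mulr0.
Qed.

Lemma formmxT : formmx^T = formmx.
Proof. exact: tr_diag_mx. Qed.

Lemma formmxK : formmx *m formmx = 1%:M.
Proof.
rewrite mulmx_diag -diag_const_mx; congr diag_mx.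
by apply/rowP => i; rewrite !mxE -expr2 sqrr_sign.
Qed.

(** The adjoint for [q], equal to the inverse on isometries. It is linear in [A] and preserves the
    norm, so unlike the inverse it passes to limits of rescaled group elements. *)
Definition adjq A : 'M[R]_4 := formmx *m A^T *m formmx.

Lemma adjqE A x y : q (A *m x) y = q x (adjq A *m y).
Proof.
by rewrite !qE /adjq trmx_mul !mulmxA -(mulmxA _ formmx formmx) formmxK mulmx1.
Qed.

Lemma adjqK A : adjq (adjq A) = A.
Proof.
rewrite /adjq !trmx_mul trmxK formmxT !mulmxA formmxK mul1mx -mulmxA formmxK.
by rewrite mulmx1.
Qed.

Lemma adjq_norm A : `|adjq A| = `|A|.
Proof.
suff h B : `|adjq B| <= `|B| by apply/le_anti; rewrite h -{1}(adjqK A) h.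
apply: mx_norm_le => // i j.
rewrite /adjq mul_diag_mx mul_mx_diag !mxE !normrM !normrX normrN1 !expr1n.
by rewrite mul1r mulr1 mx_coord_le.
Qed.

Lemma cvg_adjq {T : Type} {F : set_system T} {FF : Filter F} (f : T -> 'M[R]_4) A :
  f t @[t --> F] --> A -> adjq (f t) @[t --> F] --> adjq A.
Proof.
move=> fA; apply: cvg_mulmx; last exact: cvg_cst.
apply: cvg_mulmx; first exact: cvg_cst.
by apply: cvg_mx => i j; rewrite mxE; under eq_fun do rewrite mxE; exact: cvg_coord.
Qed.

Definition isom A := forall x y, q (A *m x) (A *m y) = q x y.

Lemma isom_adjq A : isom A -> adjq A *m A = 1%:M.
Proof.
move=> iA; suff h x : adjq A *m A *m x = x.
  apply/matrixP => i j; have /matrixP/(_ i 0) := h (delta_mx j 0).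
  by rewrite -colE [col _ _ _ _]mxE => ->; rewrite !mxE eqxx andbT.
apply/eqP; rewrite -subr_eq0; apply/eqP/q_nondeg => y.
rewrite qBl -mulmxA qC -[adjq A *m _]/(adjq A *m _) -adjqE iA qC; exact: subrr.
Qed.

Lemma isom_inv A : isom A -> invmx A = adjq A.
Proof.
move=> /isom_adjq h; have /mulmx1_unit[uA' uA] := h.
by rewrite -[RHS]mulmx1 -(mulmxV uA) mulmxA h mul1mx.
Qed.

End Form.

Section Dot.
Context {R : realType} {n : nat}.
Implicit Types x y z : 'cV[R]_n.

Definition dot x y : R := \sum_i x i 0 * y i 0.

Lemma dotC x y : dot x y = dot y x.
Proof. by apply: eq_bigr => i _; rewrite mulrC. Qed.

Lemma dotDl x y z : dot (x + y) z = dot x z + dot y z.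
Proof. by rewrite -big_split; apply: eq_bigr => i _; rewrite mxE mulrDl. Qed.

Lemma dotZl c x y : dot (c *: x) y = c * dot x y.
Proof. by rewrite mulr_sumr; apply: eq_bigr => i _; rewrite mxE mulrA. Qed.

Lemma dotDr x y z : dot x (y + z) = dot x y + dot x z.
Proof. by rewrite dotC dotDl !(dotC x). Qed.

Lemma dotZr c x y : dot x (c *: y) = c * dot x y.
Proof. by rewrite dotC dotZl dotC. Qed.

Lemma dotNl x y : dot (- x) y = - dot x y.
Proof. by rewrite -scaleN1r dotZl mulN1r. Qed.

Lemma dotNr x y : dot x (- y) = - dot x y.
Proof. by rewrite dotC dotNl dotC. Qed.

Definition dotlin := (dotDl, dotDr, dotNl, dotNr, dotZl, dotZr).

Lemma dot_ge0 x : 0 <= dot x x.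
Proof. by apply: sumr_ge0 => i _; rewrite -expr2 sqr_ge0. Qed.

Lemma dot_eq0 x : dot x x = 0 -> x = 0.
Proof.
move=> /eqP; rewrite psumr_eq0; last by move=> i _; rewrite -expr2 sqr_ge0.
move=> /allP h; apply/matrixP => i j; rewrite mxE ord1.
by have /implyP/(_ isT) := h i (mem_index_enum _); rewrite mulf_eq0 orbb => /eqP.
Qed.

Lemma enormE x : enorm x = Num.sqrt (dot x x).
Proof. by congr Num.sqrt; apply: eq_bigr => i _; rewrite expr2. Qed.

Lemma enorm_sqr x : enorm x ^+ 2 = dot x x.
Proof. by rewrite enormE sqr_sqrtr// dot_ge0. Qed.

Lemma enorm_ge0 x : 0 <= enorm x.
Proof. by rewrite enormE sqrtr_ge0. Qed.

Lemma coord_dot x i : x i 0 ^+ 2 <= dot x x.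
Proof.
rewrite /dot (bigD1 i)//= -expr2 lerDl; apply: sumr_ge0 => j _.
by rewrite -expr2 sqr_ge0.
Qed.

Lemma coord_enorm x i : `|x i 0| <= enorm x.
Proof. by rewrite enormE -sqrtr_sqr ler_wsqrtr// coord_dot. Qed.

Lemma cvg_dot {T : Type} {F : set_system T} {FF : Filter F} (f g : T -> 'cV[R]_n) x y :
  f t @[t --> F] --> x -> g t @[t --> F] --> y -> dot (f t) (g t) @[t --> F] --> dot x y.
Proof.
by move=> fx gy; apply: cvg_sum_seq => i; apply: cvgM; exact: cvg_coord.
Qed.

End Dot.

Lemma circleE {R : realType} (z : 'cV[R]_2) : circle z <-> dot z z = 1.
Proof.
split=> [h|h]; first by rewrite -enorm_sqr h expr1n.
by rewrite /circle/= enormE h sqrtr1.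
Qed.

Lemma q_block {R : realType} (a b c d : 'cV[R]_2) :
  q (col_mx a b : 'cV[R]_4) (col_mx c d) = dot b d - dot a c.
Proof.
rewrite /q (@big_split_ord _ _ _ 2 2) /= addrC; congr (_ + _).
  by apply: eq_bigr => i _; rewrite !(@col_mxEd R 2 2 1) expr0 mul1r.
rewrite -sumrN; apply: eq_bigr => i _; rewrite !(@col_mxEu R 2 2 1).
by rewrite (ltn_ord i) expr1 mulN1r.
Qed.

Section Circle.
Context {R : realType} (L : set 'cV[R]_4).
Hypothesis aL : acausal_circle L.

(** With squared norms the contraction property becomes an inequality between dot products, which
    expand bilinearly. *)
Lemma acausalP : exists F : 'cV[R]_2 -> 'cV[R]_2,
  [/\ forall z, dot z z = 1 -> dot (F z) (F z) = 1,
      forall z z', dot z z = 1 -> dot z' z' = 1 -> z <> z' ->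
        dot (F z - F z') (F z - F z') < dot (z - z') (z - z')
    & forall nu, L nu <-> exists2 z, dot z z = 1 & nu = col_mx (F z) z].
Proof.
have [F [F1 F2 ->]] := aL; exists F; split.
- by move=> z /circleE/F1/circleE.
- move=> z z' /circleE cz /circleE cz' zz'.
  by rewrite -!enorm_sqr ltr_pXn2r ?nnegrE ?enorm_ge0//; exact: F2.
- move=> nu; split=> [[z /circleE cz <-]|[z /circleE cz ->]]; by exists z.
Qed.

Lemma circle_null nu : L nu -> q nu nu = 0.
Proof.
have [F [F1 _ FL]] := acausalP; move=> /FL[z z1 ->].
by rewrite q_block z1 F1// subrr.
Qed.

(** For unit vectors the squared contraction inequality reads [2 - 2 F z . F z' < 2 - 2 z . z'],
    which is the negativity of [q]. *)
Lemma circle_lt0 nu nu' : L nu -> L nu' -> nu <> nu' -> q nu nu' < 0.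
Proof.
have [F [F1 F2 FL]] := acausalP; move=> /FL[z z1 ->] /FL[z' z1' ->] nn.
have zz : z <> z' by move=> e; apply: nn; rewrite e.
have := F2 _ _ z1 z1' zz; rewrite q_block !dotlin !F1// z1 z1' !(dotC z' z) !(dotC (F z')).
lra.
Qed.

Lemma circle_le0 nu nu' : L nu -> L nu' -> q nu nu' <= 0.
Proof.
move=> Ln Ln'; have [->|/eqP nn] := eqVneq nu nu'; first by rewrite circle_null.
exact/ltW/circle_lt0.
Qed.

Lemma circle_enorm nu : L nu -> enorm (@usubmx R 2 2 1 nu) = 1.
Proof.
have [F [F1 _ FL]] := acausalP; move=> /FL[z z1 ->].
by rewrite col_mxKu enormE F1// sqrtr1.
Qed.

Lemma circle_neq0 nu : L nu -> nu <> 0.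
Proof.
move=> /circle_enorm h n0; move: h; rewrite n0 enormE.
suff -> : @usubmx R 2 2 1 0 = 0.
  rewrite /dot big1 ?sqrtr0; last by move=> i _; rewrite !mxE mulr0.
  by move=> /eqP; rewrite eq_sym oner_eq0.
by apply/matrixP => i j; rewrite !mxE.
Qed.

Lemma circle_norm nu : L nu -> `|nu| <= 1.
Proof.
have [F [F1 _ FL]] := acausalP; move=> /FL[z z1 ->].
apply: mx_norm_le => // i j; rewrite ord1 mxE; case: fintype.split => k.
  by rewrite (le_trans (coord_enorm _ k))// enormE F1// sqrtr1.
by rewrite (le_trans (coord_enorm _ k))// enormE z1 sqrtr1.
Qed.

Lemma circle_compact : compact L.
Proof.
have [F [F1 F2 FL]] := acausalP.
rewrite compact_ultra => U UU UL.
have [l Ul] := @ultra_mx_cvg R _ U UU 4 1 id 1 (filterS circle_norm UL).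
pose z := @dsubmx R 2 2 1 l.
have Uz : @dsubmx R 2 2 1 nu @[nu --> U] --> z.
  by apply: cvg_mx => i j; rewrite mxE; under eq_fun do rewrite mxE; exact: cvg_coord.
have z1 : dot z z = 1.
  apply: (@cvg_unique _ (@norm_hausdorff _ _)
      (fmap (fun nu => dot (@dsubmx R 2 2 1 nu) (@dsubmx R 2 2 1 nu)) U)).
    exact: cvg_dot.
  apply: cvg_near_cst; apply: filterS UL => nu /FL[w w1 ->].
  by rewrite col_mxKd.
(* [F] is 1-Lipschitz on the circle, so its values converge along with its arguments. *)
have UF : F (@dsubmx R 2 2 1 nu) @[nu --> U] --> F z.
  apply: cvg_mx => i j; rewrite ord1.
  apply/cvgrPdist_le => e e0.
  have : \forall nu \near U, dot (z - @dsubmx R 2 2 1 nu) (z - @dsubmx R 2 2 1 nu) <= e ^+ 2.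
    have h : dot (z - @dsubmx R 2 2 1 nu) (z - @dsubmx R 2 2 1 nu) @[nu --> U] --> 0.
      rewrite -[0](_ : dot (z - z) (z - z) = _); last by rewrite subrr /dot big1// => k _; rewrite mxE mul0r.
      by apply: cvg_dot; apply: cvgB => //; exact: cvg_cst.
    have e20 : 0 < e ^+ 2 by rewrite exprn_gt0.
    move/cvgrPdist_le : h => /(_ _ e20); apply: filterS => nu.
    by rewrite sub0r normrN ger0_norm// dot_ge0.
  apply: (@filterS2 _ U _ _ _ _ _ UL) => nu /FL[w w1 ->]; rewrite col_mxKd => hw.
  rewrite -ler_sqr ?nnegrE ?(ltW e0)// real_normK ?num_real//.
  have [->|/eqP zw] := eqVneq z w.
    by rewrite subrr expr0n/= sqr_ge0.
  apply: le_trans hw; apply: le_trans (ltW (F2 _ _ z1 w1 zw)).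
  by have := coord_dot (F z - F w) i; rewrite !mxE.
exists l; split => //; apply/FL; exists z => //.
apply: (@cvg_unique _ (@norm_hausdorff _ _) U) Ul _.
apply: cvg_mx => i j; rewrite mxE.
pose f (nu : 'cV[R]_4) := (col_mx (F (@dsubmx R 2 2 1 nu)) (@dsubmx R 2 2 1 nu) : 'cV[R]_4) i j.
have UE : {near U, f =1 (fun nu => nu i j)}.
  by apply: filterS UL => nu /FL[w w1 ->]; rewrite /f col_mxKd.
apply: cvg_trans (near_eq_cvg UE) _.
have : f nu @[nu --> U] --> (col_mx (F z) z : 'cV[R]_4) i j.
  rewrite mxE /f; under eq_fun do rewrite mxE.
  by case: (@fintype.split 2 2 i) => k; exact: cvg_coord.
by rewrite mxE.
Qed.

(* On the circle, a null vector orthogonal to [L] would force [F] to send some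
   pair of antipodal points to antipodal points. *)
Lemma circle_perp0 x : q x x = 0 -> (forall nu, L nu -> q x nu = 0) -> x = 0.
Proof.
have [F [F1 F2 FL]] := acausalP => xx xL.
pose a := @usubmx R 2 2 1 x; pose b := @dsubmx R 2 2 1 x.
have xE : x = col_mx a b by rewrite vsubmxK.
have ab : dot b b = dot a a by apply/eqP; rewrite -subr_eq0 -q_block -xE xx.
have xF z : dot z z = 1 -> dot a (F z) = dot b z.
  move=> z1; apply/eqP; rewrite eq_sym -subr_eq0 -q_block -xE; apply/eqP/xL/FL.
  by exists z.
have [b0|/eqP b0] := eqVneq b 0.
  have a0 : a = 0 by apply: dot_eq0; rewrite -ab b0 /dot big1// => i _; rewrite mxE mul0r.
  by rewrite xE a0 b0 col_mx0.
pose r := enorm b; have rr : r ^+ 2 = dot b b by rewrite enorm_sqr.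
have r0 : r != 0 by apply/eqP => r0; apply: b0; apply: dot_eq0; rewrite -rr r0 expr0n.
have [z zE] : exists z, z = r^-1 *: b by exists (r^-1 *: b).
have z1 : dot z z = 1 by rewrite zE !dotlin -rr; field.
have z1' : dot (- z) (- z) = 1 by rewrite dotNl dotNr opprK.
have bz : dot b z = r by rewrite zE !dotlin -rr; field.
(* Equality case of Cauchy-Schwarz: [dot a (F z) = r], where [a] has norm [r] and [F z] is a unit
   vector. *)
have Fz : F z = r^-1 *: a.
  apply/eqP; rewrite -subr_eq0; apply/eqP/dot_eq0; rewrite !dotlin F1//.
  by rewrite (dotC _ a) !xF// bz -ab -rr; field.
have FNz : F (- z) = - (r^-1 *: a).
  apply/eqP; rewrite -subr_eq0; apply/eqP/dot_eq0; rewrite !dotlin F1//.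
  by rewrite (dotC _ a) !xF// dotNr bz -ab -rr; field.
have zz : z <> - z.
  by move=> e; move: z1; rewrite {1}e dotNl => h; have := dot_ge0 z; lra.
have := F2 _ _ z1 z1' zz; rewrite Fz FNz !opprK !dotlin -ab -rr.
have -> : r^-1 * (r^-1 * r ^+ 2) = 1 by field.
by rewrite z1 ltxx.
Qed.

Lemma circle_other nu : L nu -> exists2 nu', L nu' & nu' <> nu.
Proof.
have [F [F1 F2 FL]] := acausalP; move=> /FL[z z1 ->].
have z1' : dot (- z) (- z) = 1 by rewrite dotNl dotNr opprK.
exists (col_mx (F (- z)) (- z)); first by apply/FL; exists (- z).
move=> /(@eq_col_mx R 2 2 1)[_ e]; have : dot z (- z) = dot z z by rewrite e.
by rewrite dotNr z1; lra.
Qed.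

Lemma circle_nonempty : exists nu, L nu.
Proof.
have [F [F1 F2 FL]] := acausalP.
pose z : 'cV[R]_2 := delta_mx 0 0; exists (col_mx (F z) z); apply/FL; exists z => //.
rewrite /dot (bigD1 0)//= big1 => [|i i0]; first by rewrite !mxE mulr1 addr0.
by rewrite mxE (negPf i0) mul0r.
Qed.

End Circle.

Lemma q_eq0_sep {R : realType} (x : 'cV[R]_4) : x <> 0 -> exists y, q x y = 1.
Proof.
move=> x0; apply: contrapT => h; apply: x0; apply: q_nondeg => y.
apply: contrapT => xy; apply: h; exists ((q x y)^-1 *: y).
by rewrite qZr mulVf//; apply/eqP.
Qed.

(** * The cone over the circle and rank one maps *)

Section Cone.
Context {R : realType} (L : set 'cV[R]_4).
Hypothesis aL : acausal_circle L.

(** The first block of a point of [L] has norm 1, so the scale of a vector of the cone is the norm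
    [s] of its first block and depends continuously on it. Compactness of [L] supplies a limit
    direction, even when the scale tends to 0. *)
Lemma cone_lim {T : Type} {U : set_system T} {UU : UltraFilter U}
    (f : T -> 'cV[R]_4) (y : 'cV[R]_4) :
  (\forall t \near U, exists (c : R) nu, [/\ 0 <= c, L nu & f t = c *: nu]) ->
  f t @[t --> U] --> y -> exists (c : R) nu, [/\ 0 <= c, L nu & y = c *: nu].
Proof.
move=> fL fy.
pose s (x : 'cV[R]_4) := enorm (@usubmx R 2 2 1 x).
have fs : \forall t \near U, exists2 nu, L nu & f t = s (f t) *: nu.
  apply: filterS fL => t [c [nu [c0 Lnu ftE]]]; exists nu => //.
  rewrite {1}ftE; congr (_ *: _); rewrite /s ftE.
  have -> : @usubmx R 2 2 1 (c *: nu) = c *: @usubmx R 2 2 1 nu.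
    by apply/matrixP => i j; rewrite !mxE.
  have := circle_enorm aL Lnu; rewrite !enormE !dotlin mulrA -expr2 sqrtrM ?sqr_ge0//.
  by move=> ->; rewrite mulr1 sqrtr_sqr ger0_norm.
have [g gP] : exists g, \forall t \near U, L (g t) /\ f t = s (f t) *: g t.
  exists (fun t => get [set nu | L nu /\ f t = s (f t) *: nu]).
  by apply: filterS fs => t [nu Lnu e]; apply: (@getPex _ [set nu | L nu /\ _]); exists nu.
have [nu Lnu gnu] : exists2 nu, L nu & g t @[t --> U] --> nu.
  apply: ultra_cvg; first exact: circle_compact aL.
  by apply: filterS gP => t [].
exists (s y), nu; split; [exact: enorm_ge0|exact: Lnu|].
have sy : s (f t) @[t --> U] --> s y.
  rewrite /s enormE; under eq_fun do rewrite enormE.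
  apply: (@continuous_cvg _ _ _ U _ (fun t => dot (@usubmx R 2 2 1 (f t)) (@usubmx R 2 2 1 (f t)))
    (@Num.sqrt R)); first exact: sqrt_continuous.
  suff uy : @usubmx R 2 2 1 (f t) @[t --> U] --> @usubmx R 2 2 1 y by exact: cvg_dot.
  by apply: cvg_mx => i j; rewrite mxE; under eq_fun do rewrite mxE; exact: cvg_coord.
apply: (@cvg_unique _ (@norm_hausdorff _ _) (f @ U)) fy _.
have E : {near U, (fun t => s (f t) *: g t) =1 f} by apply: filterS gP => t [].
by apply: cvg_trans (near_eq_cvg E) _; exact: cvgZ.
Qed.

(** Two distinct points of [L] pair negatively, so an isotropic image cannot contain multiples of
    both: all nonzero images of points of [L] lie on one ray. If [P] kills [L], any point of [L]
    serves. *)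
Lemma isotropic_image (P : 'M[R]_4) :
  (forall x y, q (P *m x) (P *m y) = 0) ->
  (forall nu, L nu -> exists (c : R) nu', [/\ 0 <= c, L nu' & P *m nu = c *: nu']) ->
  exists2 nu1, L nu1 & forall nu, L nu -> exists2 c, 0 <= c & P *m nu = c *: nu1.
Proof.
move=> P0 PL.
have [[nu Lnu Pnu]|h] := pselect (exists2 nu, L nu & P *m nu <> 0); last first.
  have [nu1 Lnu1] := circle_nonempty aL; exists nu1 => // nu Lnu; exists 0 => //.
  by rewrite scale0r; apply: contrapT => Pnu; apply: h; exists nu.
have [c [nu1 [c0 L1 E1]]] := PL _ Lnu; exists nu1 => // nu' Lnu'.
have [c' [nu1' [c0' L1' E1']]] := PL _ Lnu'.
have [->|/eqP nn] := eqVneq nu1 nu1'; first by exists c'.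
have cn0 : c != 0 by apply/eqP => e; apply: Pnu; rewrite E1 e scale0r.
have := P0 nu nu'; rewrite E1 E1' !qlin => /eqP; rewrite !mulf_eq0 (negPf cn0)/=.
rewrite (lt_eqF (circle_lt0 aL L1 L1' nn)) orbF => /eqP ->.
by exists 0 => //; rewrite !scale0r.
Qed.

(* If [x] is orthogonal to [nu2] then so is [P x] to all of [L]; being null, it
   vanishes. Hence [P] and its adjoint both have rank one. *)
Lemma rank_one_limit (P : 'M[R]_4) (nu1 nu2 : 'cV[R]_4) :
  L nu1 -> L nu2 -> P <> 0 ->
  (forall x y, q (P *m x) (P *m y) = 0) ->
  (forall x y, q (adjq P *m x) (adjq P *m y) = 0) ->
  (forall nu, L nu -> exists2 c, 0 <= c & P *m nu = c *: nu1) ->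
  (forall nu, L nu -> exists2 c, 0 <= c & adjq P *m nu = c *: nu2) ->
  exists2 c, c < 0 & forall x, P *m x = (c * q nu2 x) *: nu1.
Proof.
move=> L1 L2 P0 Pi Pi' PL PL'.
have vanish (Q : 'M[R]_4) nu : (forall x y, q (Q *m x) (Q *m y) = 0) ->
    (forall nu', L nu' -> exists2 c, 0 <= c & adjq Q *m nu' = c *: nu) ->
    forall x, q nu x = 0 -> Q *m x = 0.
  move=> Qi QL x nux; apply: (circle_perp0 aL) => // nu' Lnu'.
  have [c _ E] := QL _ Lnu'.
  by rewrite adjqE E qZr qC nux mulr0.
have linear (Q : 'M[R]_4) nu : (forall x y, q (Q *m x) (Q *m y) = 0) -> L nu ->
    (forall nu', L nu' -> exists2 c, 0 <= c & adjq Q *m nu' = c *: nu) ->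
    exists w, forall x, Q *m x = q nu x *: w.
  move=> Qi Lnu QL; have [y y1] := q_eq0_sep (circle_neq0 aL Lnu).
  exists (Q *m y) => x; apply/eqP; rewrite -subr_eq0 scalemxAr -mulmxBr.
  by rewrite (vanish _ _ Qi QL)// qBr qZr y1 mulr1 subrr.
have [w wE] := linear P nu2 Pi L2 PL'.
have [w' wE'] : exists w, forall x, adjq P *m x = q nu1 x *: w.
  by apply: (linear _ _ Pi' L1); rewrite adjqK.
have [y2 y21] := q_eq0_sep (circle_neq0 aL L2).
pose c := q y2 w'.
(* [P x = q nu2 x *: w] and [adjq P x = q nu1 x *: w'] are adjoint to each other; testing at [y2],
   where [q nu2 y2 = 1], shows that [w] is a multiple of [nu1]. *)
have wc : w = c *: nu1.
  apply/eqP; rewrite -subr_eq0; apply/eqP/q_nondeg => y.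
  have := adjqE P y2 y; rewrite wE wE' !qlin y21 /c => h; apply/eqP.
  by rewrite mul1r in h; rewrite h subr_eq0 mulrC.
have PE x : P *m x = (c * q nu2 x) *: nu1 by rewrite wE wc scalerA mulrC.
exists c => //.
have c0 : c != 0.
  apply/eqP => c0; apply: P0; apply/matrixP => i j.
  have /matrixP/(_ i 0) := PE (delta_mx j 0); rewrite c0 mul0r scale0r.
  by rewrite -colE mxE => ->; rewrite !mxE.
(* The sign of [c]: at a point [nu] of [L] other than [nu2] the coefficient [c * q nu2 nu] is
   nonnegative, whereas [q nu2 nu] is negative. *)
have [nu Lnu nn] := circle_other aL L2.
have [l l0 /eqP] := PL _ Lnu; rewrite PE -subr_eq0 -scalerBl scaler_eq0.
case/orP => [|/eqP /(circle_neq0 aL L1)//]; rewrite subr_eq0 => /eqP cl.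
have := circle_lt0 aL L2 Lnu (nesym nn) => qlt.
by rewrite lt_neqAle c0/= -(@ler_nM2r _ (q nu2 nu))// mul0r cl.
Qed.

End Cone.

(** * Divergent sequences in the group *)

Section Dynamics.
Context {R : realType} (G : subgroup22 R) (L : set 'cV[R]_4).
Hypothesis aL : acausal_circle L.
Hypothesis GL : forall A, sg_set G A -> bd_act A @` L = L.

Lemma sg_isom A : sg_set G A -> isom A.
Proof. by move=> /sg_sub/(@connected_component_sub _ _ _)[]. Qed.

Lemma sg_adjq A : sg_set G A -> sg_set G (adjq A).
Proof. by move=> GA; rewrite -isom_inv; [exact: sg_inv|exact: sg_isom]. Qed.

Lemma sg_mulK A : sg_set G A -> adjq A *m A = 1%:M.
Proof. by move=> /sg_isom/isom_adjq. Qed.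

Lemma sg_mulVK A : sg_set G A -> A *m adjq A = 1%:M.
Proof. by move=> /sg_adjq/sg_mulK; rewrite adjqK. Qed.

Lemma bd_actE (A : 'M[R]_4) nu : L (bd_act A nu) ->
  exists2 c, 0 < c & A *m nu = c *: bd_act A nu.
Proof.
rewrite /bd_act /torus_rep; set s := enorm _ => Lnu.
have s0 : s != 0.
  (* The inverse of 0 is 0, so a zero scale would place the zero vector in [L]. *)
  apply/eqP => s0; move: Lnu; rewrite s0 invr0 scale0r.
  by move=> /(circle_neq0 aL).
exists s; last by rewrite scalerA mulfV// scale1r.
by rewrite lt_def s0 enorm_ge0.
Qed.

Lemma sg_circle A nu : sg_set G A -> L nu ->
  exists (c : R) nu', [/\ 0 < c, L nu' & A *m nu = c *: nu'].
Proof.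
move=> GA Lnu; have Lb : L (bd_act A nu) by rewrite -(GL GA); exists nu.
by have [c c0 E] := bd_actE Lb; exists c, (bd_act A nu).
Qed.

Lemma sg_circle_surj A nu' : sg_set G A -> L nu' ->
  exists (c : R) nu, [/\ 0 < c, L nu & A *m nu = c *: nu'].
Proof.
move=> GA Lnu'; have := Lnu'; rewrite -{1}(GL GA) => -[nu Lnu E].
have Lb : L (bd_act A nu) by rewrite E.
by have [c c0 E'] := bd_actE Lb; exists c, nu; rewrite E' E.
Qed.

(** Dividing an isometry by its norm multiplies the form by [|A t|^-2], which tends to 0; the cone
    over [L] is preserved and closed. Both facts hold equally for the adjoints, which are group
    elements of the same norm, so [iso] is applied to either family. *)
Lemma sg_limit {T : Type} {U : set_system T} {UU : UltraFilter U} (A : T -> 'M[R]_4) :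
  (\forall t \near U, sg_set G (A t)) ->
  (forall M, \forall t \near U, M <= `|A t|) ->
  exists (P : 'M[R]_4) (c : R) nu1 nu2, [/\ `|A t|^-1 *: A t @[t --> U] --> P, c < 0, L nu1, L nu2
    & (forall x, P *m x = (c * q nu2 x) *: nu1)
      /\ (forall x, adjq P *m x = (c * q nu1 x) *: nu2)].
Proof.
move=> GA Aoo.
have A0 : \forall t \near U, 0 < `|A t|.
  by apply: filterS (Aoo 1) => t; exact: lt_le_trans.
pose B t := `|A t|^-1 *: A t.
have B1 : \forall t \near U, `|B t| = 1.
  apply: filterS A0 => t At0; rewrite /B mx_normZ normfV normr_id mulVf//.
  by rewrite gt_eqF.
have [P BP] : exists P : 'M[R]_4, B t @[t --> U] --> P.
  by apply: (@ultra_mx_cvg _ _ U _ _ _ _ 1); apply: filterS B1 => t ->.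
have P0 : P <> 0.
  move=> P0; have : (1 : R) = 0.
    apply: (@cvg_unique _ (@norm_hausdorff _ _) ((fun t => `|B t|) @ U)).
      have E : {near U, (fun=> 1) =1 (fun t => `|B t|)} by apply: filterS B1 => t ->.
      by apply: cvg_trans (near_eq_cvg E) _; exact: cvg_cst.
    by rewrite -[0](@normr0 _ 'M[R]_4) -P0; exact: cvg_norm.
  by apply/eqP; rewrite oner_eq0.
have Ainv : `|A t|^-1 @[t --> U] --> (0 : R).
  apply/cvgrPdist_le => e e0; apply: filterS2 A0 (Aoo e^-1) => t At0 At.
  rewrite sub0r normrN ger0_norm ?invr_ge0//.
  by rewrite invf_ple// posrE.
have iso (C : T -> 'M[R]_4) (Q : 'M[R]_4) : (\forall t \near U, sg_set G (C t)) ->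
    (forall t, `|C t| = `|A t|) -> `|C t|^-1 *: C t @[t --> U] --> Q ->
    (forall x y, q (Q *m x) (Q *m y) = 0) /\
    (forall nu, L nu -> exists (c : R) nu', [/\ 0 <= c, L nu' & Q *m nu = c *: nu']).
  move=> GC CA CQ; split=> [x y|nu Lnu].
    apply: (@cvg_unique _ (@norm_hausdorff _ _)
      ((fun t => q ((`|C t|^-1 *: C t) *m x) ((`|C t|^-1 *: C t) *m y)) @ U)).
      by apply: cvg_q; apply: cvg_mulmx => //; exact: cvg_cst.
    have E : {near U, (fun t => `|A t|^-1 * (`|A t|^-1 * q x y)) =1
       (fun t => q ((`|C t|^-1 *: C t) *m x) ((`|C t|^-1 *: C t) *m y))}.
      apply: filterS GC => t /sg_isom iC.
      by rewrite -!scalemxAl !qlin iC CA.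
    apply: cvg_trans (near_eq_cvg E) _; rewrite -[0](mul0r (0 * q x y)).
    apply: cvgM => //; apply: cvgM => //; exact: cvg_cst.
  apply: (cone_lim aL (f := fun t => (`|C t|^-1 *: C t) *m nu) (U := U)).
    apply: filterS GC => t GCt; have [c [nu' [c0 Lnu' E]]] := sg_circle GCt Lnu.
    exists (`|C t|^-1 * c), nu'; split => //; first by rewrite mulr_ge0// ltW.
    by rewrite -scalemxAl E scalerA.
  by apply: cvg_mulmx => //; exact: cvg_cst.
have [Pi PL] := iso A P GA (fun=> erefl) BP.
have BP' : `|adjq (A t)|^-1 *: adjq (A t) @[t --> U] --> adjq P.
  have -> : (fun t => `|adjq (A t)|^-1 *: adjq (A t)) = (fun t => adjq (B t)).
    apply/funext => t; rewrite adjq_norm /adjq /B linearZ/= -scalemxAr -scalemxAl//.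
  exact: cvg_adjq.
have [Pi' PL'] : (forall x y, q (adjq P *m x) (adjq P *m y) = 0) /\
    (forall nu, L nu -> exists (c : R) nu', [/\ 0 <= c, L nu' & adjq P *m nu = c *: nu']).
  apply: (iso (fun t => adjq (A t))) => //; last by move=> t; rewrite adjq_norm.
  by apply: filterS GA => t; exact: sg_adjq.
have [nu1 L1 P1] := isotropic_image aL Pi PL.
have [nu2 L2 P2] := isotropic_image aL Pi' PL'.
have [c c0 PE] := rank_one_limit aL L1 L2 P0 Pi Pi' P1 P2.
exists P, c, nu1, nu2; split => //; split=> // x.
apply/eqP; rewrite -subr_eq0; apply/eqP/q_nondeg => y.
by rewrite qBl qC -adjqE PE !qlin (qC nu2 y); ring.
Qed.

End Dynamics.

Lemma nat_ultrafilter : exists U : set_system nat, UltraFilter U /\ \oo `<=` U.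
Proof. exact: ultraFilterLemma. Qed.

Lemma cvg_pair1 {T : Type} {F : set_system T}
    (U V : topologicalType) (f : T -> U * V) (l : U * V) :
  f t @[t --> F] --> l -> (f t).1 @[t --> F] --> l.1.
Proof. by move=> fl; apply: (cvg_comp f fst fl); exact: cvg_fst. Qed.

Lemma cvg_pair2 {T : Type} {F : set_system T}
    (U V : topologicalType) (f : T -> U * V) (l : U * V) :
  f t @[t --> F] --> l -> (f t).2 @[t --> F] --> l.2.
Proof. by move=> fl; apply: (cvg_comp f snd fl); exact: cvg_snd. Qed.

(** * Finiteness of bounded parts of the group *)

Section Discrete.
Context {R : realType} (G : subgroup22 R) (L : set 'cV[R]_4).
Hypothesis aL : acausal_circle L.
Hypothesis GL : forall A, sg_set G A -> bd_act A @` L = L.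

Lemma circle_norm_ge nu : L nu -> 1 <= 2 * `|nu|.
Proof.
move=> Lnu; have : dot (@usubmx R 2 2 1 nu) (@usubmx R 2 2 1 nu) = 1.
  by rewrite -enorm_sqr (circle_enorm aL Lnu) expr1n.
rewrite /dot big_ord_recl big_ord1 !mxE -!expr2 => e.
rewrite -(@ler_pXn2r _ 2)// ?nnegrE ?mulr_ge0// exprMn expr1n.
have h i j : nu i j ^+ 2 <= `|nu| ^+ 2.
  by rewrite -(real_normK (num_real (nu i j))) ler_pXn2r ?nnegrE// mx_coord_le.
have := h (@lshift 2 2 ord0) 0; have := h (@lshift 2 2 (lift ord0 ord0)) 0.
have := sqr_ge0 `|nu|; lra.
Qed.

Definition two_point (p : (R * R) * ('cV[R]_4 * 'cV[R]_4)) : 'cV[R]_4 :=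
  p.1.1 *: p.2.1 + p.1.2 *: p.2.2.

Lemma two_point_continuous : continuous two_point.
Proof.
move=> p; have p1 : t.1 @[t --> p] --> p.1 by exact: cvg_fst.
have p2 : t.2 @[t --> p] --> p.2 by exact: cvg_snd.
by apply: cvgD; apply: cvgZ;
  [exact: cvg_pair1 p1|exact: cvg_pair1 p2|exact: cvg_pair2 p1|exact: cvg_pair2 p2].
Qed.

(** A compact part of the convex core made of points on segments between points of [L]. Two free
    coefficients and the closed condition [q = -1] replace convex weights followed by a
    normalization, so compactness is immediate. *)
Definition two_point_core (r : R) : set 'cV[R]_4 :=
  two_point @` (((`[0, r] `*` `[0, r]) `*` (L `*` L)) `&`
    [set p | q (two_point p) (two_point p) = -1]).

Lemma two_point_core_compact r : compact (two_point_core r).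
Proof.
apply: continuous_compact; first exact/continuous_subspaceT/two_point_continuous.
apply: compact_closedI.
  apply: compact_setX; first by apply: compact_setX; exact: segment_compact.
  by apply: compact_setX; exact: circle_compact aL.
rewrite (_ : mkset _ = (fun p => q (two_point p) (two_point p)) @^-1` [set -1])//.
apply: (proj1 (continuous_closedP _)); last exact: closed_eq.
by move=> p; apply: cvg_q; exact: two_point_continuous.
Qed.

Lemma two_point_core_sub r : two_point_core r `<=` convex_core L.
Proof.
move=> _ [[[s t] [nu nu']] [[[/= s01 t01] [Lnu Lnu']] q1] <-].
move: s01 t01 q1; rewrite !in_itv/= => /andP[s0 _] /andP[t0 _].
rewrite /two_point/=; set x := _ + _ => q1.
have st : 0 < s + t.
  rewrite lt_def addr_ge0// andbT; apply/eqP => st0.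
  have s00 : s = 0 by lra.
  have t00 : t = 0 by lra.
  by move: q1; rewrite /x s00 t00 !scale0r addr0 q0l; lra.
have stn : s + t != 0 by rewrite gt_eqF.
have qp : q ((s + t)^-1 *: x) ((s + t)^-1 *: x) = - (s + t)^-1 ^+ 2.
  by rewrite qZl qZr q1; ring.
exists ((s + t)^-1 *: x).
  split; last by rewrite /= qp oppr_lt0 exprn_gt0// invr_gt0.
  exists 2, (fun i => if i == ord0 then nu else nu'),
    (fun i => (s + t)^-1 * (if i == ord0 then s else t)).
  rewrite !big_ord_recl !big_ord0 /= !addr0; split.
  - by move=> i; case: ifP.
  - by move=> i; rewrite mulr_ge0 ?invr_ge0 ?(ltW st)//; case: ifP.
  - by rewrite -mulrDr mulVf.
  - by rewrite /x scalerDr !scalerA.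
rewrite qp normrN ger0_norm ?sqr_ge0// sqrtr_sqr gtr0_norm ?invr_gt0// invrK.
by rewrite scalerA mulfV// scale1r.
Qed.

(** A fixed point [x0] of the core, on a segment between two points of [L], is sent by [A] to a
    similar point whose coefficients are bounded in terms of [|A|]. Hence [x0] and [A *m x0] lie in
    one compact set, and proper discontinuity leaves finitely many [A]. *)
Lemma sg_bounded_finite (M : R) : acts_properly_discontinuously G (convex_core L) ->
  finite_set [set A | sg_set G A /\ `|A| <= M].
Proof.
move=> Gpd.
have [nu Lnu] := circle_nonempty aL; have [nu' Lnu' nn] := circle_other aL Lnu.
have qn : q nu' nu < 0 by exact: (circle_lt0 aL Lnu' Lnu).
(* Chosen so that [q x0 x0 = 2 * s ^+ 2 * q nu' nu = -1]. *)
pose s := Num.sqrt (- (2 * q nu' nu)^-1).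
have s2 : s ^+ 2 = - (2 * q nu' nu)^-1.
  by rewrite sqr_sqrtr// oppr_ge0 invr_le0; lra.
have s0 : 0 <= s by exact: sqrtr_ge0.
pose x0 := two_point ((s, s), (nu, nu')).
have q1 : q x0 x0 = -1.
  rewrite /x0 /two_point/= !qlin !(circle_null aL)// (qC nu).
  transitivity (s ^+ 2 * (2 * q nu' nu)); first by ring.
  by rewrite s2; field; rewrite lt_eqF.
(* In [8] the factor 4 is the dimension in [mulmx_norm] and the factor 2 comes from
   [circle_norm_ge]. The summand [s] keeps [x0] itself in the box, and [|M|] covers a negative
   [M]. *)
pose r := s + s * (8 * `|M|).
have rs : s <= r by rewrite lerDl !mulr_ge0.
have x0K : two_point_core r x0.
  by exists ((s, s), (nu, nu')) => //; split => //; split => //; split; rewrite /= in_itv/= s0.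
apply: sub_finite_set (Gpd _ (@two_point_core_compact r) (@two_point_core_sub r)).
move=> A [GA AM]; split => //; exists (A *m x0); split; first by exists x0.
have bound c m : L m -> 0 < c -> forall m', L m' -> A *m m' = c *: m -> c <= 8 * `|M|.
  move=> Lm c0 m' Lm' E.
  have h : c <= 2 * `|A *m m'|.
    by rewrite E mx_normZ gtr0_norm// mulrCA ler_peMr ?(ltW c0)// circle_norm_ge.
  apply: le_trans h _; have := mulmx_norm A m'.
  have : `|A| * `|m'| <= `|M| * 1.
    rewrite ler_pM//; last exact: (circle_norm aL Lm').
    exact: le_trans (ler_norm _).
  rewrite -mulrA; lra.
have [c [m [c0 Lm E]]] := sg_circle aL GL GA Lnu.
have [c' [m' [c0' Lm' E']]] := sg_circle aL GL GA Lnu'.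
have Ax0 : A *m x0 = two_point ((s * c, s * c'), (m, m')).
  by rewrite /two_point/= mulmxDr -!scalemxAr E E' !scalerA.
exists ((s * c, s * c'), (m, m')) => //.
have itv d : 0 < d -> d <= 8 * `|M| -> s * d \in `[0, r] by
  move=> d0 dM; rewrite in_itv/= mulr_ge0// ?(ltW d0)//= (le_trans (ler_wpM2l s0 dM))// lerDr.
split.
  split; last by split.
  by split; apply: itv => //; [exact: (bound _ _ Lm _ _ Lnu)|exact: (bound _ _ Lm' _ _ Lnu')].
by rewrite /= -Ax0 (sg_isom GA).
Qed.

End Discrete.

Lemma cvg_pairE {T : Type} {F : set_system T} {FF : Filter F}
    (U V : topologicalType) (f : T -> U * V) (l : U * V) :
  (f t).1 @[t --> F] --> l.1 -> (f t).2 @[t --> F] --> l.2 -> f t @[t --> F] --> l.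
Proof.
case: l => a b /= f1 f2; have -> : f = (fun t => ((f t).1, (f t).2)).
  by apply/funext => t; case: (f t).
exact: cvg_pair.
Qed.

Lemma cvg_ge {R : realType} {T : Type} {F : set_system T} {FF : ProperFilter F}
    (f : T -> R) (l b : R) :
  (\forall t \near F, b <= f t) -> f t @[t --> F] --> l -> b <= l.
Proof. by move=> h; apply: (closed_cvg (fun x : R => b <= x)) => //; exact: closed_ge. Qed.

Lemma cvg_le {R : realType} {T : Type} {F : set_system T} {FF : ProperFilter F}
    (f : T -> R) (l b : R) :
  (\forall t \near F, f t <= b) -> f t @[t --> F] --> l -> l <= b.
Proof. by move=> h; apply: (closed_cvg (fun x : R => x <= b)) => //; exact: closed_le. Qed.

Lemma isom_lim {R : realType} {T : Type} {F : set_system T} {FF : ProperFilter F}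
    (A : T -> 'M[R]_4) (B : 'M[R]_4) :
  (\forall t \near F, isom (A t)) -> A t @[t --> F] --> B -> isom B.
Proof.
move=> iA AB x y; apply: (@cvg_unique _ (@norm_hausdorff _ _)
  ((fun t => q (A t *m x) (A t *m y)) @ F)).
  by apply: cvg_q; apply: cvg_mulmx => //; exact: cvg_cst.
have E : {near F, (fun=> q x y) =1 (fun t => q (A t *m x) (A t *m y))}.
  by apply: filterS iA => t ->.
by apply: cvg_trans (near_eq_cvg E) _; exact: cvg_cst.
Qed.

Lemma norm_lim0 {R : realType} {V : normedModType R} {T : Type} {F : set_system T}
    {FF : ProperFilter F} (f : T -> V) (e : T -> R) (l : V) :
  (\forall t \near F, `|f t| <= e t) -> e t @[t --> F] --> 0 -> f t @[t --> F] --> l -> l = 0.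
Proof.
move=> fe e0 fl; apply: (@cvg_unique _ (@norm_hausdorff _ _) (f @ F)) fl _.
by apply/norm_cvg0P; apply: (squeeze_cvgr (f := fun=> 0)) e0;
  [apply: filterS fe => t ->; rewrite normr_ge0|exact: cvg_cst].
Qed.

(** * The geodesic flow *)

Section FlowFacts.
Context {R : realType}.
Implicit Types (s t : R) (z w : phase R).

Lemma coshDsinh t : cosh t + sinh t = expR t.
Proof. by rewrite /cosh /sinh; field. Qed.

Lemma coshBsinh t : cosh t - sinh t = expR (- t).
Proof. by rewrite /cosh /sinh; field. Qed.

Lemma cosh2Bsinh2 t : cosh t ^+ 2 - sinh t ^+ 2 = 1.
Proof. by rewrite subr_sqr coshDsinh coshBsinh -expRD addNr expR0. Qed.

Lemma flow0 z : flow 0 z = z.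
Proof.
case: z => x v; rewrite /flow /cosh /sinh oppr0 expR0 subrr mul0r !scale0r.
by rewrite addr0 add0r -mulr2n -mulr_natl mulr1 mulfV ?pnatr_eq0// !scale1r.
Qed.

Lemma flowNK t z : flow (- t) (flow t z) = z.
Proof. by rewrite flowD addNr flow0. Qed.

(* For [sg = 1] and [sg = -1] these are the two null vectors [x + v], [x - v]
   spanning the plane of a spacelike geodesic. *)
Lemma flow_null (sg : R) t z : sg ^+ 2 = 1 ->
  (flow (sg * t) z).1 + sg *: (flow (sg * t) z).2 = expR t *: (z.1 + sg *: z.2).
Proof.
move=> sg1; have [->|->] : sg = 1 \/ sg = -1.
- by move/eqP: sg1; rewrite sqrf_eq1 => /orP[]/eqP; [left|right].
- rewrite mul1r !scale1r -coshDsinh /flow/=.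
  by apply/matrixP => i j; rewrite !mxE; ring.
- rewrite mulN1r !scaleN1r -[expR t]/(expR t) -{3}[t]opprK -coshBsinh /flow/=.
  by apply/matrixP => i j; rewrite !mxE; ring.
Qed.

Lemma T1_flow t z : T1AdS3 z -> T1AdS3 (flow t z).
Proof.
have c2 := cosh2Bsinh2 t.
move=> [xx xv vv]; rewrite /flow; split; rewrite /= !qlin (qC z.2 z.1) xx xv vv.
- by transitivity (- (cosh t ^+ 2 - sinh t ^+ 2)); [ring|rewrite c2].
- by ring.
- by transitivity (cosh t ^+ 2 - sinh t ^+ 2); [ring|rewrite c2].
Qed.

Lemma T1_act (A : 'M[R]_4) z : isom A -> T1AdS3 z -> T1AdS3 (act A z).
Proof. by move=> iA [xx xv vv]; split; rewrite /act/= iA. Qed.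

Lemma cvg_flow {T : Type} {F : set_system T} {FF : Filter F} (s : T -> R) (f : T -> phase R) t z :
  s u @[u --> F] --> t -> f u @[u --> F] --> z -> flow (s u) (f u) @[u --> F] --> flow t z.
Proof.
move=> st fz.
have eR (g : T -> R) l : g u @[u --> F] --> l -> expR (g u) @[u --> F] --> expR l.
  by move=> gl B lB; exact: gl (@continuous_expR R l B lB).
have ch : cosh (s u) @[u --> F] --> cosh t.
  apply: cvgM; last exact: cvg_cst.
  apply: cvgD; first exact: eR.
  by apply: eR; exact: cvgN.
have sh : sinh (s u) @[u --> F] --> sinh t.
  apply: cvgM; last exact: cvg_cst.
  apply: cvgB; first exact: eR.
  by apply: eR; exact: cvgN.
have f1 := cvg_pair1 fz; have f2 := cvg_pair2 fz.
by apply: cvg_pairE; [exact: (cvgD (cvgZ ch f1) (cvgZ sh f2))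
  |exact: (cvgD (cvgZ sh f1) (cvgZ ch f2))].
Qed.

Lemma cvg_act {T : Type} {F : set_system T} {FF : Filter F} (A : T -> 'M[R]_4)
    (f : T -> phase R) (B : 'M[R]_4) z :
  A u @[u --> F] --> B -> f u @[u --> F] --> z -> act (A u) (f u) @[u --> F] --> act B z.
Proof.
move=> AB fz; apply: cvg_pairE; apply: cvg_mulmx => //; [exact: cvg_pair1|exact: cvg_pair2].
Qed.

Lemma phase_norm1 z : `|z.1| <= `|z|.
Proof. by rewrite prod_normE le_max lexx. Qed.

Lemma phase_norm2 z : `|z.2| <= `|z|.
Proof. by rewrite prod_normE le_max lexx orbT. Qed.

Lemma actZ (A : 'M[R]_4) (c : R) z : act A (c *: z) = c *: act A z.
Proof. by rewrite /act /= -!scalemxAr. Qed.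

Lemma actD (A : 'M[R]_4) z w : act A (z + w) = act A z + act A w.
Proof. by rewrite /act /= !mulmxDr. Qed.

Lemma flowZ t (c : R) z : flow t (c *: z) = c *: flow t z.
Proof. by rewrite /flow; congr pair; apply/matrixP => i j; rewrite !mxE; ring. Qed.

Lemma flow_add t z w : flow t (z + w) = flow t z + flow t w.
Proof. by rewrite /flow; congr pair; apply/matrixP => i j; rewrite !mxE; ring. Qed.

End FlowFacts.

(** * The domain [Mtilde L] and properness of the action on it *)

Section MtildeFacts.
Context {R : realType} (G : subgroup22 R) (L : set 'cV[R]_4).
Hypothesis aL : acausal_circle L.
Hypothesis GL : forall A, sg_set G A -> bd_act A @` L = L.
Implicit Types (z w : phase R).

Lemma MtildeP z : Mtilde L z <->
  T1AdS3 z /\ exists t, forall nu, L nu -> q (flow t z).1 nu < 0.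
Proof.
split=> [[t _ [y [Ty [_ Oy]] <-]]|[Tz [t tz]]].
  by split; [exact: T1_flow|exists (- t); rewrite flowNK].
exists (- t) => //; exists (flow t z); last exact: flowNK.
split; first exact: T1_flow.
by split => //; have [] := T1_flow t Tz.
Qed.

Lemma Mtilde_T1 z : Mtilde L z -> T1AdS3 z.
Proof. by move=> /MtildeP[]. Qed.

Lemma Mtilde_nondeg z nu : Mtilde L z -> L nu -> q z.1 nu = 0 -> q z.2 nu = 0 -> False.
Proof.
move=> /MtildeP[_ [t tz]] Lnu z1 z2; have := tz _ Lnu.
by rewrite /flow/= !qlin z1 z2 !mulr0 addr0 ltxx.
Qed.

Lemma Mtilde_neq0 z : Mtilde L z -> z <> 0.
Proof. by move=> /Mtilde_T1[xx _ _] z0; move: xx; rewrite z0 /= q0l; lra. Qed.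

Lemma Mtilde_act A z : sg_set G A -> Mtilde L z -> Mtilde L (act A z).
Proof.
move=> GA /MtildeP[Tz [t tz]]; apply/MtildeP; split.
  by apply: T1_act => //; exact: sg_isom GA.
exists t => nu' Lnu'; have [c [nu [c0 Lnu E]]] := sg_circle_surj aL GL GA Lnu'.
by rewrite flow_act -(pmulr_rlt0 _ c0) -qZr -E /act/= (sg_isom GA) tz.
Qed.

(** Openness of [Mtilde L] in [T1AdS3], from the compactness of [L]: the flow time [t] that works
    for [z] works nearby, since otherwise points of [L] with nonnegative pairing would converge to
    one for [z]. *)
Lemma Mtilde_near {T : Type} {U : set_system T} {UU : UltraFilter U}
    (f : T -> phase R) z : Mtilde L z -> f u @[u --> U] --> z ->
  (\forall u \near U, T1AdS3 (f u)) -> \forall u \near U, Mtilde L (f u).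
Proof.
move=> /MtildeP[Tz [t tz]] fz Tf.
have [//|h] := in_ultra_setVsetC [set u | Mtilde L (f u)] UU.
pose P u nu := L nu /\ 0 <= q (flow t (f u)).1 nu.
have Ph : \forall u \near U, P u (get (P u)).
  apply: filterS2 h Tf => u nM Tu; apply: (@getPex _ (P u)).
  apply: contrapT => nP; apply: nM; apply/MtildeP; split => //; exists t => nu Lnu.
  by rewrite ltNge; apply/negP => qnu; apply: nP; exists nu.
have [nu Lnu gnu] : exists2 nu, L nu & get (P u) @[u --> U] --> nu.
  apply: ultra_cvg; first exact: circle_compact aL.
  by apply: filterS Ph => u [].
have ft : flow t (f u) @[u --> U] --> flow t z by apply: cvg_flow => //; exact: cvg_cst.
have qc : q (flow t (f u)).1 (get (P u)) @[u --> U] --> q (flow t z).1 nu.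
  by apply: cvg_q => //; exact: cvg_pair1 ft.
have : 0 <= q (flow t z).1 nu.
  by apply: cvg_ge qc; apply: filterS Ph => u [].
by rewrite leNgt tz.
Qed.

(** Makes the sums over the group locally finite. A sequence of violations that is bounded converges
    to an isometry killing [z]. If it diverges, the rank one limit kills both components of [z],
    which are then orthogonal to the same point of [L]; this is excluded in [Mtilde L]. *)
Lemma Mtilde_proper z : Mtilde L z -> exists e c : R,
  [/\ 0 < e, 0 < c & forall A w, sg_set G A -> `|z - w| < e -> c * `|A| <= `|act A w|].
Proof.
move=> Mz; apply: contrapT => nh.
have h (n : nat) : exists Aw : 'M[R]_4 * phase R, [/\ sg_set G Aw.1,
    `|z - Aw.2| < n.+1%:R^-1 & `|act Aw.1 Aw.2| < n.+1%:R^-1 * `|Aw.1| ].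
  apply: contrapT => h; apply: nh; exists n.+1%:R^-1, n.+1%:R^-1; split => // A w GA zw.
  by rewrite leNgt; apply/negP => lt; apply: h; exists (A, w).
have [f fP] := choice h; have [U [UU ooU]] := nat_ultrafilter.
have hU : (n.+1%:R^-1 : R) @[n --> U] --> 0.
  by move=> B /(@cvg_harmonic R) /ooU.
have fz : (f n).2 @[n --> U] --> z.
  apply/cvgrPdist_le => e e0; move/cvgrPdist_le : hU => /(_ _ e0); apply: filterS => n.
  rewrite sub0r normrN ger0_norm//; apply: le_trans; have [_ h2 _] := fP n; exact: ltW.
(* Along an ultrafilter, failing to be bounded already means diverging: this is [oo] below. *)
have [bd|unbd] := pselect (exists M, \forall n \near U, `|(f n).1| <= M).
  have [M bM] := bd; have [A fA] := ultra_mx_cvg bM.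
  have GA : isom A.
    by apply: (isom_lim _ fA); apply: nearW => n; have [/sg_isom] := fP n.
  have az : act A z = 0.
    apply: (norm_lim0 (f := fun n => act (f n).1 (f n).2) (e := fun n => n.+1%:R^-1 * `|M|) (F := U)).
    - apply: filterS bM => n fM; have [_ _ lt] := fP n; rewrite (le_trans (ltW lt))//.
      by rewrite ler_wpM2l// (le_trans fM)// ler_norm.
    - by rewrite -(mul0r `|M|); apply: cvgM => //; exact: cvg_cst.
    - exact: cvg_act.
  have z0 : z = 0.
    have : act (adjq A) (act A z) = z by rewrite act_mul isom_adjq// act_one.
    by move=> <-; rewrite az /act !mulmx0.
  exact: (Mtilde_neq0 Mz).
have oo M : \forall n \near U, M <= `|(f n).1|.
  have [/filterS//|h'] := in_ultra_setVsetC [set n | M <= `|(f n).1|] UU.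
  exfalso; apply: unbd; exists M; apply: filterS h' => n /negP; rewrite -ltNge; exact: ltW.
have GU : \forall n \near U, sg_set G (f n).1 by apply: nearW => n; have [] := fP n.
have [P [c [nu1 [nu2 [BP c0 L1 L2 [PE _]]]]]] := sg_limit aL GL GU oo.
have Pz : act P z = 0.
  apply: (norm_lim0 (f := fun n => act (`|(f n).1|^-1 *: (f n).1) (f n).2) (F := U) _ hU); last exact: cvg_act.
  apply: filterS (oo 1) => n An; have [_ _ lt] := fP n.
  have A0 : 0 < `|(f n).1| by apply: lt_le_trans An.
  have -> : act (`|(f n).1|^-1 *: (f n).1) (f n).2 = `|(f n).1|^-1 *: act (f n).1 (f n).2.
    by rewrite /act -!scalemxAl.
  by rewrite normrZ normfV normr_id mulrC ler_pdivrMr//; exact: ltW.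
have n10 := circle_neq0 aL L1.
have key x : P *m x = 0 -> q x nu2 = 0.
  rewrite PE => /eqP; rewrite scaler_eq0 mulf_eq0 (lt_eqF c0)/= => /orP[/eqP|/eqP//].
  by rewrite qC.
by case: Pz => /key z1 /key z2; exact: (Mtilde_nondeg Mz L2 z1 z2).
Qed.

End MtildeFacts.

(** * Smooth bump functions and an invariant metric *)

Section Bump.
Context {R : realType}.

(** The classical flat function [expR (- x^-1)], with powers of [x^-1] included so that the
    derivative of a member of the family is a combination of members. Smoothness then follows by
    induction on the order for all [n] together. *)
Definition bump (n : nat) (x : R) : R :=
  if 0 < x then x^-1 ^+ n * expR (- x^-1) else 0.

Lemma bump_ge0 n x : 0 <= bump n x.
Proof.
rewrite /bump; case: ifPn => // x0.
by rewrite mulr_ge0 ?expR_ge0// exprn_ge0// invr_ge0 ltW.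
Qed.

Lemma bump_gt0 x : 0 < x -> 0 < bump 0 x.
Proof. by move=> x0; rewrite /bump x0 expr0 mul1r expR_gt0. Qed.

Lemma bump_le0 n x : x <= 0 -> bump n x = 0.
Proof. by rewrite /bump ltNge => ->. Qed.

(** One term of the exponential series at [x^-1] suffices. The quadratic bound makes the difference
    quotient at 0 tend to 0. *)
Lemma bump_le_sqr n x : bump n x <= n.+2`!%:R * x ^+ 2.
Proof.
rewrite /bump; case: ifPn => [x0|_]; last by rewrite mulr_ge0 ?sqr_ge0.
have u0 : 0 < x^-1 by rewrite invr_gt0.
have f0 : (0 : R) < n.+2`!%:R by rewrite ltr0n fact_gt0.
have := @expR_ge1Dxn R x^-1 n.+1 (ltW u0).
set E := expR x^-1 => h.
have E0 : 0 < E by exact: expR_gt0.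
rewrite expRN -/E ler_pdivrMr// -mulrA [_ ^+ 2 * E]mulrC mulrA.
have h' : x^-1 ^+ n.+2 <= n.+2`!%:R * E.
  by rewrite mulrC -ler_pdivrMr//; lra.
have -> : x^-1 ^+ n = x^-1 ^+ n.+2 * x ^+ 2.
  by rewrite -addn2 exprD; field; rewrite gt_eqF.
by rewrite ler_wpM2r ?sqr_ge0.
Qed.

Lemma is_derive_bump (n : nat) (x : R) :
  is_derive x (1 : R) (bump n) (- n%:R * bump n.+1 x + bump n.+2 x).
Proof.
have [x0|x0|->] := ltgtP x 0.
- rewrite !bump_le0 ?(ltW x0)// mulr0 addr0.
  apply: (@near_eq_is_derive _ _ _ (cst (0 : R))).
  by near=> y; rewrite bump_le0//; apply: ltW; near: y; exact: lt_nbhsl.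
- have xn : x != 0 by rewrite gt_eqF.
  apply: (@near_eq_is_derive _ _ _ (fun y : R => y^-1 ^+ n * expR (- y^-1))).
    by near=> y; rewrite /bump ifT//; near: y; exact: lt_nbhsr.
  have dV : is_derive x (1 : R) (fun y : R => y^-1) (- x ^- 2 *: 1).
    exact: (@is_deriveV R id x 1 1).
  have dE := is_derive1_comp (is_derive_expR _) (is_deriveN dV).
  have -> : (fun y : R => y^-1 ^+ n * expR (- y^-1)) =
      ((fun y : R => y^-1) ^+ n * (expR \o (- (fun y : R => y^-1)))).
    by apply/funext => y; rewrite !fctE.
  apply: is_derive_eq (is_deriveM (is_deriveX n dV) dE) _.
  rewrite !fctE /bump x0 /= {dV dE} /GRing.scale/=; set E := expR _.
  by case: n => [|n]; rewrite /= !exprS ?expr0; field.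
- rewrite !bump_le0// mulr0 addr0.
  suff h : h^-1 *: ((bump n \o shift 0) (h *: 1) - bump n 0) @[h --> (0 : R)^'] --> (0 : R).
    by split; [apply/cvg_ex; exists 0|exact: cvg_lim].
  rewrite bump_le0//=.
  apply/norm_cvg0P; apply: (squeeze_cvgr (f := fun=> 0) (h := fun h => n.+2`!%:R * `|h|)).
  + near=> h; rewrite normr_ge0/= addr0 subr0 /GRing.scale/= mulr1 normrM normfV.
    have h0 : h != 0 by near: h; exact: nbhs_dnbhs_neq.
    rewrite mulrC ler_pdivrMr ?normr_gt0// ger0_norm ?bump_ge0//.
    by rewrite -mulrA -expr2 real_normK ?num_real// bump_le_sqr.
  + exact: cvg_cst.
  + suff : n.+2`!%:R * `|h| @[h --> (0 : R)^'] --> n.+2`!%:R * `|0 : R| by rewrite normr0 mulr0.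
    by apply: cvgM; [exact: cvg_cst|apply: cvg_norm; exact: nbhs_dnbhs].
Unshelve. all: end_near. Qed.

End Bump.

(** * Sums, products and compositions of [Ck] functions *)

Section CkCalculus.
Context {R : realType} {V : normedModType R}.
Implicit Types (f g : V -> R^o) (k : nat).
Local Notation Ck := (@Ck R V).

Lemma Ck_continuous k f : Ck k setT f -> continuous f.
Proof.
case: k => [h x|k [h _] x]; first exact: h.
exact/differentiable_continuous/h.
Qed.

(** Needed in the Leibniz and chain rules, where an undifferentiated factor is used one order
    lower. *)
Lemma Ck_pred k f : Ck k.+1 setT f -> Ck k setT f.
Proof.
elim: k f => [f h x _|k IH f [h1 h2]]; first exact: (Ck_continuous h).
by split => // v; apply: IH.
Qed.

Lemma Ck_cst k (c : R) : Ck k setT (fun=> c).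
Proof.
elim: k c => [c x _|k IH c]; first exact: cvg_cst.
split=> [x _|v]; first exact: differentiable_cst.
suff -> : 'D_v (cst c : V -> R^o) = fun=> 0 by exact: IH.
by apply/funext => x; exact: derive_cst.
Qed.

Lemma CkD k f g : Ck k setT f -> Ck k setT g -> Ck k setT (fun x => f x + g x).
Proof.
elim: k f g => [f g hf hg x _|k IH f g [f1 f2] [g1 g2]].
  by apply: cvgD; [exact: hf|exact: hg].
split=> [x _|v]; first by apply: differentiableD; [exact: f1|exact: g1].
suff -> : 'D_v (fun x => f x + g x) = fun x => 'D_v f x + 'D_v g x.
  by apply: IH; [exact: f2|exact: g2].
by apply/funext => x; apply: deriveD; apply: diff_derivable; [exact: f1|exact: g1].
Qed.

Lemma CkM k f g : Ck k setT f -> Ck k setT g -> Ck k setT (fun x => f x * g x).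
Proof.
elim: k f g => [f g hf hg x _|k IH f g Cf Cg].
  by apply: cvgM; [exact: hf|exact: hg].
have [f1 f2] := Cf; have [g1 g2] := Cg.
split=> [x _|v]; first by apply: differentiableM; [exact: f1|exact: g1].
suff -> : 'D_v (fun x => f x * g x) = fun x => f x * 'D_v g x + g x * 'D_v f x.
  by apply: CkD; [apply: (IH f ('D_v g) (Ck_pred Cf)); exact: g2|apply: (IH g ('D_v f) (Ck_pred Cg)); exact: f2].
by apply/funext => x; apply: deriveM; apply: diff_derivable; [exact: f1|exact: g1].
Qed.

Lemma Ck_sum k (I : Type) (r : seq I) (f : I -> V -> R^o) :
  (forall i, Ck k setT (f i)) -> Ck k setT (fun x => \sum_(i <- r) f i x).
Proof.
move=> h; elim: r => [|i r IH].
  by under eq_fun do rewrite big_nil; exact: Ck_cst.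
by under eq_fun do rewrite big_cons; exact: CkD.
Qed.

Lemma Ck_linear k (f : {linear V -> R^o}) : continuous f -> Ck k setT f.
Proof.
move=> cf; case: k => [x _|k]; first exact: cf.
split=> [x _|v]; first exact: linear_differentiable.
suff -> : 'D_v f = fun=> f v by exact: Ck_cst.
by apply/funext => x; rewrite deriveE ?diff_lin//; exact: linear_differentiable.
Qed.

Lemma Ck_bump k n f : Ck k setT f -> Ck k setT (fun x => bump n (f x)).
Proof.
have db (x : R) m : differentiable (bump m : R -> R^o) x.
  by apply/derivable1_diffP; exact: (@ex_derive _ _ _ _ _ _ _ (is_derive_bump m x)).
elim: k n f => [n f hf x _|k IH n f Cf].
  apply: (@continuous_comp _ _ _ f (bump n)); first exact: hf.
  exact/differentiable_continuous.
have [f1 f2] := Cf; split=> [x _|v].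
  by apply: (@differentiable_comp _ _ _ _ f (bump n : R -> R^o)) => //; exact: f1.
suff -> : 'D_v (fun x => bump n (f x) : R^o) = fun x =>
  ('D_v f x : R) * (- n%:R * bump n.+1 (f x) + bump n.+2 (f x)).
  apply: CkM; first exact: f2.
  apply: CkD; last by apply: IH; exact: Ck_pred.
  by apply: CkM; [exact: Ck_cst|apply: IH; exact: Ck_pred].
apply/funext => x.
have fx : differentiable f x by exact: f1.
rewrite deriveE; last exact: (@differentiable_comp _ _ _ _ f (bump n : R -> R^o)).
rewrite (@diff_comp _ _ _ _ f (bump n : R -> R^o))//= diff1E//.
rewrite derive1E deriveE// -[_ *: _]/(_ * _); congr (_ * _).
- by rewrite deriveE.
- by rewrite -deriveE//; have [_ ->] := is_derive_bump n (f x).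
Qed.

End CkCalculus.

Section LinearMaps.
Context {R : realType}.

Lemma Ck_linearP {V : normedModType R} k (f : V -> R^o) :
  linear f -> continuous f -> Ck k setT f.
Proof.
move=> lf cf.
pose Lf : {linear V -> R^o} := HB.pack f (GRing.isLinear.Build R V R^o *:%R f lf).
exact: (@Ck_linear _ _ k Lf).
Qed.

Lemma diff_linear {V W : normedModType R} (f : V -> W) z :
  linear f -> continuous f -> 'd f z = f :> (V -> W).
Proof.
move=> lf cf.
pose Lf : {linear V -> W} := HB.pack f (GRing.isLinear.Build R V W *:%R f lf).
exact: (@diff_lin _ _ _ Lf z cf).
Qed.

Lemma diff_act (A : 'M[R]_4) (z w : phase R) : 'd (act A) z w = act A w.
Proof.
rewrite diff_linear// => [c x y|x]; first by rewrite actD actZ.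
by apply: cvg_act; [exact: cvg_cst|exact: cvg_id].
Qed.

Lemma diff_flow t (z w : phase R) : 'd (flow t) z w = flow t w.
Proof.
rewrite diff_linear// => [c x y|x]; first by rewrite flow_add flowZ.
by apply: cvg_flow; [exact: cvg_cst|exact: cvg_id].
Qed.

End LinearMaps.

Section PhaseDot.
Context {R : realType}.
Implicit Types z w : phase R.

(** A smooth substitute for the sup norm of the phase space, comparable to it by [pdot_norm] and
    [norm_pdot]. *)
Definition pdot z w : R := dot z.1 w.1 + dot z.2 w.2.

Lemma pdotC z w : pdot z w = pdot w z.
Proof. by rewrite /pdot !(dotC z.1) !(dotC z.2). Qed.

Lemma pdotDr z w w' : pdot z (w + w') = pdot z w + pdot z w'.
Proof. by rewrite /pdot /= !dotDr; ring. Qed.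

Lemma pdotZr z w (c : R) : pdot z (c *: w) = c * pdot z w.
Proof. by rewrite /pdot /= !dotZr; ring. Qed.

Lemma pdot_ge0 z : 0 <= pdot z z.
Proof. by rewrite addr_ge0 ?dot_ge0. Qed.

Lemma pdot_gt0 z : z <> 0 -> 0 < pdot z z.
Proof.
move=> z0; rewrite lt_def pdot_ge0 andbT; apply/eqP => /eqP.
rewrite paddr_eq0 ?dot_ge0// => /andP[/eqP/dot_eq0 z1 /eqP/dot_eq0 z2].
by apply: z0; case: z z1 z2 => a b /= -> ->.
Qed.

Lemma dot_norm n (x : 'cV[R]_n) : dot x x <= n%:R * `|x| ^+ 2.
Proof.
rewrite (le_trans (ler_sum _ (G := fun=> `|x| ^+ 2) _))//.
  move=> i _; rewrite -expr2 -(real_normK (num_real (x i 0))).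
  by rewrite ler_pXn2r ?nnegrE// mx_coord_le.
by rewrite sumr_const card_ord -[leLHS]mulr_natl.
Qed.

Lemma norm_dot n (x : 'cV[R]_n) : `|x| ^+ 2 <= dot x x.
Proof.
rewrite -enorm_sqr ler_pXn2r ?nnegrE ?enorm_ge0//.
by apply: mx_norm_le => [|i j]; [exact: enorm_ge0|rewrite ord1 coord_enorm].
Qed.

Lemma pdot_norm z : pdot z z <= 8 * `|z| ^+ 2.
Proof.
have h1 : `|z.1| ^+ 2 <= `|z| ^+ 2 by rewrite ler_pXn2r ?nnegrE// phase_norm1.
have h2 : `|z.2| ^+ 2 <= `|z| ^+ 2 by rewrite ler_pXn2r ?nnegrE// phase_norm2.
have := dot_norm z.1; have := dot_norm z.2; rewrite /pdot; lra.
Qed.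

Lemma norm_pdot z : `|z| ^+ 2 <= pdot z z.
Proof.
have := norm_dot z.1; have := norm_dot z.2; have := dot_ge0 z.1; have := dot_ge0 z.2.
by rewrite /pdot prod_normE /Order.max; case: ifP => _; lra.
Qed.

Lemma Ck_coord1 k i : Ck k setT (fun z : phase R => z.1 i 0 : R^o).
Proof.
apply: Ck_linearP => [c x y|z]; first by rewrite /= !mxE.
by apply: cvg_coord; exact: cvg_fst.
Qed.

Lemma Ck_coord2 k i : Ck k setT (fun z : phase R => z.2 i 0 : R^o).
Proof.
apply: Ck_linearP => [c x y|z]; first by rewrite /= !mxE.
by apply: cvg_coord; exact: cvg_snd.
Qed.

Lemma Ck_pdot_act k (A : 'M[R]_4) : Ck k setT (fun z : phase R => pdot (act A z) (act A z) : R^o).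
Proof.
have h1 i : Ck k setT (fun z : phase R => (A *m z.1) i 0 : R^o).
  under eq_fun do rewrite mxE.
  by apply: Ck_sum => j; apply: CkM; [exact: Ck_cst|exact: Ck_coord1].
have h2 i : Ck k setT (fun z : phase R => (A *m z.2) i 0 : R^o).
  under eq_fun do rewrite mxE.
  by apply: Ck_sum => j; apply: CkM; [exact: Ck_cst|exact: Ck_coord2].
by apply: CkD; apply: Ck_sum => i; apply: CkM.
Qed.

End PhaseDot.

Lemma bump_continuous {R : realType} n : continuous (@bump R n).
Proof.
move=> x; apply/(@differentiable_continuous R R^o R^o)/derivable1_diffP.
exact: (@ex_derive _ _ _ _ _ _ _ (is_derive_bump n x)).
Qed.

Lemma Ck_sub {R : realType} {V : normedModType R} k (f : V -> R^o) (U : set V) :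
  Ck k setT f -> Ck k U f.
Proof.
elim: k f => [f h x _|k IH f [f1 f2]]; first exact: h.
by split=> [x _|v]; [exact: f1|apply: IH; exact: f2].
Qed.

(** * The metric as a locally finite sum over the group *)

Section Metric.
Context {R : realType} (G : subgroup22 R) (L : set 'cV[R]_4).
Hypothesis aL : acausal_circle L.
Hypothesis GL : forall A, sg_set G A -> bd_act A @` L = L.
Hypothesis Gpd : acts_properly_discontinuously G (convex_core L).
Implicit Types (z w : phase R) (A B : 'M[R]_4).

Definition weight k z A : R := bump 0 (k%:R - pdot (act A z) (act A z)).

Definition level k z : R := \sum_(A \in sg_set G) weight k z A.

(** The translates of one compactly supported bump would cover only the orbit of a compact set, so
    cut-offs of all sizes are used: at size [k] an element [A] counts when [|A z|^2 < k] in the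
    Euclidean norm, and a size is discarded once [level k z] reaches 1/2. The inner sum has index
    [k.+1], one more than the cut-off, so that the last size kept before the threshold is crossed
    contributes a positive amount. *)
Definition metric z w w' : R :=
  \sum_(k \in [set: nat]) bump 0 (1 / 2 - level k z) *
    \sum_(A \in sg_set G) weight k.+1 z A * pdot (act A w) (act A w').

Lemma weight_ge0 k z A : 0 <= weight k z A.
Proof. exact: bump_ge0. Qed.

Lemma metricC z w w' : metric z w w' = metric z w' w.
Proof.
apply: eq_fsbigr => k _; congr (_ * _); apply: eq_fsbigr => A _.
by rewrite pdotC.
Qed.

Lemma sum_sg_mulr B (f : 'M[R]_4 -> R) : sg_set G B ->
  \sum_(A \in sg_set G) f (A *m B) = \sum_(A \in sg_set G) f A.
Proof.
move=> GB; apply/esym/(@reindex_fsbig _ _ _ _ _ (fun A => A *m B) (sg_set G) (sg_set G)).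
split=> [A GA|A A' _ _ e|A GA]; first exact: sg_mul.
  by rewrite -[A]mulmx1 -(sg_mulVK GB) mulmxA e -mulmxA (sg_mulVK GB) mulmx1.
exists (A *m adjq B); first by apply: sg_mul => //; exact: sg_adjq.
by rewrite -mulmxA (sg_mulK GB) mulmx1.
Qed.

Lemma level_act B k z : sg_set G B -> level k (act B z) = level k z.
Proof.
move=> GB; rewrite /level -[RHS](sum_sg_mulr (weight k z) GB).
apply: eq_fsbigr => A _.
by rewrite /weight act_mul.
Qed.

Lemma metric_act B z w w' : sg_set G B ->
  metric (act B z) (act B w) (act B w') = metric z w w'.
Proof.
move=> GB; apply: eq_fsbigr => k _; rewrite level_act//; congr (_ * _).
rewrite -[RHS](sum_sg_mulr (fun A => weight k.+1 z A * pdot (act A w) (act A w')) GB).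
apply: eq_fsbigr => A _.
by rewrite /weight !act_mul.
Qed.

(* Near a point of [Mtilde L] all the sums are finite: [|A z| >= c |A|] leaves
   finitely many [A] in each inner sum, and the term [A = 1] of [level k z] tends
   to 1 as [k] grows, so that the outer weights eventually vanish. *)
Lemma metric_local z0 : Mtilde L z0 -> exists (e : R) (N : nat) (F : seq 'M[R]_4),
  [/\ 0 < e /\ (forall A, A \in F -> sg_set G A), forall z, `|z0 - z| < e -> 1 / 2 <= level N z,
      forall k z, (k <= N)%N -> `|z0 - z| < e -> level k z = \sum_(A <- F) weight k z A
    & forall z w w', `|z0 - z| < e -> metric z w w' =
        \sum_(k < N) bump 0 (1 / 2 - \sum_(A <- F) weight k z A) *
          \sum_(A <- F) weight k.+1 z A * pdot (act A w) (act A w')].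
Proof.
move=> Mz0; have [e [c [e0 c0 ec]]] := Mtilde_proper aL GL Mz0.
have fin k : finite_set [set A | sg_set G A /\ `|A| <= c^-1 * k%:R].
  exact: (sg_bounded_finite aL GL _ Gpd).
pose F (k : nat) : seq 'M[R]_4 := finmap.enum_fset (fset_set [set A | sg_set G A /\ `|A| <= c^-1 * k%:R]).
have memF k A : A \in F k <-> sg_set G A /\ `|A| <= c^-1 * k%:R.
  have -> : (A \in F k) = (A \in [set A | sg_set G A /\ `|A| <= c^-1 * k%:R]).
    exact: (in_fset_set (fin k)).
  by rewrite inE.
have supp k z A : `|z0 - z| < e -> sg_set G A -> ~ (`|A| <= c^-1 * k%:R) -> weight k z A = 0.
  move=> ze GA /negP; rewrite -ltNge => kA; rewrite /weight bump_le0// subr_le0.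
  have h1 := ec _ _ GA ze; have h2 := norm_pdot (act A z).
  have h3 : k%:R <= c * `|A| by rewrite -ler_pdivrMl// ltW.
  apply: le_trans h2; case: k {kA} h3 => [_|k h3]; first exact: sqr_ge0.
  rewrite (@le_trans _ _ (k.+1%:R ^+ 2))//.
    by rewrite expr2 ler_peMr// ler1n.
  by rewrite ler_pXn2r ?nnegrE// (le_trans h3).
have sumF k M z (f : 'M[R]_4 -> R) : (k <= M)%N -> `|z0 - z| < e ->
    (forall A, weight k z A = 0 -> f A = 0) ->
    \sum_(A \in sg_set G) f A = \sum_(A <- F M) f A.
  move=> kM ze f0; rewrite -fsbig_finite//; apply/esym/fsbig_widen; first by move=> A [].
  move=> A [GA nA] /=; apply/f0/(supp _ _ _ ze GA) => Ak; apply: nA; split => //.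
  by rewrite (le_trans Ak)// ler_wpM2l ?invr_ge0 ?(ltW c0)// ler_nat.
have levF k M z : (k <= M)%N -> `|z0 - z| < e -> level k z = \sum_(A <- F M) weight k z A.
  by move=> kM ze; rewrite /level (sumF k M z).
pose b := 8 * (`|z0| + e) ^+ 2.
have pb z : `|z0 - z| < e -> pdot z z <= b.
  move=> ze; apply: le_trans (pdot_norm _) _; rewrite ler_wpM2l// ler_pXn2r ?nnegrE ?addr_ge0 ?(ltW e0)//.
  have := ler_normB z0 (z0 - z); rewrite opprB addrC subrK; lra.
(* For [k >= N] the argument of the bump at [A = 1] is at least 2 on the ball, where the bump is at
   least [expR (- 1 / 2) >= 1 / 2]. *)
have [N bN] : exists N : nat, b + 2 <= N%:R.
  exists (Num.trunc (b + 2)).+1; apply: ltW; exact: truncnS_gt.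
have big k z : (N <= k)%N -> `|z0 - z| < e -> 1 / 2 <= level k z.
  move=> Nk ze; rewrite (levF k k z)//.
  (* [F k] may miss the identity when [k] is small compared with [c]. The larger list contains it
     and has the same sum, both being [level k z]. *)
  have [M NM] : exists M : nat, c * `|1%:M : 'M[R]_4| <= M%:R.
    exists (Num.trunc (c * `|1%:M : 'M[R]_4|)).+1; apply: ltW; exact: truncnS_gt.
  have -> : \sum_(A <- F k) weight k z A =
     \sum_(A <- F (maxn k M)) weight k z A.
    by rewrite -!levF ?leq_maxl.
  have in1 : (1%:M : 'M[R]_4) \in F (maxn k M).
    apply/memF; split; first exact: sg_one.
    by rewrite ler_pdivlMl// (le_trans NM)// ler_nat leq_maxr.
  rewrite (bigD1_seq _ in1 (finmap.fset_uniq _))/= ler_wpDr//.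
    by apply: sumr_ge0 => A _; exact: weight_ge0.
  rewrite /weight act_one.
  have k2 : 2 <= k%:R - pdot z z.
    have := pb _ ze; have : N%:R <= k%:R :> R by rewrite ler_nat.
    lra.
  rewrite /bump ifT ?expr0 ?mul1r; last by lra.
  have := expR_ge1Dx (- (k%:R - pdot z z)^-1).
  suff : (k%:R - pdot z z)^-1 <= 1 / 2 by lra.
  by rewrite mul1r lef_pV2// posrE; lra.
exists e, N, (F N); split => //.
- by split => // A /memF[].
- by move=> z ze; exact: big.
- by move=> k z kN ze; exact: levF.
move=> z w w' ze; rewrite /metric.
rewrite -(@fsbig_widen _ _ _ _ `I_N [set: nat])//; last first.
  move=> k [_ /= kN]; rewrite bump_le0 ?mul0r// subr_le0 big// leqNgt; exact/negP.
rewrite -fsbig_ord; apply: eq_bigr => k _; rewrite (levF _ N)// 1?ltnW//.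
by congr (_ * _); rewrite (sumF k.+1 N z)// => A ->; rewrite mul0r.
Qed.

Lemma metric_linear z w : Mtilde L z -> linear (metric z w : phase R -> R^o).
Proof.
move=> /metric_local[e [N [F [[e0 _] _ _ mE]]]] a x y.
have ze : `|z - z| < e by rewrite subrr normr0.
change (metric z w (a *: x + y) = a * metric z w x + metric z w y).
rewrite !mE// mulr_sumr -big_split; apply: eq_bigr => k _ /=.
rewrite mulrCA -mulrDr; congr (_ * _); rewrite mulr_sumr -big_split.
apply: eq_bigr => A _ /=; rewrite actD actZ pdotDr pdotZr; ring.
Qed.

Lemma metric_gt0 z w : Mtilde L z -> w <> 0 -> 0 < metric z w w.
Proof.
move=> Mz w0; have [e [N [F [[e0 FG] lN lE mE]]]] := metric_local Mz.
have ze : `|z - z| < e by rewrite subrr normr0.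
rewrite mE//.
(* At the least [k0] with [level k0 z >= 1 / 2], the cut-off of index [k0 - 1] is positive and some
   weight of index [k0] is positive. This [k0] is not 0, since all weights of index 0 vanish. *)
have exk : exists k, 1 / 2 <= level k z by exists N; exact: lN.
have [k0 hk mink] := ex_minnP exk.
have kN : (k0 <= N)%N by apply: mink; exact: lN.
case: k0 kN hk mink => [|k] kN hk mink.
  move: hk; rewrite lE// big1; first by rewrite div1r; have := invr_gt0 (2 : R); lra.
  by move=> A _; rewrite /weight bump_le0// sub0r oppr_le0 pdot_ge0.
have lk : level k z < 1 / 2.
  by rewrite ltNge; apply/negP => /mink; rewrite ltnn.
have pos (j : nat) : 0 <= \sum_(A <- F) weight j.+1 z A * pdot (act A w) (act A w).
  by apply: sumr_ge0 => A _; rewrite mulr_ge0 ?weight_ge0 ?pdot_ge0.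
rewrite (bigD1 (Ordinal kN))//= ltr_wpDr//.
  by apply: sumr_ge0 => j _; rewrite mulr_ge0 ?bump_ge0.
rewrite mulr_gt0//.
  by rewrite bump_gt0// -lE// 1?ltnW// subr_gt0.
rewrite lt_def pos andbT; apply/eqP => /eqP.
rewrite psumr_eq0; last by move=> A _; rewrite mulr_ge0 ?weight_ge0 ?pdot_ge0.
move=> /allP h; move: hk; rewrite lE// big_seq big1.
  by rewrite div1r; have := invr_gt0 (2 : R); lra.
move=> A FA; have /implyP/(_ isT) := h _ FA; rewrite mulf_eq0 => /orP[/eqP//|/eqP Aw].
have Aw0 : act A w = 0 by apply: contrapT => /pdot_gt0; rewrite Aw ltxx.
exfalso; apply: w0; have : act (adjq A) (act A w) = w by rewrite act_mul (sg_mulK (FG _ FA)) act_one.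
by move=> <-; rewrite Aw0 /act !mulmx0.
Qed.

Lemma metric_smooth w w' : smooth_on (Mtilde L) (fun z => metric z w w' : R^o).
Proof.
move=> z Mz; have [e [N [F [[e0 _] _ _ mE]]]] := metric_local Mz.
exists (ball z e), (fun z => \sum_(k < N) bump 0 (1 / 2 - \sum_(A <- F) weight k z A) *
          \sum_(A <- F) weight k.+1 z A * pdot (act A w) (act A w')).
have Cw m k A : Ck m setT (fun z => weight k z A : R^o).
  apply: Ck_bump; apply: (@CkD _ _ m (fun=> k%:R)); first exact: Ck_cst.
  have -> : (fun z => - pdot (act A z) (act A z)) = (fun z => -1 * pdot (act A z) (act A z)).
    by apply/funext => y; rewrite mulN1r.
  by apply: CkM; [exact: Ck_cst|exact: Ck_pdot_act].
split.
- exact: ball_open.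
- exact: ballxx.
- move=> m; apply: Ck_sub; apply: Ck_sum => k; apply: CkM.
    apply: Ck_bump; apply: (@CkD _ _ m (fun=> 1 / 2)); first exact: Ck_cst.
    have -> : (fun z => - \sum_(A <- F) weight k z A) = (fun z => -1 * \sum_(A <- F) weight k z A).
      by apply/funext => y; rewrite mulN1r.
    by apply: CkM; [exact: Ck_cst|apply: Ck_sum].
  by apply: Ck_sum => A; apply: CkM => //; exact: Ck_cst.
- by move=> y; rewrite inE => -[_ zy]; apply: mE; move: zy; rewrite -ball_normE.
Qed.

Lemma metric_Riemannian : invariant_Riemannian_metric G L metric.
Proof.
split.
- exact: metric_linear.
- by move=> z w w' _; exact: metricC.
- by move=> z w Mz _ w0; exact: metric_gt0.
- exact: metric_smooth.
- by move=> A z w w' GA _ _ _; rewrite !diff_act metric_act.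
Qed.

Lemma metric_cvg {T : Type} {U : set_system T} {FF : Filter U} (f : T -> phase R)
    (g : T -> phase R) z w : Mtilde L z ->
  f t @[t --> U] --> z -> g t @[t --> U] --> w ->
  metric (f t) (g t) (g t) @[t --> U] --> metric z w w.
Proof.
move=> Mz fz gw; have [e [N [F [[e0 _] _ _ mE]]]] := metric_local Mz.
have cA (h : T -> phase R) y A : h t @[t --> U] --> y -> act A (h t) @[t --> U] --> act A y.
  by move=> hy; apply: cvg_act => //; exact: cvg_cst.
have cp (h : T -> phase R) y A : h t @[t --> U] --> y ->
    pdot (act A (h t)) (act A (h t)) @[t --> U] --> pdot (act A y) (act A y).
  move=> /(cA _ _ A) hy; have h1 := cvg_pair1 hy; have h2 := cvg_pair2 hy.
  exact: (cvgD (cvg_dot h1 h1) (cvg_dot h2 h2)).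
have cb (u : T -> R) (l : R) : u t @[t --> U] --> l -> bump 0 (u t) @[t --> U] --> bump 0 l.
  by move=> ul B lB; exact: ul (@bump_continuous R 0 l B lB).
have cw k A : weight k (f t) A @[t --> U] --> weight k z A.
  by apply: cb; apply: cvgB; [exact: cvg_cst|exact: cp].
have zz : `|z - z| < e by rewrite subrr normr0.
rewrite mE//.
have E : {near U, (fun t => \sum_(k < N) bump 0 (1 / 2 - \sum_(A <- F) weight k (f t) A) *
          \sum_(A <- F) weight k.+1 (f t) A * pdot (act A (g t)) (act A (g t))) =1
    (fun t => metric (f t) (g t) (g t))}.
  move/cvgrPdist_lt : fz => /(_ _ e0); apply: filterS => t ft.
  by rewrite mE.
apply: cvg_trans (near_eq_cvg E) _; apply: cvg_sum_seq => k; apply: cvgM.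
  by apply: cb; apply: cvgB; [exact: cvg_cst|apply: cvg_sum_seq].
by apply: cvg_sum_seq => A; apply: cvgM => //; exact: cp.
Qed.

End Metric.

(** * The non-wandering set *)

Section QuotientTopology.
Context {R : realType} (G : subgroup22 R) (L : set 'cV[R]_4).
Hypothesis aL : acausal_circle L.
Hypothesis GL : forall A, sg_set G A -> bd_act A @` L = L.
Implicit Types (y z : Mtilde L).

Local Notation NW := (non_wandering (@qflow R G L)).
Local Notation Per := (periodic_points (@qflow R G L)).

Lemma Mtilde_val z : Mtilde L (\val z).
Proof. exact: (set_mem (valP z)). Qed.

Definition mk_Mtilde (z : phase R) (Mz : Mtilde L z) : Mtilde L := exist _ z (mem_set Mz).

Lemma orbit_proj_eq y z : orbit_proj G y = orbit_proj G z <->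
  exists2 A, sg_set G A & \val z = act A (\val y).
Proof.
split=> [/eqmodP/asboolP//|h]; apply/eqmodP; exact/asboolP.
Qed.

Lemma orbit_proj_surj (p : orbit_space G L) : exists z, p = orbit_proj G z.
Proof. by exists (repr p); rewrite /orbit_proj reprK. Qed.

Lemma open_Mtilde (V : set (Mtilde L)) z : open V -> V z ->
  exists2 e : R, 0 < e & forall y, `|\val z - \val y| < e -> V y.
Proof.
move=> [W oW <-] Wz; have : nbhs (\val z) W by exact: open_nbhs_nbhs.
move=> /nbhs_ballP[e /= e0 eW]; exists e => // y ye; apply: eW.
by rewrite -ball_normE.
Qed.

Lemma open_orbit (V : set (orbit_space G L)) z : open V -> V (orbit_proj G z) ->
  exists2 e : R, 0 < e & forall y, `|\val z - \val y| < e -> V (orbit_proj G y).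
Proof.
move=> oV Vz; have oV' : open [set y : Mtilde L | V (orbit_proj G y)] by exact: oV.
exact: (open_Mtilde oV').
Qed.

(** The inverse image of this set in [Mtilde L] is the trace of the union of the translates of the
    ball, and each translate is open. *)
Lemma ball_orbit_open z (e : R) :
  open (@orbit_proj R G L @` [set y : Mtilde L | `|\val z - \val y| < e]).
Proof.
rewrite /open/= /quotient_open.
exists (\bigcup_(A in sg_set G) [set w | `|\val z - act A w| < e]).
  apply: bigcup_open => A _.
  rewrite (_ : mkset _ = act A @^-1` (ball (\val z) e)); last by rewrite -ball_normE.
  apply: open_comp; last exact: ball_open.
  by move=> w _; apply: cvg_act; [exact: cvg_cst|exact: cvg_id].
apply/seteqP; split=> [y [A GA /= h]|y [y' /= h /orbit_proj_eq[A GA E]]].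
  exists (mk_Mtilde (Mtilde_act aL GL GA (Mtilde_val y))) => //.
  apply/orbit_proj_eq; exists (adjq A); first exact: sg_adjq.
  by rewrite /= act_mul (sg_mulK GA) act_one.
exists (adjq A); first exact: sg_adjq.
rewrite /= set_valE E act_mul (sg_mulK GA) act_one//.
Qed.

Lemma non_wanderingP z : NW (orbit_proj G z) <->
  forall e T : R, 0 < e -> 0 < T -> exists t y A, [/\ T <= t, sg_set G A,
    `|\val z - \val y| < e & `|\val z - act A (flow t (\val y))| < e].
Proof.
split=> [h e T e0 T0|h V oV Vz T T0].
  have zz : (@orbit_proj R G L @` [set y : Mtilde L | `|\val z - \val y| < e]) (orbit_proj G z).
    by exists z => //=; rewrite subrr normr0.
  have [t Tt [_ [[_ [y /= ye <-] <-] [y' /= ye' /esym]]]] := h _ (ball_orbit_open z e) zz _ T0.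
  rewrite qflow_orbit_proj => /orbit_proj_eq[A GA E].
  by exists t, y, A; split => //; move: ye'; rewrite E.
have [e e0 eV] := open_orbit oV Vz; have [t [y [A [Tt GA ye Ae]]]] := h _ _ e0 T0.
exists t => //; exists (orbit_proj G (Mflow t y)); split.
  by exists (orbit_proj G y); [exact: eV|rewrite qflow_orbit_proj].
pose y' := mk_Mtilde (Mtilde_act aL GL GA (Mtilde_val (Mflow t y))).
have -> : orbit_proj G (Mflow t y) = orbit_proj G y' by apply/orbit_proj_eq; exists A.
exact: eV.
Qed.

Lemma qflowD s t p : @qflow R G L s (qflow t p) = qflow (s + t) p.
Proof.
have [z ->] := orbit_proj_surj p; rewrite !qflow_orbit_proj; congr (orbit_proj G _).
by apply: val_inj; rewrite /= flowD.
Qed.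

Lemma qflow0 p : @qflow R G L 0 p = p.
Proof.
have [z ->] := orbit_proj_surj p; rewrite qflow_orbit_proj; congr (orbit_proj G _).
by apply: val_inj; rewrite /= flow0.
Qed.

Lemma non_wandering_flow t p : NW p -> NW (qflow t p).
Proof.
have [z ->] := orbit_proj_surj p => /non_wanderingP h.
rewrite qflow_orbit_proj; apply/non_wanderingP => e T e0 T0.
have : flow t w @[w --> \val z] --> flow t (\val z).
  by apply: cvg_flow; [exact: cvg_cst|exact: cvg_id].
move=> /cvgrPdist_lt/(_ _ e0)/nbhs_ballP[d /= d0 dE].
have [s [y [A [Ts GA yd Ad]]]] := h _ _ d0 T0.
exists s, (Mflow t y), A; split => //=.
  by apply: dE; rewrite -ball_normE.
have -> : act A (flow s (flow t (sval y))) = flow t (act A (flow s (\val y))).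
  by rewrite flow_act !flowD addrC.
have := dE (act A (flow s (\val y))); rewrite -ball_normE; exact.
Qed.

Lemma non_wandering_invariant : invariant_set (@qflow R G L) NW.
Proof.
move=> t; apply/seteqP; split=> [_ [p NWp <-]|p NWp]; first exact: non_wandering_flow.
exists (qflow (- t) p); first exact: non_wandering_flow.
by rewrite qflowD subrr qflow0.
Qed.

Lemma periodic_non_wandering : Per `<=` NW.
Proof.
move=> p [T T0 Tp] V oV Vp T' T'0.
have nTp n : qflow (n%:R * T) p = p.
  elim: n => [|n IH]; first by rewrite mul0r qflow0.
  by rewrite -natr1 mulrDl mul1r addrC -qflowD IH.
pose n := (Num.trunc (T' / T)).+1.
exists (n%:R * T); first by rewrite -ler_pdivrMr// ltW// truncnS_gt.
by exists p; split => //; exists p.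
Qed.

End QuotientTopology.

Lemma non_wandering_closed {R : realType} {X : topologicalType} (phi : R -> X -> X) :
  closed (non_wandering phi).
Proof.
move=> z cz V oV Vz; have [y [Vy NWy]] := cz _ (open_nbhs_nbhs (conj oV Vz)).
exact: Vy.
Qed.

(** * Geodesics with both endpoints in the circle *)

Section LimitGeodesics.
Context {R : realType} (G : subgroup22 R) (L : set 'cV[R]_4).
Hypothesis aL : acausal_circle L.
Hypothesis GL : forall A, sg_set G A -> bd_act A @` L = L.
Implicit Types (z w : phase R).

(* Both endpoints of the geodesic through [z] lie in [L]. *)
Definition limit_geodesics : set (phase R) :=
  [set z | T1AdS3 z /\ forall sg : R, sg ^+ 2 = 1 ->
     exists (c : R) nu, [/\ 0 < c, L nu & z.1 + sg *: z.2 = c *: nu]].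

Local Notation S := limit_geodesics.

Lemma T1_null_pairing z (sg : R) : sg ^+ 2 = 1 -> T1AdS3 z ->
  q (z.1 + sg *: z.2) (z.1 - sg *: z.2) = -2.
Proof.
move=> s2 [xx xv vv]; rewrite !qlin (qC z.2 z.1) xx xv vv.
by transitivity (- 1 - sg ^+ 2); [ring|rewrite s2; ring].
Qed.

Lemma limit_geodesics_T1 z : S z -> T1AdS3 z.
Proof. by case. Qed.

Lemma limit_geodesicsP z : S z -> exists (c c' : R) nu nu',
  [/\ 0 < c, 0 < c', L nu, L nu' & z = (c *: nu + c' *: nu', c *: nu - c' *: nu')].
Proof.
move=> [Tz h]; have [|c [nu [c0 Lnu E]]] := h 1; first by rewrite expr1n.
have [|c' [nu' [c'0 Lnu' E']]] := h (-1); first by rewrite sqrrN expr1n.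
exists (c / 2), (c' / 2), nu, nu'; split => //; rewrite ?divr_gt0//.
have -> : (c / 2) *: nu = 2^-1 *: (c *: nu) by rewrite scalerA mulrC.
have -> : (c' / 2) *: nu' = 2^-1 *: (c' *: nu') by rewrite scalerA mulrC.
rewrite -E -E'; case: z {Tz h E E'} => x v /=.
by congr pair; apply/matrixP => i j; rewrite !mxE; field.
Qed.

Lemma limit_geodesics_act A z : sg_set G A -> S z -> S (act A z).
Proof.
move=> GA [Tz h]; split; first by apply: T1_act => //; exact: sg_isom GA.
move=> sg s2; have [c [nu [c0 Lnu E]]] := h _ s2.
have [c' [nu' [c'0 Lnu' E']]] := sg_circle aL GL GA Lnu.
exists (c * c'), nu'; split => //; first exact: mulr_gt0.
by rewrite /act/= scalemxAr -mulmxDr E -scalemxAr E' scalerA.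
Qed.

Lemma limit_geodesics_flow t z : S z -> S (flow t z).
Proof.
move=> [Tz h]; split; first exact: T1_flow.
move=> sg s2; have [c [nu [c0 Lnu E]]] := h _ s2.
exists (expR (sg * t) * c), nu; split => //; first by rewrite mulr_gt0 ?expR_gt0.
have -> : t = sg * (sg * t) by rewrite mulrA -expr2 s2 mul1r.
by rewrite flow_null// E scalerA mulrA -expr2 s2 mul1r.
Qed.

(** The base point [c *: nu1 + c' *: nu2] already lies in [Oplus L], so the flow time is 0. Its
    pairing with [nu] could vanish only if [nu1 = nu2 = nu], and then the base point would be
    null. *)
Lemma limit_geodesics_Mtilde z : S z -> Mtilde L z.
Proof.
move=> Sz; apply/MtildeP; split; first exact: limit_geodesics_T1.
exists 0 => nu Lnu; rewrite flow0.
have [c [c' [nu1 [nu2 [c0 c0' L1 L2 zE]]]]] := limit_geodesicsP Sz.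
rewrite zE /= !qlin.
have h1 := circle_le0 aL L1 Lnu; have h2 := circle_le0 aL L2 Lnu.
have [e1|/eqP n1] := eqVneq nu1 nu; last first.
  have := circle_lt0 aL L1 Lnu n1 => h; nra.
have [e2|/eqP n2] := eqVneq nu2 nu; last first.
  have := circle_lt0 aL L2 Lnu n2 => h; nra.
have [xx _ _] := limit_geodesics_T1 Sz.
move: xx; rewrite zE e1 e2 /= !qlin (circle_null aL Lnu); lra.
Qed.

Lemma limit_geodesics_core z : S z -> convex_core L z.1.
Proof.
move=> Sz; have [c [c' [nu1 [nu2 [c0 c0' L1 L2 zE]]]]] := limit_geodesicsP Sz.
apply: (@two_point_core_sub _ _ (c + c')).
have z1E : z.1 = two_point ((c, c'), (nu1, nu2)) by rewrite zE.
exists ((c, c'), (nu1, nu2)) => //; split; last first.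
  by rewrite /= -z1E; case: (limit_geodesics_T1 Sz).
by split; split; rewrite //= in_itv/= ?(ltW c0) ?(ltW c0')/= ?lerDl ?lerDr ltW.
Qed.

Lemma limit_geodesics_lim {T : Type} {U : set_system T} {UU : UltraFilter U}
    (f : T -> phase R) z :
  (\forall t \near U, S (f t)) -> f t @[t --> U] --> z -> S z.
Proof.
move=> Sf fz; have f1 := cvg_pair1 fz; have f2 := cvg_pair2 fz.
have Tz : T1AdS3 z.
  have lim (u : T -> R) (l c : R) : (\forall t \near U, u t = c) -> u t @[t --> U] --> l -> l = c.
    move=> uc ul; apply: (@cvg_unique _ (@norm_hausdorff _ _) (u @ U)) ul _.
    have E : {near U, (fun=> c) =1 u} by apply: filterS uc => t ->.
    by apply: cvg_trans (near_eq_cvg E) _; exact: cvg_cst.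
  split.
  - by apply: lim (cvg_q f1 f1); apply: filterS Sf => t [[]].
  - by apply: lim (cvg_q f1 f2); apply: filterS Sf => t [[]].
  - by apply: lim (cvg_q f2 f2); apply: filterS Sf => t [[]].
split=> // sg s2.
have [c [nu [c0 Lnu E]]] : exists c nu, [/\ 0 <= c, L nu & z.1 + sg *: z.2 = c *: nu].
  apply: (cone_lim aL (f := fun t => (f t).1 + sg *: (f t).2) (U := U)).
    apply: filterS Sf => t [_ /(_ _ s2)[c [nu [c0 Lnu E]]]].
    by exists c, nu; split => //; exact: ltW.
  exact: (cvgD f1 (cvgZ (cvg_cst sg) f2)).
(* The limit of the cone might be its apex; the pairing [-2] of the two null vectors forbids it. *)
exists c, nu; split => //; rewrite lt_def c0 andbT; apply/eqP => c00.
have := T1_null_pairing s2 Tz; rewrite E c00 scale0r q0l; lra.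
Qed.

(** A linear functional bounded below on [L] by a positive constant measures size in the cone. A
    point of [L] pairs to 0 with itself, but the sum of two distinct points pairs negatively with
    all of [L]. *)
Lemma circle_pairing_bound : exists (x : 'cV[R]_4) (d : R), 0 < d /\
  forall nu, L nu -> d <= - q x nu.
Proof.
have [nu1 L1] := circle_nonempty aL; have [nu2 L2 n12] := circle_other aL L1.
exists (nu1 + nu2); apply: contrapT => h.
have h' (n : nat) : exists nu, L nu /\ - q (nu1 + nu2) nu <= n.+1%:R^-1.
  apply: contrapT => hn; apply: h; exists n.+1%:R^-1; split => // nu Lnu.
  by rewrite leNgt; apply/negP => lt; apply: hn; exists nu; split => //; exact: ltW.
have [f fP] := choice h'; have [U [UU ooU]] := nat_ultrafilter.
have hU : (n.+1%:R^-1 : R) @[n --> U] --> 0 by move=> B /(@cvg_harmonic R) /ooU.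
have [nu Lnu fnu] : exists2 nu, L nu & f n @[n --> U] --> nu.
  apply: ultra_cvg; first exact: circle_compact aL.
  by apply: nearW => n; have [] := fP n.
have c1 : - q (nu1 + nu2) (f n) @[n --> U] --> - q (nu1 + nu2) nu.
  by apply: cvgN; apply: cvg_q => //; exact: cvg_cst.
have : - q (nu1 + nu2) nu <= 0.
  by apply: (ler_cvg_to c1 hU); apply: nearW => n; have [_] := fP n.
rewrite !qlin; have h1 := circle_le0 aL L1 Lnu; have h2 := circle_le0 aL L2 Lnu.
have [e1|/eqP m1] := eqVneq nu1 nu; last by have := circle_lt0 aL L1 Lnu m1; lra.
by have := circle_lt0 aL L2 Lnu; rewrite -e1 => /(_ n12); rewrite -e1 in h1 *; lra.
Qed.

Lemma q_norm (x y : 'cV[R]_4) : `|q x y| <= 4 * `|x| * `|y|.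
Proof.
rewrite (le_trans (ler_norm_sum _ _ _))//.
rewrite (le_trans (ler_sum _ (G := fun=> `|x| * `|y|) _))//.
  by move=> i _; rewrite !normrM normrX normrN1 expr1n mul1r ler_pM// mx_coord_le.
by rewrite sumr_const card_ord -[leLHS]mulr_natl mulrA.
Qed.

(** The unit spacelike vectors at a point form a noncompact hyperboloid, so the base point alone
    does not bound the velocity. With both endpoints in [L], base point and velocity have the same
    coefficients up to sign, and the functional above bounds their sum. *)
Lemma limit_geodesics_bounded M : exists M', forall z, S z -> `|z.1| <= M -> `|z| <= M'.
Proof.
have [x [d [d0 dP]]] := circle_pairing_bound.
exists (4 * `|x| * M / d) => z Sz zM.
have [c [c' [nu1 [nu2 [c0 c0' L1 L2 zE]]]]] := limit_geodesicsP Sz.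
have cc : c + c' <= 4 * `|x| * M / d.
  rewrite ler_pdivlMr//.
  have h : - q x z.1 <= 4 * `|x| * M.
    rewrite (le_trans (ler_norm _))// normrN (le_trans (q_norm _ _))//.
    by rewrite ler_wpM2l// mulr_ge0.
  apply: le_trans h; rewrite zE /= !qlin.
  have := dP _ L1; have := dP _ L2; nra.
apply: le_trans cc; rewrite zE prod_normE ge_max; apply/andP; split.
  rewrite (le_trans (ler_normD _ _))// !normrZ !gtr0_norm//.
  by rewrite lerD// ler_piMr ?(ltW c0) ?(ltW c0')// (circle_norm aL).
rewrite (le_trans (ler_normB _ _))// !normrZ !gtr0_norm//.
by rewrite lerD// ler_piMr ?(ltW c0) ?(ltW c0')// (circle_norm aL).
Qed.

Hypothesis Gcc : acts_cocompactly G (convex_core L).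

Lemma limit_geodesics_cocompact : exists M, forall z, S z ->
  exists2 A, sg_set G A & `|act A z| <= M.
Proof.
have [K [cK KC KE]] := Gcc.
have [M0 [_ /(_ _ (ltr_pwDr ltr01 (lexx _))) KM]] := compact_bounded cK.
have [M MP] := limit_geodesics_bounded (M0 + 1); exists M => z Sz.
have := limit_geodesics_core Sz; rewrite -KE => -[A GA [k Kk E]].
have GA' := sg_adjq GA; exists (adjq A) => //.
apply: MP; first exact: limit_geodesics_act.
by rewrite /act /= -E mulmxA (sg_mulK GA) mul1mx; exact: KM.
Qed.

Lemma ultra_phase_cvg {T : Type} {U : set_system T} {UU : UltraFilter U}
    (f : T -> phase R) M : (\forall t \near U, `|f t| <= M) ->
  exists l : phase R, f t @[t --> U] --> l.
Proof.
move=> fM.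
have [|l1 h1] := @ultra_mx_cvg R _ U UU _ _ (fun t => (f t).1) M.
  by apply: filterS fM => t; apply: le_trans; exact: phase_norm1.
have [|l2 h2] := @ultra_mx_cvg R _ U UU _ _ (fun t => (f t).2) M.
  by apply: filterS fM => t; apply: le_trans; exact: phase_norm2.
by exists (l1, l2); exact: cvg_pairE.
Qed.

Lemma limit_geodesics_orbit_compact :
  compact (@orbit_proj R G L @` [set z : Mtilde L | S (\val z)]).
Proof.
have [M MP] := limit_geodesics_cocompact.
pose K : set (Mtilde L) := [set z | S (\val z) /\ `|\val z| <= M].
have -> : @orbit_proj R G L @` [set z : Mtilde L | S (\val z)] = @orbit_proj R G L @` K.
  apply/seteqP; split=> [_ [z /= Sz <-]|_ [z [Sz _] <-]]; last by exists z.
  have [A GA AM] := MP _ Sz.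
  pose z' := mk_Mtilde (Mtilde_act aL GL GA (Mtilde_val z)).
  exists z'; first by split => //; exact: limit_geodesics_act.
  by apply/esym/orbit_proj_eq; exists A.
apply: continuous_compact; first exact/continuous_subspaceT/pi_continuous.
rewrite compact_ultra => U UU UK.
have [l Ul] : exists l : phase R, \val t @[t --> U] --> l.
  by apply: (@ultra_phase_cvg _ U UU _ M); apply: filterS UK => t [].
have Sl : S l by apply: (limit_geodesics_lim (U := U)) Ul; apply: filterS UK => t [].
exists (mk_Mtilde (limit_geodesics_Mtilde Sl)); split.
  split => //=; apply: (cvg_le (F := U)); last exact: (cvg_norm Ul).
  by apply: filterS UK => t [].
move=> V; rewrite nbhsE => -[W [oW Wl] WV].
have [e e0 eW] := open_Mtilde oW Wl.
move/cvgrPdist_lt : Ul => /(_ _ e0); apply: filterS => y ye; apply: WV; exact: eW.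
Qed.

End LimitGeodesics.

(** * Closing lemma *)

Section Eigen.
Context {R : realType}.

Lemma cvg_prod_seq {T : Type} {F : set_system T} {FF : Filter F} (I : Type) (r : seq I)
    (f : I -> T -> R) (l : I -> R) :
  (forall i, f i t @[t --> F] --> l i) ->
  (\prod_(i <- r) f i t) @[t --> F] --> \prod_(i <- r) l i.
Proof.
move=> h; elim: r => [|i r ih].
  by rewrite big_nil; under eq_fun do rewrite big_nil; exact: cvg_cst.
rewrite big_cons; under eq_fun do rewrite big_cons.
by apply: cvgM.
Qed.

Lemma cvg_det {T : Type} {F : set_system T} {FF : Filter F} n (A : T -> 'M[R]_n) (B : 'M[R]_n) :
  A t @[t --> F] --> B -> \det (A t) @[t --> F] --> \det B.
Proof.
move=> AB; apply: cvg_sum_seq => s; apply: cvgM; first exact: cvg_cst.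
by apply: cvg_prod_seq => i; exact: cvg_coord.
Qed.

(** The matrix determinant lemma: one block matrix [M] is reduced to triangular form by either of
    its diagonal blocks. *)
Lemma det_sub_rank_one n (u : 'cV[R]_n) (w : 'rV[R]_n) (s : R) : s != 0 ->
  \det (s%:M - u *m w) = (1 - s^-1 * (w *m u) 0 0) * s ^+ n.
Proof.
move=> s0.
pose M : 'M[R]_(1 + n) := block_mx 1%:M w u s%:M.
have E1 : \det M = \det (s%:M - u *m w).
  have : block_mx 1%:M 0 (- u) 1%:M *m M = block_mx 1%:M w 0 (s%:M - u *m w).
    rewrite mulmx_block !mul1mx !mul0mx !addr0 mulmx1 addNr mulNmx.
    by rewrite addrC.
  move=> /(congr1 (fun A => \det A)).
  by rewrite det_mulmx det_lblock det_ublock !det1 !mul1r.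
have E2 : \det M = (1 - s^-1 * (w *m u) 0 0) * s ^+ n.
  have : block_mx 1%:M (- (s^-1 *: w)) 0 1%:M *m M = block_mx (1%:M - s^-1 *: (w *m u)) 0 u s%:M.
    rewrite mulmx_block !mul1mx !mul0mx !add0r mulNmx -scalemxAl mul_mx_scalar.
    by rewrite scalerN scalerA divff// scale1r subrr.
  move=> /(congr1 (fun A => \det A)).
  rewrite det_mulmx det_ublock det_lblock !det1 !mul1r det_scalar => ->.
  by rewrite det_mx11 !mxE.
by rewrite -E1.
Qed.

Lemma horner_char_poly n (A : 'M[R]_n) (s : R) : (char_poly A).[s] = \det (s%:M - A).
Proof.
rewrite -horner_evalE -det_map_mx; congr (\det _).
by apply/matrixP => i j; rewrite !mxE /= horner_evalE hornerD hornerN hornerC hornerMn hornerX.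
Qed.

(** With [l = w *m u], the characteristic polynomial of [u *m w] is negative at [l / 2] and positive
    at [2 l]. By continuity so is that of [B t], which therefore has a real eigenvalue in between. A
    limit of unit eigenvectors is an eigenvector of [u *m w] for a nonzero eigenvalue, hence a
    multiple [k *: u]; dividing by [k] makes the limit [u]. *)
Lemma eigenvector_limit {T : Type} {U : set_system T} {UU : UltraFilter U} n
    (B : T -> 'M[R]_n.+1) (u : 'cV[R]_n.+1) (w : 'rV[R]_n.+1) :
  B t @[t --> U] --> u *m w -> 0 < (w *m u) 0 0 ->
  exists (s : T -> R) (x : T -> 'cV[R]_n.+1) (d : R),
    [/\ 0 < d, x t @[t --> U] --> u & \forall t \near U, d <= s t /\ B t *m x t = s t *: x t].
Proof.
set l := (w *m u) 0 0 => Buw l0.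
have detlim (s : R) : \det (s%:M - B t) @[t --> U] --> \det (s%:M - u *m w).
  by apply: cvg_det; exact: (cvgB (cvg_cst _) Buw).
have d1 : \det ((l / 2)%:M - u *m w) < 0.
  have h : 0 < l / 2 by rewrite divr_gt0.
  rewrite det_sub_rank_one -/l; last by rewrite gt_eqF.
  rewrite pmulr_llt0; last exact: exprn_gt0.
  suff -> : (l / 2)^-1 * l = 2 by lra.
  by field; rewrite gt_eqF.
have d2 : 0 < \det ((l * 2)%:M - u *m w).
  have h : 0 < l * 2 by rewrite mulr_gt0.
  rewrite det_sub_rank_one -/l; last by rewrite gt_eqF.
  rewrite pmulr_lgt0; last exact: exprn_gt0.
  suff -> : (l * 2)^-1 * l = 1 / 2 by lra.
  by field; rewrite gt_eqF.
have n1 : \forall t \near U, \det ((l / 2)%:M - B t) < 0 by exact: (cvgr_lt _ (detlim _)).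
have n2 : \forall t \near U, 0 < \det ((l * 2)%:M - B t) by exact: (cvgr_gt _ (detlim _)).
pose P t (sx : R * 'cV[R]_n.+1) :=
  [/\ l / 2 <= sx.1, sx.1 <= l * 2, `|sx.2| = 1 & B t *m sx.2 = sx.1 *: sx.2].
have Ph : \forall t \near U, P t (get (P t)).
  apply: filterS2 n1 n2 => t t1 t2; apply: (@getPex _ (P t)).
  have l12 : l / 2 <= l * 2 by lra.
  have [|s /andP[s1 s2] rs] := @poly_ivt R (char_poly (B t)) _ _ l12.
    by rewrite !horner_char_poly !ltW.
  (* [eigenvalue] refers to row vectors, hence the transpose. *)
  have : eigenvalue (B t)^T s.
    rewrite eigenvalue_root_char; move: rs; rewrite !rootE !horner_char_poly.
    by rewrite -[in X in _ -> X]det_tr linearB/= trmxK tr_scalar_mx.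
  move=> /eigenvalueP[v vE v0].
  exists (s, `|v^T|^-1 *: v^T); split => //=.
    rewrite normrZ normfV normr_id mulVf// normr_eq0; apply: contra v0 => /eqP v0.
    by rewrite -[v]trmxK v0 trmx0.
  rewrite -scalemxAr -[B t]trmxK -trmx_mul vE linearZ/=.
  by rewrite !scalerA mulrC.
have [s0 sl] : exists s0 : R, (get (P t)).1 @[t --> U] --> s0.
  have [|s0 _ h] := @ultra_cvg _ U UU _ `[l / 2, l * 2] (fun t => (get (P t)).1) (@segment_compact R _ _).
    by apply: filterS Ph => t [h1 h2 _ _]; rewrite /= in_itv/= h1 h2.
  by exists s0.
have [x0 xl] : exists x0 : 'cV[R]_n.+1, (get (P t)).2 @[t --> U] --> x0.
  by apply: (@ultra_mx_cvg _ _ U UU _ _ _ 1); apply: filterS Ph => t [_ _ -> _].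
have s0l : l / 2 <= s0 by apply: (cvg_ge (F := U)) sl; apply: filterS Ph => t [].
have x01 : `|x0| = 1.
  apply: (@cvg_unique _ (@norm_hausdorff _ _) ((fun t => `|(get (P t)).2|) @ U)).
    exact: cvg_norm.
  have E : {near U, (fun=> 1) =1 (fun t => `|(get (P t)).2|)} by apply: filterS Ph => t [_ _ -> _].
  by apply: cvg_trans (near_eq_cvg E) _; exact: cvg_cst.
have xE : u *m w *m x0 = s0 *: x0.
  apply: (@cvg_unique _ (@norm_hausdorff _ _) ((fun t => B t *m (get (P t)).2) @ U)).
    exact: cvg_mulmx.
  have E : {near U, (fun t => (get (P t)).1 *: (get (P t)).2) =1 (fun t => B t *m (get (P t)).2)}.
    by apply: filterS Ph => t [_ _ _ ->].
  by apply: cvg_trans (near_eq_cvg E) _; exact: cvgZ.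
have s0n : s0 != 0 by rewrite gt_eqF//; lra.
pose k := s0^-1 * (w *m x0) 0 0.
have xk : x0 = k *: u.
  rewrite -[x0]scale1r -(mulVf s0n) -scalerA -xE -mulmxA [w *m x0]mx11_scalar.
  by rewrite mul_mx_scalar scalerA.
have k0 : k != 0.
  apply/eqP => k0; move: x01; rewrite xk k0 scale0r normr0 => /eqP.
  by rewrite eq_sym oner_eq0.
exists (fun t => (get (P t)).1), (fun t => k^-1 *: (get (P t)).2), (l / 2); split.
- by rewrite divr_gt0.
- have -> : u = k^-1 *: x0 by rewrite xk scalerA mulVf// scale1r.
  by apply: cvgZ => //; exact: cvg_cst.
- by apply: filterS Ph => t [h1 _ _ h2]; split => //; rewrite -scalemxAr h2 !scalerA [k^-1 * _]mulrC.
Qed.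

End Eigen.

(** * Group elements along long orbit segments *)

Section Axis.
Context {R : realType} (G : subgroup22 R) (L : set 'cV[R]_4).
Hypothesis aL : acausal_circle L.
Hypothesis GL : forall A, sg_set G A -> bd_act A @` L = L.
Context {T : Type} {U : set_system T} {UU : UltraFilter U}.

Definition diverges (s : T -> R) := forall M, \forall u \near U, M <= s u.

Lemma expRN_cvg0 (s : T -> R) : diverges s -> expR (- s u) @[u --> U] --> (0 : R).
Proof.
move=> soo; apply/cvgrPdist_le => e e0; apply: filterS (soo e^-1) => u su.
rewrite sub0r normrN ger0_norm ?expR_ge0// expRN invf_ple ?posrE ?expR_gt0//.
by apply: le_trans su _; have := expR_ge1Dx (s u); lra.
Qed.

Lemma cvg_inv_diverges (s : T -> R) : diverges s -> (s u)^-1 @[u --> U] --> (0 : R).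
Proof.
move=> soo; apply/cvgrPdist_le => e e0; apply: filterS2 (soo 1) (soo e^-1) => u s1 su.
have s0 : 0 < s u by apply: lt_le_trans s1.
by rewrite sub0r normrN ger0_norm ?invr_ge0 ?(ltW s0)// invf_ple ?posrE.
Qed.

Lemma cvg_near_eq {V : normedModType R} (f g : T -> V) (l l' : V) :
  (\forall u \near U, f u = g u) -> f u @[u --> U] --> l -> g u @[u --> U] --> l' -> l = l'.
Proof.
move=> fg fl gl; apply: (@cvg_unique _ (@norm_hausdorff _ _) (f @ U)) fl _.
have E : {near U, g =1 f} by apply: filterS fg => u ->.
exact: cvg_trans (near_eq_cvg E) _.
Qed.

(* The dynamics of [sg_limit] along orbit segments of the geodesic flow which
   start near [(a0, b0)] and whose images under [A] end near [(a0', b0')]. *)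
Lemma axis_limit (A : T -> 'M[R]_4) (s : T -> R) (a b a' b' : T -> 'cV[R]_4)
    (a0 b0 a0' b0' : 'cV[R]_4) :
  (\forall u \near U, sg_set G (A u)) -> diverges s ->
  a u @[u --> U] --> a0 -> b u @[u --> U] --> b0 ->
  a' u @[u --> U] --> a0' -> b' u @[u --> U] --> b0' ->
  (forall u, A u *m a u = expR (- s u) *: a' u) ->
  (forall u, A u *m b u = expR (s u) *: b' u) ->
  a0 <> 0 -> b0' <> 0 ->
  (forall nu, L nu -> q nu a0 = 0 -> q nu b0 <> 0) ->
  exists (P : 'M[R]_4) (c sg : R) nu1 nu2,
    [/\ [/\ `|A u|^-1 *: A u @[u --> U] --> P, c < 0, L nu1 & L nu2],
        (forall x, P *m x = (c * q nu2 x) *: nu1) /\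
        (forall x, adjq P *m x = (c * q nu1 x) *: nu2),
        diverges (fun u => `|A u|) /\ q nu2 a0 = 0 /\ q nu1 b0' = 0,
        0 < sg /\ `|A u|^-1 * expR (s u) @[u --> U] --> sg
      & P *m b0 = sg *: b0' /\ adjq P *m a0' = sg *: a0].
Proof.
move=> GA soo aa bb aa' bb' Aa Ab a00 b00 nd.
have e0 := expRN_cvg0 soo.
(* If [A] stayed bounded, so would its inverse, and [a = A^-1 (e^-s a')] would tend to 0. *)
have Aoo : diverges (fun u => `|A u|).
  move=> M; have [//|h] := in_ultra_setVsetC [set u | M <= `|A u|] UU.
  exfalso; apply: a00.
  have lim0 : expR (- s u) *: a' u @[u --> U] --> (0 : 'cV[R]_4).
    by rewrite -(scale0r a0'); exact: cvgZ.
  apply: (norm_lim0 (F := U) (e := fun u => 4 * `|M| * `|expR (- s u) *: a' u|) _ _ aa).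
    apply: filterS2 GA h => u GAu /negP; rewrite -ltNge => AM.
    rewrite -Aa -[X in `|X| <= _]mul1mx -(sg_mulK GAu) -mulmxA.
    rewrite (le_trans (mulmx_norm _ _))// adjq_norm ler_wpM2r// ler_wpM2l//.
    by rewrite (le_trans (ltW AM))// ler_norm.
  have -> : (0 : R) = 4 * `|M| * `|0 : 'cV[R]_4| by rewrite normr0 mulr0.
  by apply: cvgM; [exact: cvg_cst|exact: cvg_norm].
have [P [c [nu1 [nu2 [BP c0 L1 L2 [PE PE']]]]]] := sg_limit aL GL GA Aoo.
have Ai := cvg_inv_diverges Aoo.
have BP' : `|A u|^-1 *: adjq (A u) @[u --> U] --> adjq P.
  have -> : (fun u => `|A u|^-1 *: adjq (A u)) = (fun u => adjq (`|A u|^-1 *: A u)).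
    by apply/funext => u; rewrite /adjq linearZ/= -scalemxAr -scalemxAl.
  exact: cvg_adjq.
have n1 := circle_neq0 aL L1; have n2 := circle_neq0 aL L2.
have Pa : P *m a0 = 0.
  have h1 : (`|A u|^-1 *: A u) *m a u @[u --> U] --> P *m a0 by exact: cvg_mulmx.
  apply: (cvg_near_eq _ h1 (g := fun u => `|A u|^-1 *: (expR (- s u) *: a' u))).
    by apply: nearW => u; rewrite -scalemxAl Aa.
  by rewrite -(scale0r (0 *: a0')); exact: (cvgZ Ai (cvgZ e0 aa')).
have q2 : q nu2 a0 = 0.
  move: Pa; rewrite PE => /eqP; rewrite scaler_eq0 mulf_eq0 (lt_eqF c0)/=.
  by case/orP => /eqP.
have Pb' : adjq P *m b0' = 0.
  have h1 : (`|A u|^-1 *: adjq (A u)) *m b' u @[u --> U] --> adjq P *m b0' by exact: cvg_mulmx.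
  apply: (cvg_near_eq _ h1 (g := fun u => `|A u|^-1 *: (expR (- s u) *: b u))).
    apply: filterS GA => u GAu; rewrite -scalemxAl; congr (_ *: _).
    rewrite -[in RHS](mul1mx (b u)) -(sg_mulK GAu) -mulmxA Ab -scalemxAr scalerA.
    by rewrite -expRD addNr expR0 scale1r.
  by rewrite -(scale0r (0 *: b0)); exact: (cvgZ Ai (cvgZ e0 bb)).
have q1 : q nu1 b0' = 0.
  move: Pb'; rewrite PE' => /eqP; rewrite scaler_eq0 mulf_eq0 (lt_eqF c0)/=.
  by case/orP => /eqP.
have hPb : (`|A u|^-1 * expR (s u)) *: b' u @[u --> U] --> P *m b0.
  have -> : (fun u => (`|A u|^-1 * expR (s u)) *: b' u) = (fun u => (`|A u|^-1 *: A u) *m b u).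
    by apply/funext => u; rewrite -scalemxAl Ab scalerA.
  exact: cvg_mulmx.
have [y y1] := q_eq0_sep b00.
(* The convergence of [e^s / |A|] is read off one coordinate: pairing with [y] is legitimate since
   [q b0' y = 1], so that [q (b' u) y] stays away from 0. *)
pose sg := q (P *m b0) y.
have hsg : `|A u|^-1 * expR (s u) @[u --> U] --> sg.
  have hq : q (b' u) y @[u --> U] --> (1 : R) by rewrite -y1; apply: cvg_q => //; exact: cvg_cst.
  have hV : (q (b' u) y)^-1 @[u --> U] --> (1 : R).
    by rewrite -invr1; apply: cvgV => //; exact: oner_neq0.
  have hP : q ((`|A u|^-1 * expR (s u)) *: b' u) y * (q (b' u) y)^-1 @[u --> U] --> sg.
    by rewrite -[sg]mulr1; apply: cvgM => //; apply: cvg_q => //; exact: cvg_cst.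
  have E : {near U, (fun u => q ((`|A u|^-1 * expR (s u)) *: b' u) y * (q (b' u) y)^-1) =1
      (fun u => `|A u|^-1 * expR (s u))}.
    have /cvgr_gt/(_ _ ltr01) := hq; apply: filterS => u qu.
    by rewrite qZl mulfK// gt_eqF.
  exact: cvg_trans (near_eq_cvg E) _.
have Pb : P *m b0 = sg *: b0'.
  by apply: (cvg_near_eq _ hPb (cvgZ hsg bb')); exact: nearW.
have Pa' : adjq P *m a0' = sg *: a0.
  have h1 : (`|A u|^-1 *: adjq (A u)) *m a' u @[u --> U] --> adjq P *m a0' by exact: cvg_mulmx.
  apply: (cvg_near_eq _ h1 (cvgZ hsg aa)).
  apply: filterS GA => u GAu; rewrite -scalemxAl -scalerA; congr (_ *: _).
  have -> : a' u = expR (s u) *: (A u *m a u).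
    by rewrite Aa scalerA -expRD subrr expR0 scale1r.
  by rewrite -scalemxAr mulmxA (sg_mulK GAu) mul1mx.
have sg0 : 0 <= sg.
  apply: (cvg_ge (F := U)) hsg; apply: nearW => u.
  by rewrite mulr_ge0 ?invr_ge0 ?expR_ge0.
(* If [sg = 0] then [P] kills [b0], and [nu2] is orthogonal to both [a0] and [b0], against the
   nondegeneracy hypothesis. *)
have sgn : 0 < sg.
  rewrite lt_def sg0 andbT; apply/eqP => sg00.
  move: Pb; rewrite sg00 scale0r PE => /eqP; rewrite scaler_eq0 mulf_eq0 (lt_eqF c0)/=.
  by case/orP => /eqP; [exact: nd|].
by exists P, c, sg, nu1, nu2; split.
Qed.

End Axis.

(** * The null coordinates [x + v] and [x - v] *)

Section NullCoordinates.
Context {R : realType}.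
Implicit Types (z : phase R) (a b : 'cV[R]_4).

Definition nplus z : 'cV[R]_4 := z.1 + z.2.
Definition nminus z : 'cV[R]_4 := z.1 - z.2.
Definition of_null a b : phase R := (2^-1 *: (a + b), 2^-1 *: (a - b)).

Lemma of_nullK z : of_null (nplus z) (nminus z) = z.
Proof.
case: z => x v; rewrite /of_null /nplus /nminus /=.
by congr pair; apply/matrixP => i j; rewrite !mxE; field.
Qed.

Lemma nplus_flow t z : nplus (flow t z) = expR t *: nplus z.
Proof.
have := @flow_null R 1 t z; rewrite expr1n mul1r !scale1r; exact.
Qed.

Lemma nminus_flow t z : nminus (flow t z) = expR (- t) *: nminus z.
Proof.
have := @flow_null R (-1) (- t) z; rewrite sqrrN expr1n mulrNN mul1r !scaleN1r; exact.
Qed.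

Lemma nplus_act (A : 'M[R]_4) z : nplus (act A z) = A *m nplus z.
Proof. by rewrite /nplus /act/= mulmxDr. Qed.

Lemma nminus_act (A : 'M[R]_4) z : nminus (act A z) = A *m nminus z.
Proof. by rewrite /nminus /act/= mulmxBr. Qed.

Lemma act_of_null (A : 'M[R]_4) a b : act A (of_null a b) = of_null (A *m a) (A *m b).
Proof. by rewrite /act /of_null /= -!scalemxAr mulmxDr mulmxBr. Qed.

Lemma flow_of_null t a b : flow t (of_null a b) = of_null (expR t *: a) (expR (- t) *: b).
Proof.
rewrite -[LHS]of_nullK nplus_flow nminus_flow /nplus /nminus /of_null /=.
by congr (of_null (_ *: _) (_ *: _)); apply/matrixP => i j; rewrite !mxE; field.
Qed.

Lemma T1_of_null a b : q a a = 0 -> q b b = 0 -> q a b = -2 -> T1AdS3 (of_null a b).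
Proof.
move=> aa bb ab; split; rewrite /of_null/= !qlin (qC b) aa bb ab; by field.
Qed.

Lemma T1_nplus_nminus z : T1AdS3 z -> q (nplus z) (nminus z) = -2.
Proof. by case=> xx xv vv; rewrite /nplus /nminus !qlin (qC z.2) xx xv vv; ring. Qed.

Lemma cvg_of_null {T : Type} {F : set_system T} {FF : Filter F} (f g : T -> 'cV[R]_4) a b :
  f u @[u --> F] --> a -> g u @[u --> F] --> b -> of_null (f u) (g u) @[u --> F] --> of_null a b.
Proof.
by move=> fa gb; apply: cvg_pairE;
  [exact: (cvgZ (cvg_cst _) (cvgD fa gb))|exact: (cvgZ (cvg_cst _) (cvgB fa gb))].
Qed.

Lemma cvg_nplus {T : Type} {F : set_system T} {FF : Filter F} (f : T -> phase R) z :
  f u @[u --> F] --> z -> nplus (f u) @[u --> F] --> nplus z.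
Proof. by move=> fz; have f1 := cvg_pair1 fz; have f2 := cvg_pair2 fz; exact: (cvgD f1 f2). Qed.

Lemma cvg_nminus {T : Type} {F : set_system T} {FF : Filter F} (f : T -> phase R) z :
  f u @[u --> F] --> z -> nminus (f u) @[u --> F] --> nminus z.
Proof. by move=> fz; have f1 := cvg_pair1 fz; have f2 := cvg_pair2 fz; exact: (cvgB f1 f2). Qed.

Lemma isom_eigenvector_null (B : 'M[R]_4) (x : 'cV[R]_4) (m : R) :
  isom B -> 1 < m -> B *m x = m *: x -> q x x = 0.
Proof.
move=> iB m1 Bx; have := iB x x; rewrite Bx !qlin => h.
have : (m ^+ 2 - 1) * q x x = 0 by rewrite mulrBl mul1r -{2}h; ring.
move=> /eqP; rewrite mulf_eq0 => /orP[|/eqP//]; rewrite subr_eq0 sqrf_eq1.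
by case/orP => /eqP m1E; move: m1; rewrite m1E; lra.
Qed.

End NullCoordinates.

(** * Periodic orbits near non-wandering points *)

Section Closing.
Context {R : realType} (G : subgroup22 R) (L : set 'cV[R]_4).
Hypothesis aL : acausal_circle L.
Hypothesis GL : forall A, sg_set G A -> bd_act A @` L = L.

Local Notation NW := (non_wandering (@qflow R G L)).
Local Notation Per := (periodic_points (@qflow R G L)).

(** The base point of the flow at time [t] is half of [e^t (x + v) + e^-t (x - v)]; when one pairing
    vanishes, the other has the sign of the sum. *)
Lemma Mtilde_null_lt0 z nu : Mtilde L z -> L nu -> q (nplus z) nu = 0 -> q (nminus z) nu < 0.
Proof.
move=> /MtildeP[Tz [t tz]] Lnu a0; have := tz _ Lnu.
have -> : (flow t z).1 = 2^-1 *: (expR t *: nplus z + expR (- t) *: nminus z).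
  by rewrite -nplus_flow -nminus_flow -{1}(of_nullK (flow t z)).
rewrite qZl qDl !qZl a0 mulr0 add0r pmulr_rlt0 ?invr_gt0//.
by rewrite pmulr_rlt0 ?expR_gt0.
Qed.

Lemma Mtilde_null_lt0' z nu : Mtilde L z -> L nu -> q (nminus z) nu = 0 -> q (nplus z) nu < 0.
Proof.
move=> /MtildeP[Tz [t tz]] Lnu a0; have := tz _ Lnu.
have -> : (flow t z).1 = 2^-1 *: (expR t *: nplus z + expR (- t) *: nminus z).
  by rewrite -nplus_flow -nminus_flow -{1}(of_nullK (flow t z)).
rewrite qZl qDl !qZl a0 mulr0 addr0 pmulr_rlt0 ?invr_gt0//.
by rewrite pmulr_rlt0 ?expR_gt0.
Qed.

(** Near-returns start and end near the same [z], so [axis_limit] applies with equal limits at both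
    ends: [nminus z] becomes an eigenvector of [P] and [nplus z] one of [adjq P], with images
    spanned by [nu1] and [nu2]. The coefficients are positive because [c] and the pairings are
    negative. *)
Lemma non_wandering_axis (z : Mtilde L) : NW (orbit_proj G z) ->
  exists (U : set_system nat) (A : nat -> 'M[R]_4) (P : 'M[R]_4) (c al be : R) nu1 nu2,
    [/\ UltraFilter U, forall n, sg_set G (A n), diverges (U := U) (fun n => `|A n|),
       `|A n|^-1 *: A n @[n --> U] --> P & [/\ c < 0, L nu1, L nu2,
        (forall x, P *m x = (c * q nu2 x) *: nu1) /\
        (forall x, adjq P *m x = (c * q nu1 x) *: nu2)
      & [/\ 0 < al, 0 < be, nplus (\val z) = al *: nu2 & nminus (\val z) = be *: nu1]]].
Proof.
move=> /(non_wanderingP aL GL) h.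
have h' (n : nat) : exists tyA : R * (Mtilde L * 'M[R]_4),
   [/\ n.+1%:R <= tyA.1, sg_set G tyA.2.2, `|\val z - \val tyA.2.1| < n.+1%:R^-1
    & `|\val z - act tyA.2.2 (flow tyA.1 (\val tyA.2.1))| < n.+1%:R^-1].
  have [||t [y [A H]]] := h n.+1%:R^-1 n.+1%:R; rewrite ?invr_gt0//.
  by exists (t, (y, A)).
have [f fP] := choice h'; have [U [UU ooU]] := nat_ultrafilter.
have hU : (n.+1%:R^-1 : R) @[n --> U] --> 0 by move=> B /(@cvg_harmonic R) /ooU.
have near_z (g : nat -> phase R) : (forall n, `|\val z - g n| < n.+1%:R^-1) ->
    g n @[n --> U] --> \val z.
  move=> gz; apply/cvgrPdist_le => e e0; move/cvgrPdist_le : hU => /(_ _ e0).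
  by apply: filterS => n; rewrite sub0r normrN ger0_norm//; apply: le_trans; exact: ltW.
pose A n := (f n).2.2; pose s n := (f n).1; pose y n := \val (f n).2.1.
pose y' n := act (A n) (flow (s n) (y n)).
have GA n : sg_set G (A n) by have [] := fP n.
have yz : y n @[n --> U] --> \val z by apply: near_z => n; have [] := fP n.
have yz' : y' n @[n --> U] --> \val z by apply: near_z => n; have [] := fP n.
have soo : diverges (U := U) s.
  move=> M; apply: ooU; exists (Num.trunc M).+1 => // n /= Mn.
  have [h1 _ _ _] := fP n; apply: le_trans h1.
  rewrite (le_trans (ltW (truncnS_gt M)))// ler_nat (leq_trans Mn)//.
have Mz := Mtilde_val z; have Tz := Mtilde_T1 Mz.
have pm := T1_nplus_nminus Tz.
have p0 : nplus (\val z) <> 0 by move=> e; move: pm; rewrite e q0l; lra.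
have m0 : nminus (\val z) <> 0 by move=> e; move: pm; rewrite e q0r; lra.
have nd nu : L nu -> q nu (nplus (\val z)) = 0 -> q nu (nminus (\val z)) <> 0.
  move=> Lnu; rewrite qC => /(Mtilde_null_lt0 Mz Lnu); rewrite qC => /lt_eqF h0 h1.
  by move: h0; rewrite h1 eqxx.
have e1 n : A n *m nplus (y n) = expR (- s n) *: nplus (y' n).
  by rewrite nplus_act nplus_flow -scalemxAr scalerA -expRD addNr expR0 scale1r.
have e2 n : A n *m nminus (y n) = expR (s n) *: nminus (y' n).
  by rewrite nminus_act nminus_flow -scalemxAr scalerA -expRD subrr expR0 scale1r.
have [P [c [sg [nu1 [nu2 [[BP c0 L1 L2] [PE PE'] [Aoo [q2 q1]] [sg0 _] [Pb Pa]]]]]]] :=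
  axis_limit aL GL (nearW _ GA) soo (cvg_nplus yz) (cvg_nminus yz) (cvg_nplus yz')
   (cvg_nminus yz') e1 e2 p0 m0 nd.
have sgn : sg != 0 by rewrite gt_eqF.
pose be := sg^-1 * (c * q nu2 (nminus (\val z))).
pose al := sg^-1 * (c * q nu1 (nplus (\val z))).
have mE : nminus (\val z) = be *: nu1.
  by rewrite -scalerA -PE Pb scalerA mulVf// scale1r.
have pE : nplus (\val z) = al *: nu2.
  by rewrite -scalerA -PE' Pa scalerA mulVf// scale1r.
exists U, A, P, c, al, be, nu1, nu2; split => //; split => //; split => //.
  rewrite qC in q1; have lt := Mtilde_null_lt0' Mz L1 q1.
  by rewrite mulr_gt0 ?invr_gt0// nmulr_rgt0// qC.
rewrite qC in q2; have lt := Mtilde_null_lt0 Mz L2 q2.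
by rewrite mulr_gt0 ?invr_gt0// nmulr_rgt0// qC.
Qed.

Lemma non_wandering_limit_geodesics (z : Mtilde L) :
  NW (orbit_proj G z) -> limit_geodesics L (\val z).
Proof.
move=> /non_wandering_axis[U [A [P [c [al [be [nu1 [nu2
  [_ _ _ _ [_ L1 L2 _ [al0 be0 pE mE]]]]]]]]]]].
split; first exact: (Mtilde_T1 (Mtilde_val z)).
move=> sg /eqP; rewrite sqrf_eq1 => /orP[]/eqP ->.
  by exists al, nu2; rewrite scale1r.
by exists be, nu1; rewrite scaleN1r.
Qed.

Lemma expanding_eigenvalue {T : Type} {U : set_system T} {FF : Filter U} (A B : T -> 'M[R]_4)
    (s : T -> R) (x : T -> 'cV[R]_4) (d : R) :
  diverges (U := U) (fun n => `|A n|) -> 0 < d ->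
  (\forall n \near U, d <= s n /\ (`|A n|^-1 *: B n) *m x n = s n *: x n) ->
  \forall n \near U, 1 < `|A n| * s n /\ B n *m x n = (`|A n| * s n) *: x n.
Proof.
move=> Aoo d0 h; have dn : d != 0 by rewrite gt_eqF.
(* This threshold gives [|A n| * s n >= (1 + d^-1) * d = d + 1 > 1]. *)
have hA := Aoo (1 + d^-1); apply: filterS2 h hA => n [ds E] An.
have A0 : 0 < `|A n| by rewrite (lt_le_trans _ An)// addr_gt0// invr_gt0.
have An0 : `|A n| != 0 by rewrite gt_eqF.
split; last by rewrite -scalerA -E -scalemxAl scalerA mulfV// scale1r.
apply: (@lt_le_trans _ _ ((1 + d^-1) * d)); first by rewrite mulrDl mulVf// mul1r ltrDr.
by apply: ler_pM => //; [rewrite addr_ge0// invr_ge0 ltW|exact: ltW].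
Qed.

Lemma closing (z : Mtilde L) (e : R) : NW (orbit_proj G z) -> 0 < e ->
  exists2 w : Mtilde L, `|\val z - \val w| < e & Per (orbit_proj G w).
Proof.
move=> /non_wandering_axis[U [A [P [c [al [be [nu1 [nu2
  [UU GA Aoo BP [c0 L1 L2 [PE PE'] [al0 be0 pE mE]]]]]]]]]]] e0.
have Mz := Mtilde_val z; have Tz := Mtilde_T1 Mz; have pm := T1_nplus_nminus Tz.
have q21 : q nu2 nu1 < 0.
  move: pm; rewrite pE mE !qlin => h.
  by rewrite -(pmulr_rlt0 _ be0) -(pmulr_rlt0 _ al0) h; lra.
have rank1 (Q : 'M[R]_4) (n1 n2 : 'cV[R]_4) : (forall x, Q *m x = (c * q n2 x) *: n1) ->
    q n2 n1 < 0 -> exists2 w : 'rV[R]_4, Q = n1 *m w & 0 < (w *m n1) 0 0.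
  move=> QE qn; exists (c *: (n2^T *m formmx)); last first.
    by rewrite -scalemxAl mxE -qE nmulr_rgt0.
  apply/matrixP => i j; have /matrixP/(_ i 0) := QE (delta_mx j 0).
  rewrite -colE [col _ _ _ _]mxE => ->; rewrite qE -colE [col _ _ _ _]mxE.
  rewrite [LHS]mxE -scalemxAr [RHS]mxE [X in _ = _ * X]mxE big_ord1; ring.
have [w1 PE1 w10] := rank1 _ _ _ PE q21.
have [w2 PE2 w20] : exists2 w : 'rV[R]_4, adjq P = nu2 *m w & 0 < (w *m nu2) 0 0.
  by apply: rank1 PE' _; rewrite qC.
rewrite PE1 in BP.
have BP' : `|A n|^-1 *: adjq (A n) @[n --> U] --> nu2 *m w2.
  rewrite -PE2.
  have -> : (fun n => `|A n|^-1 *: adjq (A n)) = (fun n => adjq (`|A n|^-1 *: A n)).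
    by apply/funext => n; rewrite /adjq linearZ/= -scalemxAr -scalemxAl.
  by apply: cvg_adjq; rewrite PE1.
have [s1 [x1 [d1 [d10 x1n s1E]]]] := eigenvector_limit BP w10.
have [s2 [x2 [d2 [d20 x2n s2E]]]] := eigenvector_limit BP' w20.
pose m1 n := `|A n| * s1 n; pose m2 n := `|A n| * s2 n.
have E1 : \forall n \near U, 1 < m1 n /\ A n *m x1 n = m1 n *: x1 n.
  exact: (expanding_eigenvalue Aoo d10 s1E).
have E2 : \forall n \near U, 1 < m2 n /\ adjq (A n) *m x2 n = m2 n *: x2 n.
  exact: (expanding_eigenvalue Aoo d20 s2E).
have qx : q (x2 n) (x1 n) @[n --> U] --> q nu2 nu1 by exact: cvg_q.
have qx0 : \forall n \near U, q (x2 n) (x1 n) < 0 by exact: (cvgr_lt _ qx).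
(* Eigenvectors are determined up to scale; the factor of [x2] is fixed by [q (a n) (b n) = -2], the
   condition for a unit tangent vector. *)
pose a n := ((- 2) / (be * q (x2 n) (x1 n))) *: x2 n; pose b n := be *: x1 n.
have an : a n @[n --> U] --> nplus (\val z).
  have -> : nplus (\val z) = ((- 2) / (be * q nu2 nu1)) *: nu2.
    rewrite pE; congr (_ *: _); rewrite -pm pE mE !qlin; field.
    by rewrite (lt_eqF q21) (gt_eqF be0).
  apply: cvgZ => //; apply: cvgM; first exact: cvg_cst.
  apply: cvgV; first by rewrite mulf_eq0 (gt_eqF be0) (lt_eqF q21).
  exact: (cvgM (cvg_cst _) qx).
have bn : b n @[n --> U] --> nminus (\val z).
  by rewrite mE; exact: (cvgZ (cvg_cst _) x1n).
have wz : of_null (a n) (b n) @[n --> U] --> \val z.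
  by have := cvg_of_null an bn; rewrite of_nullK; exact.
have Tw : \forall n \near U, T1AdS3 (of_null (a n) (b n)).
  apply: filterS3 E1 E2 qx0 => n [m11 Ax1] [m21 Ax2] q0.
  apply: T1_of_null.
  - by rewrite /a !qlin (isom_eigenvector_null (sg_isom (sg_adjq (GA n))) m21 Ax2) !mulr0.
  - by rewrite /b !qlin (isom_eigenvector_null (sg_isom (GA n)) m11 Ax1) !mulr0.
  - rewrite /a /b !qlin; field.
    by rewrite (lt_eqF q0) (gt_eqF be0).
have Mw : \forall n \near U, Mtilde L (of_null (a n) (b n)) by exact: (Mtilde_near aL Mz wz Tw).
have ew : \forall n \near U, `|\val z - of_null (a n) (b n)| < e.
  by move/cvgrPdist_lt : wz; exact.
have [n [[[m11 Ax1] [m21 Ax2]] [q0 [Mn en]]]] :=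
    filter_ex (filterI (filterI E1 E2) (filterI qx0 (filterI Mw ew))).
exists (mk_Mtilde Mn) => //.
(* [A] multiplies [x1] by [m1] and [x2] by [m2^-1] while preserving their nonzero pairing. *)
have mm : m1 n = m2 n.
  have Ax2' : m2 n *: (A n *m x2 n) = x2 n.
    by rewrite scalemxAr -Ax2 mulmxA (sg_mulVK (GA n)) mul1mx.
  have := sg_isom (GA n) (x2 n) (x1 n).
  rewrite Ax1 -{2}Ax2' qZr qZl => /eqP; rewrite -subr_eq0 -mulrBl mulf_eq0.
  case/orP => [|/eqP h]; first by rewrite subr_eq0 => /eqP.
  by move: q0; rewrite -Ax2' qZl h mulr0 ltxx.
(* The flow at time [ln m1] multiplies [a] by [m1] and [b] by [m1^-1], and [A n] undoes both. *)
exists (ln (m1 n)); first by rewrite ln_gt0.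
rewrite qflow_orbit_proj; apply/orbit_proj_eq; exists (A n) => //=.
have m10 : 0 < m1 n by exact: lt_trans m11.
rewrite flow_of_null act_of_null expRN lnK//.
have m1n : m1 n != 0 by rewrite gt_eqF.
have Ax2' : A n *m x2 n = (m1 n)^-1 *: x2 n.
  rewrite -[x2 n in RHS]mul1mx -(sg_mulVK (GA n)) -mulmxA Ax2 mm -scalemxAr.
  by rewrite scalerA mulVf ?scale1r// -mm.
congr of_null; rewrite /a /b -!scalemxAr.
  by rewrite Ax2' !scalerA mulrAC mulfV// mul1r.
by rewrite Ax1 !scalerA mulrAC mulVf// mul1r.
Qed.

Lemma non_wandering_periodic : NW = closure Per.
Proof.
apply/seteqP; split=> [p|p cp].
  have [z ->] := orbit_proj_surj p => NWz V; rewrite nbhsE => -[W [oW Wz] WV].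
  have [e e0 eW] := open_orbit oW Wz; have [w ew Pw] := closing NWz e0.
  by exists (orbit_proj G w); split => //; apply: WV; exact: eW.
apply: (@non_wandering_closed _ _ (@qflow R G L)).
exact: (closure_subset (@periodic_non_wandering _ G L)).
Qed.

Lemma non_wandering_compact : acts_cocompactly G (convex_core L) -> compact NW.
Proof.
move=> Gcc; apply: (subclosed_compact _ (limit_geodesics_orbit_compact aL GL Gcc)).
  exact: non_wandering_closed.
move=> p; have [z ->] := orbit_proj_surj p => NWz.
by exists z => //; exact: non_wandering_limit_geodesics.
Qed.

End Closing.

(** * Exponential contraction *)

Section Contraction.
Context {R : realType} (G : subgroup22 R) (L : set 'cV[R]_4).
Hypothesis aL : acausal_circle L.
Hypothesis GL : forall A, sg_set G A -> bd_act A @` L = L.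
Hypothesis Gpd : acts_properly_discontinuously G (convex_core L).
Hypothesis Gcc : acts_cocompactly G (convex_core L).
Variable sg : R.
Hypothesis sg2 : sg ^+ 2 = 1.
Implicit Types (z w : phase R) (u : 'cV[R]_4) (t : R).

Local Notation S := (limit_geodesics L).

Definition orthogonal_to z u : Prop := q u z.1 = 0 /\ q u z.2 = 0.

(** Stable vectors for [sg = 1], unstable ones for [sg = -1]; in both cases [flow (sg * t)]
    contracts them by [e^-t]. *)
Definition antidiag u : phase R := (u, - sg *: u).

Lemma antidiagZ (c : R) u : antidiag (c *: u) = c *: antidiag u.
Proof. by rewrite /antidiag; congr pair; rewrite !scalerA mulrC. Qed.

Lemma sg_neq0 : sg != 0.
Proof. by apply/eqP => h; move: sg2; rewrite h expr0n/=; lra. Qed.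

Lemma flow_antidiag t u : flow (sg * t) (antidiag u) = expR (- t) *: antidiag u.
Proof.
have h : sg = 1 \/ sg = -1.
  by move/eqP: sg2; rewrite sqrf_eq1 => /orP[]/eqP; [left|right].
rewrite /flow /antidiag /= /cosh /sinh; case: h => ->.
  by congr pair; apply/matrixP => i j; rewrite !mxE mul1r; field.
by congr pair; apply/matrixP => i j; rewrite !mxE mulN1r opprK; field.
Qed.

Lemma act_antidiag (A : 'M[R]_4) u : act A (antidiag u) = antidiag (A *m u).
Proof. by rewrite /act /antidiag/= scalemxAr. Qed.

Lemma orthogonal_act (A : 'M[R]_4) z u : isom A -> orthogonal_to z u ->
  orthogonal_to (act A z) (A *m u).
Proof. by move=> iA [h1 h2]; split; rewrite /act/= iA. Qed.

Definition mnorm2 z u : R := metric G z (antidiag u) (antidiag u).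

Lemma mnorm2_act (A : 'M[R]_4) z u : sg_set G A -> mnorm2 (act A z) (A *m u) = mnorm2 z u.
Proof. by move=> GA; rewrite /mnorm2 -act_antidiag metric_act. Qed.

Lemma metricZ z w (c : R) : Mtilde L z -> metric G z (c *: w) (c *: w) = c ^+ 2 * metric G z w w.
Proof.
move=> Mz; have h w' x : metric G z w' (c *: x) = c * metric G z w' x.
  have l := metric_linear aL GL Gpd w' Mz.
  have l0 : metric G z w' 0 = 0.
    have := l 0 0 0; rewrite scaler0 addr0 -[0 *: _]/(0 * _) mul0r add0r => e.
    have := l 1 0 0; rewrite scaler0 addr0 -[1 *: _]/(1 * _) mul1r; lra.
  have := l c x 0; rewrite !addr0 => ->.
  by rewrite -[c *: _]/(c * _) l0 addr0.
by rewrite h metricC h mulrA -expr2.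
Qed.

Lemma mnorm2Z z u (c : R) : Mtilde L z -> mnorm2 z (c *: u) = c ^+ 2 * mnorm2 z u.
Proof. by move=> Mz; rewrite /mnorm2 antidiagZ metricZ. Qed.

Lemma mnorm2_gt0 z u : Mtilde L z -> u <> 0 -> 0 < mnorm2 z u.
Proof. by move=> Mz u0; apply: (metric_gt0 aL GL Gpd) => // -[]. Qed.

Lemma mnorm2_0 z : Mtilde L z -> mnorm2 z 0 = 0.
Proof. by move=> Mz; rewrite -(scale0r 0) mnorm2Z// expr0n mul0r. Qed.

Lemma mnorm2_ge0 z u : Mtilde L z -> 0 <= mnorm2 z u.
Proof.
move=> Mz; have [->|/eqP u0] := eqVneq u 0; first by rewrite mnorm2_0.
exact/ltW/mnorm2_gt0.
Qed.

Lemma mnorm2_cvg {T : Type} {U : set_system T} {FF : Filter U} (f : T -> phase R)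
    (g : T -> 'cV[R]_4) z u : Mtilde L z ->
  f n @[n --> U] --> z -> g n @[n --> U] --> u -> mnorm2 (f n) (g n) @[n --> U] --> mnorm2 z u.
Proof.
move=> Mz fz gu; apply: (metric_cvg aL GL Gpd) => //.
by apply: cvg_pairE => //=; exact: (cvgZ (cvg_cst _) gu).
Qed.

(* A violation of a contraction estimate may be moved by the group to a bounded
   region and normalized, and so has a limit. *)
Lemma normalized_violation (I : nat -> R -> Prop) (k : nat -> R) :
  (forall n, 0 <= k n) ->
  (forall n, exists z u t, [/\ S z, orthogonal_to z u, I n t &
     k n * mnorm2 z u < mnorm2 (flow (sg * t) z) (expR (- t) *: u)]) ->
  exists (U : set_system nat) (z : nat -> phase R) (u : nat -> 'cV[R]_4) (t : nat -> R)
    (z0 : phase R) (u0 : 'cV[R]_4),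
    [/\ UltraFilter U /\ \oo `<=` U, z n @[n --> U] --> z0 /\ u n @[n --> U] --> u0,
        S z0 /\ orthogonal_to z0 u0, u0 <> 0
      & forall n, [/\ S (z n), I n (t n) &
     k n * mnorm2 (z n) (u n) < mnorm2 (flow (sg * t n) (z n)) (expR (- t n) *: u n)]].
Proof.
move=> k0 h; have [M MP] := limit_geodesics_cocompact aL GL Gcc.
have h' (n : nat) : exists p : phase R * ('cV[R]_4 * R),
  [/\ S p.1, `|p.1| <= M, orthogonal_to p.1 p.2.1, `|p.2.1| = 1 & I n p.2.2 /\
     k n * mnorm2 p.1 p.2.1 < mnorm2 (flow (sg * p.2.2) p.1) (expR (- p.2.2) *: p.2.1)].
  have [z [u [t [Sz zu It lt]]]] := h n; have [A GA AM] := MP _ Sz.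
  have Mz := limit_geodesics_Mtilde aL Sz.
  have Mft := limit_geodesics_Mtilde aL (limit_geodesics_flow (sg * t) Sz).
  have u0 : u <> 0.
    by move=> u0; move: lt; rewrite u0 scaler0 !mnorm2_0// mulr0 ltxx.
  have Au0 : `|A *m u| != 0.
    rewrite normr_eq0; apply/eqP => Au0; apply: u0.
    by rewrite -[u]mul1mx -(sg_mulK GA) -mulmxA Au0 mulmx0.
  pose c := `|A *m u|^-1; have c0 : 0 < c by rewrite invr_gt0 lt_def Au0 normr_ge0.
  have SA := limit_geodesics_act aL GL GA Sz.
  exists (act A z, (c *: (A *m u), t)); split => //=.
  - have [h1 h2] := orthogonal_act (sg_isom GA) zu.
    by split; rewrite qZl ?h1 ?h2 mulr0.
  - by rewrite normrZ /c normfV normr_id mulVf.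
  have MA := limit_geodesics_Mtilde aL SA.
  have MAf := Mtilde_act aL GL GA Mft.
  split => //; rewrite flow_act scalerA [_ * c]mulrC -scalerA (scalemxAr (expR (- t))).
  rewrite (mnorm2Z _ _ MA) (mnorm2Z _ _ MAf) !(mnorm2_act _ _ GA).
  by rewrite mulrCA ltr_pM2l// exprn_gt0.
have [f fP] := choice h'; have [U [UU ooU]] := nat_ultrafilter.
have [z0 zz] : exists z0 : phase R, (f n).1 @[n --> U] --> z0.
  by apply: (@ultra_phase_cvg _ _ U _ _ M); apply: nearW => n; have [] := fP n.
have [u0 uu] : exists u0 : 'cV[R]_4, (f n).2.1 @[n --> U] --> u0.
  by apply: (@ultra_mx_cvg _ _ U _ _ _ _ 1); apply: nearW => n; have [_ _ _ -> _] := fP n.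
exists U, (fun n => (f n).1), (fun n => (f n).2.1), (fun n => (f n).2.2), z0, u0; split => //.
- have Sz0 : S z0.
    by apply: (limit_geodesics_lim aL (U := U)) zz; apply: nearW => n; have [] := fP n.
  split => //; have z1 := cvg_pair1 zz; have z2 := cvg_pair2 zz.
  split; apply: (@cvg_near_eq _ _ U _ R^o _ (fun=> 0)).
  + by apply: nearW => n; have [_ _ [h1 _] _ _] := fP n; exact: h1.
  + exact: cvg_q.
  + exact: cvg_cst.
  + by apply: nearW => n; have [_ _ [_ h1] _ _] := fP n; exact: h1.
  + exact: cvg_q.
  + exact: cvg_cst.
- move=> u00; have := @cvg_near_eq _ _ U _ R^o (fun n => `|(f n).2.1|) (fun=> 1) `|u0| 1.
  rewrite u00 normr0 => H; have : (0 : R) = 1.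
    apply: H; last exact: cvg_cst.
      by apply: nearW => n; have [_ _ _ -> _] := fP n.
    by have := cvg_norm uu; rewrite u00 normr0; exact.
  by move/eqP; rewrite eq_sym oner_eq0.
- by move=> n; have [h1 _ _ _ [h2 h3]] := fP n.
Qed.

(** [mnorm2] is a squared norm, so lengths are at least halved after time [T0]. *)
Lemma eventual_contraction : exists2 T0 : R, 0 < T0 & forall z u t,
  S z -> orthogonal_to z u -> T0 <= t ->
  mnorm2 (flow (sg * t) z) (expR (- t) *: u) <= 4^-1 * mnorm2 z u.
Proof.
apply: contrapT => nh.
have [//|n|U [z [u [t [z0 [u0 [[UU ooU] [zz uu] [Sz0 zu0] u00 H]]]]]]] :=
  @normalized_violation (fun n t => n.+1%:R <= t) (fun=> 4^-1).
  apply: contrapT => h; apply: nh; exists n.+1%:R => // z u t Sz zu nt.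
  by rewrite leNgt; apply/negP => lt; apply: h; exists z, u, t.
have Mz0 := limit_geodesics_Mtilde aL Sz0.
have too : diverges (U := U) t.
  move=> M; apply: ooU; exists (Num.trunc M).+1 => // n /= Mn.
  have [_ h1 _] := H n; apply: le_trans h1.
  by rewrite (le_trans (ltW (truncnS_gt M)))// ler_nat (leq_trans Mn).
(* The violations start in a bounded region; a second sequence [A] of group elements brings their
   endpoints back, so that both ends converge. *)
have [M MP] := limit_geodesics_cocompact aL GL Gcc.
have h' (n : nat) : exists A, sg_set G A /\ `|act A (flow (sg * t n) (z n))| <= M.
  by have [Sz _ _] := H n; have [A GA AM] := MP _ (limit_geodesics_flow (sg * t n) Sz); exists A.
have [A AP] := choice h'.
have GA n : sg_set G (A n) by have [] := AP n.
pose y n := act (A n) (flow (sg * t n) (z n)).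
have Sy n : S (y n).
  by apply: (limit_geodesics_act aL GL) => //; apply: limit_geodesics_flow; have [] := H n.
have [y0 yy] : exists y0 : phase R, y n @[n --> U] --> y0.
  by apply: (@ultra_phase_cvg _ _ U _ _ M); apply: nearW => n; have [] := AP n.
have Sy0 : S y0.
  by apply: (limit_geodesics_lim aL (U := U)) yy; exact: nearW.
have My0 := limit_geodesics_Mtilde aL Sy0.
pose p w := w.1 + sg *: w.2; pose m w := w.1 - sg *: w.2.
have cp (f : nat -> phase R) w : f n @[n --> U] --> w -> p (f n) @[n --> U] --> p w.
  by move=> fw; have f1 := cvg_pair1 fw; have f2 := cvg_pair2 fw; exact: (cvgD f1 (cvgZ (cvg_cst sg) f2)).
have cm (f : nat -> phase R) w : f n @[n --> U] --> w -> m (f n) @[n --> U] --> m w.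
  by move=> fw; have f1 := cvg_pair1 fw; have f2 := cvg_pair2 fw; exact: (cvgB f1 (cvgZ (cvg_cst sg) f2)).
have pf s w : p (flow (sg * s) w) = expR s *: p w by exact: flow_null.
have mf s w : m (flow (sg * s) w) = expR (- s) *: m w.
  have := @flow_null R (- sg) (- s) w; rewrite sqrrN mulrNN !scaleNr; exact.
have pA (B : 'M[R]_4) w : p (act B w) = B *m p w by rewrite /p /act/= mulmxDr scalemxAr.
have mA (B : 'M[R]_4) w : m (act B w) = B *m m w by rewrite /m /act/= mulmxBr scalemxAr.
have pm w : S w -> q (p w) (m w) = -2 by move=> [Tw _]; exact: T1_null_pairing.
have e1 n : A n *m p (z n) = expR (- t n) *: p (y n).
  by rewrite pA pf -scalemxAr scalerA -expRD addNr expR0 scale1r.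
have e2 n : A n *m m (z n) = expR (t n) *: m (y n).
  by rewrite mA mf -scalemxAr scalerA -expRD subrr expR0 scale1r.
have p0 : p z0 <> 0 by move=> e; have := pm _ Sz0; rewrite e q0l; lra.
have m0 : m y0 <> 0 by move=> e; have := pm _ Sy0; rewrite e q0r; lra.
have nd nu : L nu -> q nu (p z0) = 0 -> q nu (m z0) <> 0.
  rewrite /p /m qDr qBr !qZr => Lnu h1 h2.
  have q1 : q nu z0.1 = 0 by lra.
  have q2 : sg * q nu z0.2 = 0 by lra.
  move/eqP : q2; rewrite mulf_eq0 (negPf sg_neq0)/= => /eqP q2.
  by apply: (Mtilde_nondeg Mz0 Lnu); rewrite qC.
have [P [c [k [nu1 [nu2 [[BP c0 L1 L2] [PE _] [_ [q2 _]] [k0 kl] _]]]]]] :=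
  axis_limit aL GL (nearW _ GA) too (cp _ _ zz) (cm _ _ zz) (cp _ _ yy) (cm _ _ yy) e1 e2 p0 m0 nd.
(* [p z0] is a positive multiple of a point of [L] orthogonal to [nu2], which must be [nu2] itself;
   and [u0] is orthogonal to [p z0]. *)
have Pu : P *m u0 = 0.
  have [_ /(_ _ sg2)[al [nu [al0 Lnu pE]]]] := Sz0.
  have al0n : al != 0 by rewrite gt_eqF.
  have nuE : nu = nu2.
    apply: contrapT => nn; have := circle_lt0 aL L2 Lnu (nesym nn).
    by move: q2; rewrite /p pE qZr => /eqP; rewrite mulf_eq0 (negPf al0n)/= => /eqP ->; rewrite ltxx.
  have : q (al *: nu2) u0 = 0.
    by rewrite -nuE -pE; have [h1 h2] := zu0; rewrite qC qDr qZr h1 h2 mulr0 addr0.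
  rewrite qZl => /eqP; rewrite mulf_eq0 (negPf al0n)/= => /eqP h.
  by rewrite PE h mulr0 scale0r.
(* The vector equals [(e^t / |A|)^-1] times [(A / |A|) u], with limit [k^-1 *: (P *m u0)]; here
   [k > 0] is essential. *)
have v0 : expR (- t n) *: (A n *m u n) @[n --> U] --> (0 : 'cV[R]_4).
  have -> : (fun n => expR (- t n) *: (A n *m u n)) =
     (fun n => (`|A n|^-1 * expR (t n))^-1 *: ((`|A n|^-1 *: A n) *m u n)).
    apply/funext => n; rewrite -scalemxAl scalerA invfM invrK expRN.
    congr (_ *: _); rewrite mulrAC mulfV ?mul1r//.
    rewrite normr_eq0; apply/eqP => A0.
    have := sg_mulK (GA n); rewrite A0 mulmx0 => /matrixP/(_ 0 0)/eqP.
    by rewrite !mxE eq_sym oner_eq0.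
  rewrite -(scaler0 _ k^-1) -Pu; apply: cvgZ; last exact: cvg_mulmx.
  by apply: cvgV => //; rewrite gt_eqF.
have lim1 : mnorm2 (y n) (expR (- t n) *: (A n *m u n)) @[n --> U] --> mnorm2 y0 0.
  exact: mnorm2_cvg.
have lim2 : 4^-1 * mnorm2 (z n) (u n) @[n --> U] --> 4^-1 * mnorm2 z0 u0.
  by apply: cvgM; [exact: cvg_cst|exact: mnorm2_cvg].
have : 4^-1 * mnorm2 z0 u0 <= mnorm2 y0 0.
  apply: (ler_cvg_to lim2 lim1); apply: nearW => n /=.
  have [_ _ lt] := H n; apply: ltW.
  by rewrite scalemxAr /y mnorm2_act.
rewrite mnorm2_0// leNgt mulr_gt0// ?invr_gt0//.
exact: mnorm2_gt0.
Qed.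

(** Violations of the bound [n.+1] have times in a compact interval, hence converge; dividing by
    [n.+1] yields [mnorm2 z0 u0 <= 0] with [u0] nonzero. *)
Lemma bounded_expansion (T0 : R) : exists2 D : R, 0 < D & forall z u t,
  S z -> orthogonal_to z u -> 0 <= t <= T0 ->
  mnorm2 (flow (sg * t) z) (expR (- t) *: u) <= D * mnorm2 z u.
Proof.
apply: contrapT => nh.
have [//|n|U [z [u [t [z0 [u0 [[UU ooU] [zz uu] [Sz0 zu0] u00 H]]]]]]] :=
  @normalized_violation (fun n t => 0 <= t <= T0) (fun n => n.+1%:R).
  apply: contrapT => h; apply: nh; exists n.+1%:R => // z u t Sz zu nt.
  by rewrite leNgt; apply/negP => lt; apply: h; exists z, u, t.
have Mz0 := limit_geodesics_Mtilde aL Sz0.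
have [t0 tt] : exists t0 : R, t n @[n --> U] --> t0.
  have [|t0 _ h] := @ultra_cvg _ U UU _ `[0, T0] t (@segment_compact R _ _).
    by apply: nearW => n; have [_ h _] := H n; rewrite /= in_itv.
  by exists t0.
have My0 := limit_geodesics_Mtilde aL (limit_geodesics_flow (sg * t0) Sz0).
have eR : expR (- t n) @[n --> U] --> expR (- t0).
  by move=> B lB; exact: (cvgN tt) (@continuous_expR R (- t0) B lB).
have lim1 : mnorm2 (flow (sg * t n) (z n)) (expR (- t n) *: u n) @[n --> U] -->
    mnorm2 (flow (sg * t0) z0) (expR (- t0) *: u0).
  apply: mnorm2_cvg => //; last exact: cvgZ.
  by apply: cvg_flow => //; exact: (cvgM (cvg_cst _) tt).
have lim2 : mnorm2 (z n) (u n) @[n --> U] --> mnorm2 z0 u0 by exact: mnorm2_cvg.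
have hU : (n.+1%:R^-1 : R) @[n --> U] --> 0 by move=> B /(@cvg_harmonic R) /ooU.
have : mnorm2 z0 u0 <= 0 * mnorm2 (flow (sg * t0) z0) (expR (- t0) *: u0).
  apply: (ler_cvg_to lim2 (cvgM hU lim1)); apply: nearW => n /=.
  by have [_ _ lt] := H n; rewrite ler_pdivlMl// ltW.
by rewrite mul0r leNgt mnorm2_gt0.
Qed.

Lemma exponential_contraction : exists C c : R, [/\ 0 < C, 0 < c & forall z u t,
  S z -> orthogonal_to z u -> 0 <= t ->
  mnorm2 (flow (sg * t) z) (expR (- t) *: u) <= (C * expR (- (c * t))) ^+ 2 * mnorm2 z u].
Proof.
have [T0 T00 H1] := eventual_contraction; have [D D0 H2] := bounded_expansion T0.
pose c := ln 2 / T0; have c0 : 0 < c by rewrite divr_gt0// ln_gt0// ltr1n.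
have eT : expR (- (c * T0)) = 2^-1.
  by rewrite /c divfK ?gt_eqF// expRN lnK// posrE.
(* The factor 2 pays for the incomplete last period: [t <= n.+1 * T0] gives
   [2 ^- n <= 2 * e^(-c t)]. *)
exists (2 * Num.sqrt D), c; split => //; first by rewrite mulr_gt0// sqrtr_gt0.
have orth z u t (k : R) : orthogonal_to z u -> orthogonal_to (flow t z) (k *: u).
  by move=> [h1 h2]; split; rewrite /flow/= qZl qDr !qZr h1 h2 !mulr0 addr0 mulr0.
(* Each full period [T0] contributes [4^-1], and the remaining time, at most [T0], contributes
   [D]. *)
have key (n : nat) : forall z u t, S z -> orthogonal_to z u -> n%:R * T0 <= t <= n.+1%:R * T0 ->
    mnorm2 (flow (sg * t) z) (expR (- t) *: u) <= D * 4^-1 ^+ n * mnorm2 z u.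
  elim: n => [|n IH] z u t Sz zu /andP[t1 t2].
    by rewrite expr0 mulr1; apply: H2 => //; rewrite -[0](mul0r T0) t1/= -[T0]mul1r.
  have -> : flow (sg * t) z = flow (sg * (t - T0)) (flow (sg * T0) z).
    by rewrite flowD -mulrDr subrK.
  have -> : expR (- t) *: u = expR (- (t - T0)) *: (expR (- T0) *: u).
    by rewrite scalerA -expRD; congr (expR _ *: _); ring.
  have Sz' := limit_geodesics_flow (sg * T0) Sz.
  have h1 := IH _ _ (t - T0) Sz' (orth _ _ (sg * T0) (expR (- T0)) zu).
  apply: (le_trans (h1 _)).
    move: t1 t2; rewrite -[n.+2%:R]natr1 -natr1 !mulrDl !mul1r => t1 t2.
    by rewrite lerBrDr t1 lerBlDr.
  rewrite exprSr mulrA -[_ * 4^-1 * _]mulrA ler_wpM2l//.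
    by rewrite mulr_ge0 ?(ltW D0)// exprn_ge0// invr_ge0.
  exact: H1.
move=> z u t Sz zu t0.
pose n := Num.trunc (t / T0).
have tT0 : 0 <= t / T0 by rewrite divr_ge0// ltW.
have /andP[n1 n2] : n%:R <= t / T0 < n.+1%:R by exact: truncn_itv.
have h := key n z u t Sz zu.
apply: (le_trans (h _)).
  by rewrite -ler_pdivlMr// n1/= -ler_pdivrMr// ltW.
have Mz := limit_geodesics_Mtilde aL Sz.
rewrite ler_wpM2r ?mnorm2_ge0// !exprMn sqr_sqrtr ?(ltW D0)//.
have -> : (2 : R) ^+ 2 * D * expR (- (c * t)) ^+ 2 = D * (2 * expR (- (c * t))) ^+ 2 by ring.
rewrite ler_wpM2l ?(ltW D0)//.
have -> : (4^-1 : R) ^+ n = (2^-1 ^+ n) ^+ 2.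
  by rewrite -!exprM mulnC exprM; congr (_ ^+ _); rewrite exprVn; congr (_^-1); ring.
rewrite ler_pXn2r ?nnegrE ?mulr_ge0 ?expR_ge0 ?exprn_ge0 ?invr_ge0//.
rewrite -ler_pdivrMl//.
have -> : 2^-1 * 2^-1 ^+ n = expR (- (c * (n.+1%:R * T0))).
  by rewrite -exprS -eT -expRM_natl; congr expR; ring.
rewrite ler_expR lerN2 ler_wpM2l ?(ltW c0)//.
by rewrite -ler_pdivrMr// ltW.
Qed.

End Contraction.

(** * Stable and unstable bundles *)

Section Frame.
Context {R : realType}.
Implicit Types (x y u : 'cV[R]_4) (z w : phase R).

Definition vec4 (a b c d : R) : 'cV[R]_4 := \col_i nth 0 [:: a; b; c; d] i.

Lemma vec4P (x : 'cV[R]_4) : x = vec4 (x 0 0) (x 1 0) (x 2 0) (x 3 0).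
Proof.
apply/matrixP => i j; rewrite ord1 mxE.
by case: i => [[|[|[|[|//]]]] lti] /=; congr (x _ _); exact: val_inj.
Qed.

Lemma q_vec4 a b c d a' b' c' d' :
  q (vec4 a b c d) (vec4 a' b' c' d') = - (a * a') - b * b' + c * c' + d * d'.
Proof. by rewrite /q !big_ord_recl big_ord0 !mxE /=; ring. Qed.

(* Left multiplication by the units [i], [j], [k] of the split quaternions, whose
   norm form is [- q]. *)
Definition quat_i x := vec4 (- x 1 0) (x 0 0) (- x 3 0) (x 2 0).
Definition quat_j x := vec4 (x 2 0) (- x 3 0) (x 0 0) (- x 1 0).
Definition quat_k x := vec4 (x 3 0) (x 2 0) (x 1 0) (x 0 0).

Lemma quat_orth x :
  ((q x (quat_i x) = 0) * (q x (quat_j x) = 0) * (q x (quat_k x) = 0) *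
   (q (quat_i x) x = 0) * (q (quat_j x) x = 0) * (q (quat_k x) x = 0) *
   (q (quat_i x) (quat_j x) = 0) * (q (quat_i x) (quat_k x) = 0) *
   (q (quat_j x) (quat_k x) = 0) * (q (quat_j x) (quat_i x) = 0) *
   (q (quat_k x) (quat_i x) = 0) * (q (quat_k x) (quat_j x) = 0) *
   (q (quat_i x) (quat_i x) = q x x) * (q (quat_j x) (quat_j x) = - q x x) *
   (q (quat_k x) (quat_k x) = - q x x))%type.
Proof.
rewrite (vec4P x) /quat_i /quat_j /quat_k !mxE /= !q_vec4.
by do !split; ring.
Qed.

Lemma quat_expand x y : q x x *: y = q y x *: x + q y (quat_i x) *: quat_i x
  - q y (quat_j x) *: quat_j x - q y (quat_k x) *: quat_k x.
Proof.
rewrite (vec4P x) (vec4P y) /quat_i /quat_j /quat_k !mxE /= !q_vec4.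
apply/matrixP => i j; rewrite !mxE.
by case: i => [[|[|[|[|//]]]] lti] /=; ring.
Qed.

Definition frame (b : bool) z : 'cV[R]_4 :=
  let al := - q z.2 (quat_i z.1) in
  let be := q z.2 (quat_j z.1) in
  let ga := q z.2 (quat_k z.1) in
  if b then - ga *: quat_j z.1 + be *: quat_k z.1
  else (be ^+ 2 + ga ^+ 2) *: quat_i z.1 + al *: (be *: quat_j z.1 + ga *: quat_k z.1).

(* The three coefficients of [v] in the quaternionic frame at [x] satisfy
   [- al ^ 2 + be ^ 2 + ga ^ 2 = 1]; the two frame vectors are the rotational field
   on this hyperboloid and its cross product with [v]. *)
Lemma frameP z : T1AdS3 z -> exists D : R, [/\ D != 0,
  q (frame true z) (frame true z) = D, q (frame true z) (frame false z) = 0,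
  q (frame false z) (frame false z) = - D &
  forall u, orthogonal_to z u <-> u = (q u (frame true z) / D) *: frame true z
    - (q u (frame false z) / D) *: frame false z].
Proof.
case: z => x v [/= xx xv vv]; rewrite /orthogonal_to /frame /=.
set al := - q v (quat_i x); set be := q v (quat_j x); set ga := q v (quat_k x).
have O := quat_orth x; rewrite xx in O.
have expand y : y = - q y x *: x - q y (quat_i x) *: quat_i x
    + q y (quat_j x) *: quat_j x + q y (quat_k x) *: quat_k x.
  have := quat_expand x y; rewrite xx scaleN1r => e.
  by rewrite -[LHS]opprK e; apply/matrixP => i j; rewrite !mxE; ring.
have vE : v = al *: quat_i x + be *: quat_j x + ga *: quat_k x.
  by rewrite [LHS]expand (qC v x) xv oppr0 scale0r sub0r /al scaleNr.
have n1 : be ^+ 2 + ga ^+ 2 = 1 + al ^+ 2.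
  move: vv; rewrite vE !qlin !O => e.
  have -> : 1 = - al ^+ 2 + be ^+ 2 + ga ^+ 2 by rewrite -e; ring.
  ring.
(* The rotation vanishes only on its axis, which the hyperboloid avoids. *)
have D0 : be ^+ 2 + ga ^+ 2 != 0.
  by rewrite n1 gt_eqF//; have := sqr_ge0 al; lra.
have f1x : q (- ga *: quat_j x + be *: quat_k x) x = 0 by rewrite !qlin !O; ring.
have f2x : q ((be ^+ 2 + ga ^+ 2) *: quat_i x + al *: (be *: quat_j x + ga *: quat_k x)) x = 0.
  by rewrite !qlin !O; ring.
have f1v : q (- ga *: quat_j x + be *: quat_k x) v = 0 by rewrite vE !qlin !O; ring.
have f2v : q ((be ^+ 2 + ga ^+ 2) *: quat_i x + al *: (be *: quat_j x + ga *: quat_k x)) v = 0.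
  by rewrite vE !qlin !O; ring.
exists (be ^+ 2 + ga ^+ 2); split => //.
- by rewrite !qlin !O; ring.
- by rewrite !qlin !O; ring.
- rewrite !qlin !O; transitivity ((be ^+ 2 + ga ^+ 2) * (al ^+ 2 - (be ^+ 2 + ga ^+ 2))); first by ring.
  by rewrite n1; ring.
move=> u; split=> [[ux uv]|->]; last first.
  by rewrite qBl !qZl f1x f2x qBl !qZl f1v f2v !mulr0 subrr.
rewrite [LHS]expand ux oppr0 scale0r sub0r.
move: uv; rewrite vE !qlin => uv.
set p := q u (quat_i x) in uv *; set r := q u (quat_j x) in uv *; set s := q u (quat_k x) in uv *.
have pal : p * al = - (r * be + s * ga) by lra.
have [D DE] : exists D, D = be ^+ 2 + ga ^+ 2 by exists (be ^+ 2 + ga ^+ 2).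
rewrite -DE in D0 *.
have e2 : D * p + al * (be * r + ga * s) = p.
  transitivity (p * (D - al ^+ 2) + al * (p * al + (r * be + s * ga))); first by ring.
  by rewrite pal addNr mulr0 addr0 DE n1; ring.
have e1 (k l m : R) : k * r - l * s - p * al * m = (k + m * be) * r + (m * ga - l) * s.
  by rewrite pal; ring.
have c1 : (- ga * r + be * s) / D * - ga - p / D * (al * be) = r.
  transitivity ((ga ^+ 2 * r - (ga * be) * s - p * al * be) / D); first by ring.
  rewrite e1; transitivity (r * D / D); last by rewrite mulfK.
  by rewrite DE; ring.
have c2 : (- ga * r + be * s) / D * be - p / D * (al * ga) = s.
  transitivity ((- (ga * be) * r - - (be ^+ 2) * s - p * al * ga) / D); first by ring.
  rewrite e1; transitivity (s * D / D); last by rewrite mulfK.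
  by rewrite DE; ring.
have c3 : p / D * D = p by rewrite divfK.
(* Both quotients become variables [k], [l], and the coordinates of [u] are replaced by their
   expressions in these, leaving a division-free identity. *)
rewrite e2; move: c1 c2 c3; move: (_ / D) (p / D) => k l <- <- <-.
by apply/matrixP => i j; rewrite !mxE; ring.
Qed.

(** A span of sections defined everywhere, so that one frame proves continuity. [mem_bundle]
    recovers the description by orthogonality, on which invariance rests. *)
Definition bundle (sg : R) z : {vspace phase R} :=
  <<[tuple antidiag sg (frame (i == ord0 :> 'I_2) z) | i < 2]>>%VS.

Lemma sum_frame (sg : R) z (k : 'I_2 -> R) :
  \sum_i k i *: [tuple antidiag sg (frame (i == ord0 :> 'I_2) z) | i < 2]`_i =
  antidiag sg (k ord0 *: frame true z + k (lift ord0 ord0) *: frame false z).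
Proof.
rewrite !big_ord_recl big_ord0 addr0 /=.
have -> : [tuple antidiag sg (frame (i == ord0 :> 'I_2) z) | i < 2]`_0 = antidiag sg (frame true z).
  by have := nth_mktuple (fun i : 'I_2 => antidiag sg (frame (i == ord0) z)) 0 ord0; rewrite eqxx.
have -> : [tuple antidiag sg (frame (i == ord0 :> 'I_2) z) | i < 2]`_1 = antidiag sg (frame false z).
  by have := nth_mktuple (fun i : 'I_2 => antidiag sg (frame (i == ord0) z)) 0 (lift ord0 ord0).
by rewrite /antidiag; congr pair; apply/matrixP => i j; rewrite !mxE; ring.
Qed.

Lemma mem_bundle (sg : R) z w : T1AdS3 z ->
  w \in bundle sg z <-> exists2 u, orthogonal_to z u & w = antidiag sg u.
Proof.
move=> Tz; have [D [D0 f11 f12 f22 fE]] := frameP Tz.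
split=> [/coord_span ->|[u /fE uE ->]].
  rewrite sum_frame; eexists; last by [].
  apply/fE; move: f11 f12 f22; move: (frame true z) (frame false z) => f1 f2 f11 f12 f22.
  rewrite !qlin f11 f12 f22 (qC f2) f12.
  by congr (_ *: _ + _); rewrite ?mulr0 ?addr0 ?add0r ?mulfK// -scaleNr mulrN mulNr mulfK ?opprK.
rewrite uE.
have -> : antidiag sg ((q u (frame true z) / D) *: frame true z - (q u (frame false z) / D) *: frame false z) =
  \sum_i (if i == ord0 :> 'I_2 then q u (frame true z) / D else - (q u (frame false z) / D)) *:
    [tuple antidiag sg (frame (i == ord0 :> 'I_2) z) | i < 2]`_i.
  rewrite sum_frame eqxx (_ : (lift ord0 ord0 == ord0 :> 'I_2) = false)//.
  by rewrite [in RHS]scaleNr.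
apply: rpred_sum => i _; apply: rpredZ; apply: memv_span; apply: mem_nth.
by rewrite size_tuple.
Qed.

Lemma frame_free (sg : R) z : T1AdS3 z ->
  free [tuple antidiag sg (frame (i == ord0 :> 'I_2) z) | i < 2].
Proof.
move=> Tz; have [D [D0 f11 f12 f22 _]] := frameP Tz.
apply/freeP => k; rewrite sum_frame => /(congr1 fst) /= k0.
have k1 : k ord0 = 0.
  have := q0l (frame true z); rewrite -k0 qDl !qZl f11 (qC (frame false z)) f12 mulr0 addr0.
  by move/eqP; rewrite mulf_eq0 (negPf D0) orbF => /eqP.
have k2 : k (lift ord0 ord0) = 0.
  have := q0l (frame false z); rewrite -k0 qDl !qZl f12 f22 mulr0 add0r.
  by move/eqP; rewrite mulf_eq0 oppr_eq0 (negPf D0) orbF => /eqP.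
by move=> i; case: (unliftP ord0 i) => [j ->|->//]; rewrite ord1.
Qed.

Lemma frame_continuous b : continuous (frame b).
Proof.
move=> z; have z1 : w.1 @[w --> z] --> z.1 by exact: cvg_fst.
have z2 : w.2 @[w --> z] --> z.2 by exact: cvg_snd.
have vc (f1 f2 f3 f4 : phase R -> R) (l1 l2 l3 l4 : R) :
    f1 w @[w --> z] --> l1 -> f2 w @[w --> z] --> l2 -> f3 w @[w --> z] --> l3 ->
    f4 w @[w --> z] --> l4 ->
    vec4 (f1 w) (f2 w) (f3 w) (f4 w) @[w --> z] --> vec4 l1 l2 l3 l4.
  move=> h1 h2 h3 h4; apply: cvg_mx => i j; rewrite mxE; under eq_fun do rewrite mxE.
  by case: i => [[|[|[|[|//]]]] lti].
have xc (i : 'I_4) : (w : phase R).1 i 0 @[w --> z] --> z.1 i 0 by exact: cvg_coord.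
have ci : quat_i w.1 @[w --> z] --> quat_i z.1.
  by apply: vc => //; apply: cvgN; exact: xc.
have cj : quat_j w.1 @[w --> z] --> quat_j z.1.
  by apply: vc => //; apply: cvgN; exact: xc.
have ck : quat_k w.1 @[w --> z] --> quat_k z.1 by exact: vc.
have al : - q w.2 (quat_i w.1) @[w --> z] --> - q z.2 (quat_i z.1) by apply: cvgN; exact: cvg_q.
have be : q w.2 (quat_j w.1) @[w --> z] --> q z.2 (quat_j z.1) by exact: cvg_q.
have ga : q w.2 (quat_k w.1) @[w --> z] --> q z.2 (quat_k z.1) by exact: cvg_q.
case: b; first exact: (cvgD (cvgZ (cvgN ga) cj) (cvgZ be ck)).
exact: (cvgD (cvgZ (cvgD (cvgM be be) (cvgM ga ga)) ci) (cvgZ al (cvgD (cvgZ be cj) (cvgZ ga ck)))).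
Qed.

Lemma bundle_continuous (sg : R) (S : set (phase R)) : sg ^+ 2 = 1 ->
  (forall z, S z -> T1AdS3 z) -> continuous_subbundle S (bundle sg).
Proof.
move=> sg2 ST; split=> [z w Sz|z0 Sz0].
  move=> /(mem_bundle _ _ (ST _ Sz))[u [ux uv] ->]; rewrite /tangent /antidiag /=.
  by split; rewrite /= ?qZr ?qZl ?(qC z.1) ?(qC z.2) ?ux ?uv ?mulr0 ?addr0.
exists 2, setT, (fun i z => antidiag sg (frame (i == ord0) z)); split.
- exact: filterT.
- move=> i; apply: continuous_subspaceT => z.
  by apply: cvg_pairE; [exact: frame_continuous|apply: cvgZ; [exact: cvg_cst|exact: frame_continuous]].
- by move=> z Sz _; rewrite /basis_of eqxx; apply: frame_free; exact: ST.
Qed.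

End Frame.

Lemma derive1_lim {R : realType} {V : normedModType R} (f : R -> V) (a : R) (l : V) :
  h^-1 *: (f (h + a) - f a) @[h --> (0 : R)^'] --> l -> derive1 f a = l.
Proof. by move=> fl; rewrite /derive1; apply: cvg_lim fl; exact: norm_hausdorff. Qed.

(** * The generator and the splitting of the tangent space *)

Section Generator.
Context {R : realType}.
Implicit Types (z w : phase R).

Lemma is_derive_expRN0 : is_derive (0 : R) (1 : R) (fun t => expR (- t)) (-1).
Proof.
have d : is_derive (0 : R) (1 : R) (fun t : R => - t) (-1) by exact: is_deriveN.
have := is_derive1_comp (is_derive_expR (- 0 : R)) d.
by rewrite oppr0 expR0 mul1r.
Qed.

Lemma flow_generatorE z : flow_generator z = (z.2, z.1).
Proof.
have dE : is_derive (0 : R) (1 : R) expR 1 by have := is_derive_expR (0 : R); rewrite expR0.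
have quot (f : R -> R) (d : R) : is_derive (0 : R) (1 : R) f d ->
    h^-1 * (f h - f 0) @[h --> (0 : R)^'] --> d.
  move=> [df <-].
  have : cvg (h^-1 *: ((f \o shift (0 : R)) (h *: (1 : R)) - f 0) @[h --> (0 : R)^']) by exact: df.
  rewrite /derive.
  have -> : (fun h : R => h^-1 *: ((f \o shift (0 : R)) (h *: (1 : R)) - f 0)) =
      (fun h => h^-1 * (f h - f 0)).
    by apply/funext => h; rewrite /= addr0 -[h *: 1]/(h * 1) mulr1.
  exact.
have qe := quot _ _ dE; have qn := quot _ _ is_derive_expRN0.
apply: derive1_lim.
have qc : h^-1 * (cosh h - 1) @[h --> (0 : R)^'] --> (0 : R).
  have -> : (fun h : R => h^-1 * (cosh h - 1)) =
      (fun h => 2^-1 * (h^-1 * (expR h - expR 0) + h^-1 * (expR (- h) - expR (- 0)))).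
    by apply/funext => h; rewrite /cosh oppr0 expR0; move: (h^-1) => i; field.
  have := cvgM (cvg_cst (2^-1 : R)) (cvgD qe qn); rewrite subrr mulr0; exact.
have qs : h^-1 * sinh h @[h --> (0 : R)^'] --> (1 : R).
  have -> : (fun h : R => h^-1 * sinh h) =
      (fun h => 2^-1 * (h^-1 * (expR h - expR 0) - h^-1 * (expR (- h) - expR (- 0)))).
    by apply/funext => h; rewrite /sinh oppr0 expR0; move: (h^-1) => i; field.
  have e2 : 2^-1 * (1 - -1) = 1 :> R by rewrite opprK; field.
  have := cvgM (cvg_cst (2^-1 : R)) (cvgB qe qn); rewrite e2; exact.
have -> : (fun h : R => h^-1 *: (flow (h + 0) z - flow 0 z)) =
   (fun h => ((h^-1 * (cosh h - 1)) *: z.1 + (h^-1 * sinh h) *: z.2,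
              (h^-1 * sinh h) *: z.1 + (h^-1 * (cosh h - 1)) *: z.2)).
  apply/funext => h; rewrite addr0 flow0 /flow; case: z => x v /=.
  by congr pair; apply/matrixP => i j; rewrite !mxE; ring.
have lc (x : 'cV[R]_4) : (h^-1 * (cosh h - 1)) *: x @[h --> (0 : R)^'] --> (0 : 'cV[R]_4).
  by rewrite -(scale0r x); apply: cvgZ => //; exact: cvg_cst.
have ls (x : 'cV[R]_4) : (h^-1 * sinh h) *: x @[h --> (0 : R)^'] --> x.
  by rewrite -[X in _ --> X](scale1r x); apply: cvgZ => //; exact: cvg_cst.
apply: cvg_pairE => /=.
  rewrite -[X in _ --> X]add0r; exact: (cvgD (lc _) (ls _)).
rewrite -[X in _ --> X]addr0; exact: (cvgD (ls _) (lc _)).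
Qed.

Lemma tangent_splitting z : T1AdS3 z ->
  directv (<[flow_generator z]> + bundle 1 z + bundle (-1) z) /\
  forall w, w \in (<[flow_generator z]> + bundle 1 z + bundle (-1) z)%VS <-> tangent z w.
Proof.
move=> Tz; have [xx xv vv] := Tz; rewrite flow_generatorE; split.
  rewrite !directv_addE/= !directv_trivial/=.
  (* Pairing first components with [z.2] gives [k = 0]; then [u = u'] and [- u = u']. *)
  have key (k : R) u u' : orthogonal_to z u -> orthogonal_to z u' ->
      k *: (z.2, z.1) + antidiag 1 u = antidiag (-1) u' -> k = 0 /\ u = 0.
    move=> [ux uv] [ux' uv'] [e1 e2].
    have k0 : k = 0.
      have := qDl (k *: z.2) u z.2; rewrite e1 uv' uv qZl vv; lra.
    split => //; move: e1 e2; rewrite k0 !scale0r !add0r !scaleN1r opprK scale1r => -> e.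
    have : u' + u' = 0 by rewrite -{1}e addNr.
    by rewrite -mulr2n -scaler_nat => /eqP; rewrite scaler_eq0 pnatr_eq0 => /eqP.
  apply/andP; split.
    rewrite -subv0; apply/subvP => w; rewrite memv_cap => /andP[/vlineP[k ->]].
    move=> /(mem_bundle _ _ Tz)[u [ux uv] E].
    have u0 : orthogonal_to z 0 by rewrite /orthogonal_to !q0l.
    have ou : orthogonal_to z (- u) by split; rewrite qNl ?ux ?uv oppr0.
    have E' : k *: (z.2, z.1) + antidiag 1 (- u) = antidiag (-1) 0.
      rewrite E /antidiag scaler0; congr pair; first exact: subrr.
      by rewrite scalerN; exact: subrr.
    by have [-> _] := key _ _ _ ou u0 E'; rewrite scale0r mem0v.
  rewrite -subv0; apply/subvP => w; rewrite memv_cap => /andP[/memv_addP[_ /vlineP[k ->] [w' Ew' ->]]].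
  move: Ew' => /(mem_bundle _ _ Tz)[u ou ->] /(mem_bundle _ _ Tz)[u' ou' E].
  have [k0 u0] := key _ _ _ ou ou' E.
  by rewrite k0 u0 scale0r add0r /antidiag scaler0 mem0v.
move=> w; split.
  move=> /memv_addP[_ /memv_addP[_ /vlineP[k ->] [w1 E1 ->]] [w2 E2 ->]].
  move: E1 E2 => /(mem_bundle _ _ Tz)[u [ux uv] ->] /(mem_bundle _ _ Tz)[u' [ux' uv'] ->].
  rewrite /tangent /antidiag /=; split; rewrite !qlin ?(qC z.1 u) ?(qC z.1 u') ?(qC z.2 u) ?(qC z.2 u')
    ?(qC z.2 z.1) ?ux ?uv ?ux' ?uv' ?xx ?xv ?vv; ring.
case: w => w1 w2 [/= h1 h2 h3].
(* Subtracting [k] times the generator leaves [(a, b)] with both entries orthogonal to [z]; its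
   stable and unstable parts come from [(a - b) / 2] and [(a + b) / 2]. *)
pose k := q w1 z.2; pose a := w1 - k *: z.2; pose b := w2 - k *: z.1.
have oa : orthogonal_to z a.
  split; rewrite /a qBl qZl; first by rewrite (qC w1) h1 (qC z.2) xv; ring.
  by rewrite vv /k; ring.
have ob : orthogonal_to z b.
  split; rewrite /b qBl qZl.
    by rewrite xx (qC w2) /k; lra.
  by rewrite xv (qC w2) h3; ring.
have oc (c d : R) : orthogonal_to z (c *: a + d *: b).
  by move: oa ob => [a1 a2] [b1 b2]; split; rewrite qDl !qZl ?a1 ?a2 ?b1 ?b2 !mulr0 addr0.
apply/memv_addP; exists (k *: (z.2, z.1) + antidiag 1 (2^-1 *: a + (- 2^-1) *: b)).
  apply/memv_addP; exists (k *: (z.2, z.1)); first by apply/vlineP; exists k.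
  eexists; last by []. by apply/mem_bundle => //; eexists; last by [].
exists (antidiag (-1) (2^-1 *: a + 2^-1 *: b)).
  by apply/mem_bundle => //; eexists; last by [].
by rewrite /antidiag /a /b; congr pair; apply/matrixP => i j; rewrite !mxE /=; field.
Qed.

Lemma bundle_act (sg : R) (A : 'M[R]_4) z w : isom A -> T1AdS3 z ->
  w \in bundle sg z -> act A w \in bundle sg (act A z).
Proof.
move=> iA Tz /(mem_bundle _ _ Tz)[u ou ->]; apply/mem_bundle; first exact: T1_act.
by exists (A *m u); [exact: orthogonal_act|rewrite act_antidiag].
Qed.

Lemma bundle_flow (sg : R) t z w : sg ^+ 2 = 1 -> T1AdS3 z ->
  w \in bundle sg z -> flow t w \in bundle sg (flow t z).
Proof.
move=> sg2 Tz /(mem_bundle _ _ Tz)[u [ux uv] ->]; apply/mem_bundle; first exact: T1_flow.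
exists (expR (- (sg * t)) *: u).
  by split; rewrite /flow/= qZl qDr !qZr ux uv !mulr0 addr0 mulr0.
have -> : flow t (antidiag sg u) = flow (sg * (sg * t)) (antidiag sg u).
  by rewrite mulrA -expr2 sg2 mul1r.
by rewrite flow_antidiag// antidiagZ.
Qed.

End Generator.

(** * Hyperbolicity of the non-wandering set *)

Section Hyperbolic.
Context {R : realType} (G : subgroup22 R) (L : set 'cV[R]_4).
Hypothesis aL : acausal_circle L.
Hypothesis GL : forall A, sg_set G A -> bd_act A @` L = L.
Hypothesis Gpd : acts_properly_discontinuously G (convex_core L).
Hypothesis Gcc : acts_cocompactly G (convex_core L).

Local Notation NW := (non_wandering (@qflow R G L)).

Lemma lift_non_wandering z : lift_set NW z -> limit_geodesics L z.
Proof. by move=> [y NWy <-]; exact: (non_wandering_limit_geodesics aL GL NWy). Qed.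

Lemma lift_T1 z : lift_set NW z -> T1AdS3 z.
Proof. by move=> /lift_non_wandering[]. Qed.

Lemma bundle_invariant (sg : R) : sg ^+ 2 = 1 ->
  [/\ continuous_subbundle (lift_set NW) (bundle sg),
      G_invariant G (lift_set NW) (bundle sg) & flow_invariant (lift_set NW) (bundle sg)].
Proof.
move=> sg2; split; first by apply: bundle_continuous => //; exact: lift_T1.
- move=> A z w GA /lift_T1 Tz; rewrite diff_act; apply/idP/idP.
    by apply: bundle_act => //; exact: sg_isom GA.
  have TA : T1AdS3 (act A z) by apply: T1_act => //; exact: sg_isom GA.
  move=> /(bundle_act (sg_isom (sg_adjq GA)) TA).
  by rewrite !act_mul (sg_mulK GA) !act_one.
- move=> t z w /lift_T1 Tz; rewrite diff_flow; apply/idP/idP; first exact: bundle_flow.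
  move=> /(bundle_flow (- t) sg2 (T1_flow t Tz)).
  by rewrite !flowNK.
Qed.

(** The constants may be weakened, so that both bundles can share a maximum of the [C] and a minimum
    of the [c]. *)
Lemma bundle_contraction (sg : R) : sg ^+ 2 = 1 -> exists C c : R, [/\ 0 < C, 0 < c &
  forall C' c' z w t, C <= C' -> 0 <= c' <= c -> lift_set NW z -> w \in bundle sg z -> 0 <= t ->
    Num.sqrt (metric G (flow (sg * t) z) ('d (flow (sg * t)) z w) ('d (flow (sg * t)) z w))
      <= C' * expR (- (c' * t)) * Num.sqrt (metric G z w w)].
Proof.
move=> sg2; have [C [c [C0 c0 H]]] := exponential_contraction aL GL Gpd Gcc sg2.
exists C, c; split => // C' c' z w t CC /andP[c'0 cc] /lift_non_wandering Sz Ew t0.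
have Tz := limit_geodesics_T1 Sz; have Mz := limit_geodesics_Mtilde aL Sz.
move: Ew => /(mem_bundle _ _ Tz)[u ou ->].
rewrite diff_flow flow_antidiag// -antidiagZ -/(mnorm2 G sg _ _) -/(mnorm2 G sg _ _).
have Ce0 : 0 <= C * expR (- (c * t)) by rewrite mulr_ge0 ?expR_ge0 ?(ltW C0).
apply: (@le_trans _ _ (C * expR (- (c * t)) * Num.sqrt (mnorm2 G sg z u))).
  rewrite -[X in X * Num.sqrt _](ger0_norm Ce0) -sqrtr_sqr -sqrtrM ?sqr_ge0//.
  by rewrite ler_wsqrtr// H.
rewrite ler_wpM2r ?sqrtr_ge0// ler_pM ?expR_ge0 ?(ltW C0)//.
by rewrite ler_expR lerN2 ler_wpM2r.
Qed.

Lemma non_wandering_hyperbolic : hyperbolic NW.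
Proof.
split; [exact: non_wandering_compact aL GL Gcc|exact: (non_wandering_invariant aL GL)|].
have s1 : (1 : R) ^+ 2 = 1 by rewrite expr1n.
have sN1 : (-1 : R) ^+ 2 = 1 by rewrite sqrrN expr1n.
have [C1 [c1 [C10 c10 H1]]] := bundle_contraction s1.
have [C2 [c2 [C20 c20 H2]]] := bundle_contraction sN1.
exists (bundle 1), (bundle (-1)), (metric G), (Num.max C1 C2), (Num.min c1 c2).
have c0 : 0 < Num.min c1 c2 by rewrite lt_min c10 c20.
split.
- exact: bundle_invariant.
- exact: bundle_invariant.
- by move=> z /lift_T1; exact: tangent_splitting.
- by split => //; [exact: metric_Riemannian|rewrite lt_max C10].
split=> z w t Sz Ew t0.
  have := H1 (Num.max C1 C2) (Num.min c1 c2) z w t; rewrite mul1r; apply => //.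
    by rewrite le_max lexx.
  by rewrite (ltW c0)/= ge_min lexx.
(* Backward time on the unstable bundle is [flow (-1 * - t)] with [- t >= 0]. *)
have := H2 (Num.max C1 C2) (Num.min c1 c2) z w (- t).
rewrite mulrNN mul1r ler0_norm//; apply => //.
- by rewrite le_max lexx orbT.
- by rewrite (ltW c0)/= ge_min lexx orbT.
- by rewrite oppr_ge0.
Qed.

End Hyperbolic.

Theorem proposition4p14 (R : realType) (Gamma : subgroup22 R)
    (Lambda : set 'cV[R]_4) :
  quasi_Fuchsian Gamma Lambda -> Axiom_A Gamma Lambda.
Proof.
move=> [aL GL _ Gpd Gcc]; split.
- exact: (non_wandering_compact aL GL Gcc).
- exact: (non_wandering_hyperbolic aL GL Gpd Gcc).
- exact: (non_wandering_periodic aL GL).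
Qed.
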